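(* For all integers $d,H$ there exist constants $A=A(d,H)$, $B=B(d,H)$ such that the following holds for every finite field $\mathbb F=\mathbb F_q$ with $\operatorname{char}(\mathbb F)>d$, every nontrivial additive character $\chi$ of $\mathbb F$, every $n$ and every $s>0$. If $\mathcal Q$ is an $(A,B,s)$-regular tower of polynomials in $\mathbb F[x_1,\dots,x_n]$ of degree $\le d$ and height $\le H$, and $P\in\mathbb F[x_1,\dots,x_n]$ is a polynomial of degree $\le d$ with $$bias_{Z(\mathcal Q)}(P)\ge q^{-s},$$ then $$rk_{\mathcal Q}(P)\le A(1+s)^B .$$
   Context: For a finite set $E$, $\mathbb E_{x\in E}:=\frac1{|E|}\sum_{x\in E}$, with $\mathbb E_{x\in\emptyset}=0$. For $X\subset\mathbb F^n$ and $P:\mathbb F^n\to\mathbb F$, $bias_X(P)=|\mathbb E_{x\in X}\chi(P(x))|$. $Z(\mathcal Q)\subset\mathbb F^n$ is the set of common zeros of all polynomials in $\mathcal Q$. For a polynomial $P$ of degree $e$, $\tilde P$ is its homogeneous component of degree $e$ ($\tilde 0=0$); for a collection, $\tilde{\mathcal Q}=(\tilde Q_i)_i$. Schmidt rank: for a homogeneous polynomial $P$, $rk(P)$ is the minimal $r$ such that $P=\sum_{i=1}^r Q_iR_i$ with all $Q_i,R_i$ homogeneous of degree $<\deg(P)$ ($rk(0)=0$; $rk(P)=\infty$ if there is no such presentation, e.g. for a nonzero linear form). Convention: constants have rank $0$. For general $P$, $rk(P)=rk(\tilde P)$. Relative rank: for homogeneous $P$ and a collection $\mathcal Q=(Q_1,\dots,Q_m)$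 of homogeneous polynomials, $$rk_{\mathcal Q}(P)=\min\Big\{rk\Big(P+\sum_{i=1}^m R_iQ_i\Big): \deg(R_i)+\deg(Q_i)\le\deg(P)\ \forall i\Big\}$$ over polynomials $R_i$ (so $R_i=0$ whenever $\deg(Q_i)>\deg(P)$). For general polynomials, $rk_{\mathcal Q}(P):=rk_{\tilde{\mathcal Q}}(\tilde P)$. For a collection $\mathcal P=(P_i)_{i\in[m]}$, $rk_{\mathcal Q}(\mathcal P)=\min\{rk_{\mathcal Q}(a\cdot\tilde{\mathcal P}): 0\ne a\in\mathbb F^m\}$, where $a\cdot\tilde{\mathcal P}=\sum_i a_i\tilde P_i$. A (polynomial) tower $\mathcal Q=(\mathcal Q_i)_{i\in[h]}$ of height $h$ consists of $h$ collections (layers) $\mathcal Q_i=(Q_{i,j})_{j\in[m_i]}$ of polynomials, where all polynomials in the $i$-th layer have the same degree $d_i$. Its degree is $\max(d_1,\dots,d_h)$, its dimension is $m_1+\dots+m_h$, and $\mathcal Q_{<i}=(\mathcal Q_j)_{j\in[i-1]}$ (regarded as a collection of polynomials when taking relative rank). The tower is $(A,B,s)$-regular if for every $i\in[h]$, $rk_{\mathcal Q_{<i}}(\mathcal Q_i)>A(m_i+m_{i+1}+\dots+m_h+s)^B$. *)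

(* Defs.v *)
From HB Require Import structures.
From mathcomp Require Import all_boot all_order all_algebra.
From mathcomp Require Import complex.
From mathcomp Require Import boolp classical_sets reals constructive_ereal ereal exp.
(* mpoly's notations clash with those of MathComp-Analysis, hence -(notations). *)
From mathcomp Require Import -(notations) mpoly.

Set Implicit Arguments.
Unset Strict Implicit.
Unset Printing Implicit Defensive.

Import Order.TTheory GRing.Theory Num.Theory.
Local Open Scope ring_scope.

Notation "{ 'mpoly' T [ n ] }" := (mpoly n T) : type_scope.

(* tdeg 0 = 0. *)
Definition tdeg (F : fieldType) (n : nat) (P : {mpoly F[n]}) : nat :=
  (mmeasure mdeg P).-1.

Definition lform (F : fieldType) (n : nat) (P : {mpoly F[n]}) : {mpoly F[n]} :=
  pihomog mdeg (tdeg P) P.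

Definition schmidt_presentation (F : fieldType) (n : nat) (P : {mpoly F[n]})
    (r : nat) : Prop :=
  exists S T : 'I_r -> {mpoly F[n]},
    (forall i, [/\ S i \is ishomog mdeg, (tdeg (S i) < tdeg P)%N,
                   T i \is ishomog mdeg & (tdeg (T i) < tdeg P)%N]) /\
    P = \sum_(i < r) S i * T i.

(* Ranks live in N \cup {+oo}, seen inside \bar R, so each infimum below is a
   minimum, or +oo when there is no candidate. *)
Definition rk_homog (R : realType) (F : fieldType) (n : nat) (P : {mpoly F[n]})
    : \bar R :=
  if tdeg P == 0%N then 0%E
  else ereal_inf [set (r%:R)%:E | r in schmidt_presentation P]%classic.

Definition rk (R : realType) (F : fieldType) (n : nat) (P : {mpoly F[n]})
    : \bar R := rk_homog R (lform P).

(* The zero polynomial has degree -oo, so T i = 0 is always admissible, and it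
   is the only choice when the degree of Q`_i exceeds that of P. *)
Definition rel_rk_homog (R : realType) (F : fieldType) (n : nat)
    (Q : seq {mpoly F[n]}) (P : {mpoly F[n]}) : \bar R :=
  ereal_inf [set rk R (P + \sum_(i < size Q) T i * Q`_i) |
    T in [set T : 'I_(size Q) -> {mpoly F[n]} | forall i,
      T i = 0 \/ (tdeg (T i) + tdeg (Q`_i)%R <= tdeg P)%N]]%classic.

Definition rel_rk (R : realType) (F : fieldType) (n : nat)
    (Q : seq {mpoly F[n]}) (P : {mpoly F[n]}) : \bar R :=
  rel_rk_homog R [seq lform q | q <- Q] (lform P).

Definition rel_rk_seq (R : realType) (F : fieldType) (n : nat)
    (Q Ps : seq {mpoly F[n]}) : \bar R :=
  ereal_inf [set rel_rk R Q (\sum_(i < size Ps) a i *: lform Ps`_i) |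
    a in [set a : {ffun 'I_(size Ps) -> F} | a != 0]]%classic.

Record tower (F : fieldType) (n : nat) := Tower {
  layers :> seq (seq {mpoly F[n]});
  layers_same_tdeg :
    forall L, L \in layers -> {in L &, forall p q, tdeg p = tdeg q}
}.

Definition tower_height (F : fieldType) (n : nat) (Q : tower F n) : nat :=
  size Q.

Definition tower_polys (F : fieldType) (n : nat) (Q : tower F n)
    : seq {mpoly F[n]} := flatten Q.

Definition tower_degree (F : fieldType) (n : nat) (Q : tower F n) : nat :=
  \max_(p <- tower_polys Q) tdeg p.

(* With layers numbered from 0, flatten (take i Q) is the collection of the
   layers before the i-th one, and size (flatten (drop i Q)) is the number of
   polynomials in the i-th and all later layers. *)
Definition tower_regular (R : realType) (F : fieldType) (n : nat) (A B s : R)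
    (Q : tower F n) : Prop :=
  forall i, (i < tower_height Q)%N ->
    ((A * ((size (flatten (drop i Q)))%:R + s) `^ B)%:E
       < rel_rk_seq R (flatten (take i Q)) (nth [::] Q i))%E.

Definition zeros (F : finFieldType) (n : nat) (Q : seq {mpoly F[n]})
    : {set {ffun 'I_n -> F}} :=
  [set x : {ffun 'I_n -> F} | all (fun q => meval x q == 0) Q].

(* Equal to 0 on the empty set, as 0^-1 = 0. *)
Definition average (R : realType) (T : finType) (E : {set T}) (f : T -> R[i])
    : R[i] := #|E|%:R^-1 * \sum_(x in E) f x.

Definition additive_character (R : realType) (F : finFieldType)
    (chi : F -> R[i]) : Prop :=
  chi 0 = 1 /\ {morph chi : x y / x + y >-> x * y}.

Definition nontrivial_character (R : realType) (F : finFieldType)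
    (chi : F -> R[i]) : Prop := exists x, chi x != 1.

Definition bias (R : realType) (F : finFieldType) (chi : F -> R[i]) (n : nat)
    (X : {set {ffun 'I_n -> F}}) (P : {mpoly F[n]}) : R :=
  Normc.normc (average X (fun x => chi (meval x P))).

(* Main.v *)
(** Replace every polynomial of degree e by its polar forms, the e-linear forms
    obtained by e-fold differencing in e of K = d + 1 directions.  A regular tower
    of polynomials becomes a regular tower of multilinear forms on subsets of
    {1, ..., K}; conversely a decomposition of a polar form yields one of the
    leading form, by restriction to the diagonal and division by e!, which is
    where char F > d enters.

    For multilinear forms, bias relative to a regular tower bounds the relative
    rank.  This goes by induction on the number of coordinates, on the number of
    coordinates met by the tower, and on its height.  A biased form P differs from
    a form biased on the lower layers by a combination of the top layer, so the
    induction on the height writes P as a sum of few products modulo the tower.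
    Adding one factor of each product to the tower and regularizing puts P in the
    ideal of a larger tower, whose new layers are removed one at a time: a biased
    sum of a_j B_j with a_j equidistributed is a biased form in the a_j and in the
    variables of the B_j, hence of fewer coordinates.  Without a tower, a biased P
    vanishes on the zeros of few forms in fewer variables (chosen at random),
    and a Nullstellensatz, the case t = 0 of the induction, bounds its rank.

    Equidistribution of the towers of polynomials and the passage from the bias of
    a polynomial to that of its polar forms are proved by a simultaneous induction
    on the height, counting cubes and using the Cauchy-Schwarz inequality once for
    each direction. *)

(* For multilinear forms everything is real and elementary: where the argument of a character is
   linear in a coordinate, the character may be averaged over the nonzero multiples of that
   argument. This gives [psi], whose sums over systems of forms are non-negative and obey one
   correlation inequality. Lower bounds for densities of systems of forms need no regularity; only
   upper bounds do.

   The obstacle is termination. Removing a layer on a set A of coordinates trades A for a single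
   coordinate, a gain only if A has two elements or more. The new layers are therefore made to meet
   the coordinates of the tower, so that a singleton A takes a coordinate from the tower instead;
   hence the triple (k, c, h).

   For polynomials, the second moment of the cube counts involves a new system, the values at the
   vertices of a cube. It is again a tower of the same height, and inherits regularity, so the
   induction on the height closes. Since it counts cubes in e + 1 directions for a polynomial of
   degree e, d + 1 directions are provided. *)
From HB Require Import structures.
From mathcomp Require Import all_boot all_order all_algebra.
From mathcomp Require Import boolp.
From mathcomp Require Import zify ring lra.

Set Implicit Arguments.
Unset Strict Implicit.
Unset Printing Implicit Defensive.

Import Order.TTheory GRing.Theory Num.Theory.
Local Open Scope ring_scope.

(** * Averages *)

Section Average.
Variable R : numFieldType.

Definition avg (T : finType) (f : T -> R) : R := (#|T|%:R)^-1 * \sum_x f x.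

Lemma eq_avg (T : finType) (f g : T -> R) : f =1 g -> avg f = avg g.
Proof. by move=> e; rewrite /avg (eq_bigr _ (fun x _ => e x)). Qed.

Lemma avgD (T : finType) (f g : T -> R) : avg (fun x => f x + g x) = avg f + avg g.
Proof. by rewrite /avg big_split /= mulrDr. Qed.

Lemma avgZ (T : finType) (c : R) (f : T -> R) : avg (fun x => c * f x) = c * avg f.
Proof. by rewrite /avg -mulr_sumr mulrCA. Qed.

Lemma avgZr (T : finType) (c : R) (f : T -> R) : avg (fun x => f x * c) = avg f * c.
Proof. by rewrite /avg -mulr_suml mulrA. Qed.

Lemma avgN (T : finType) (f : T -> R) : avg (fun x => - f x) = - avg f.
Proof. by rewrite /avg sumrN mulrN. Qed.

Lemma avgB (T : finType) (f g : T -> R) : avg (fun x => f x - g x) = avg f - avg g.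
Proof. by rewrite avgD avgN. Qed.

Lemma avg_sum (T I : finType) (f : I -> T -> R) :
  avg (fun x => \sum_i f i x) = \sum_i avg (f i).
Proof. by rewrite /avg exchange_big /= mulr_sumr. Qed.

Lemma avg_exch (T U : finType) (f : T -> U -> R) :
  avg (fun x => avg (fun y => f x y)) = avg (fun y => avg (fun x => f x y)).
Proof.
rewrite /avg -!mulr_sumr exchange_big /= mulrCA; congr (_ * _); congr (_ * _).
Qed.

Lemma avg_pair (T U : finType) (f : T -> U -> R) :
  avg (fun p : T * U => f p.1 p.2) = avg (fun x => avg (fun y => f x y)).
Proof.
rewrite /avg card_prod natrM invfM -mulrA; congr (_ * _).
by rewrite -mulr_sumr; congr (_ * _); rewrite pair_big.
Qed.

Lemma avg_bij (T U : finType) (h : T -> U) (f : U -> R) :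
  bijective h -> avg (fun x => f (h x)) = avg f.
Proof.
move=> bh; rewrite /avg (bij_eq_card bh); congr (_ * _).
by rewrite [RHS](reindex h) //; apply: onW_bij.
Qed.

Lemma avg_const (T : finType) (x0 : T) (c : R) : avg (fun _ : T => c) = c.
Proof.
rewrite /avg sumr_const -[c *+ _]mulr_natl mulrA mulVf ?mul1r //.
by rewrite pnatr_eq0 -lt0n; apply/card_gt0P; exists x0.
Qed.

Lemma ler_avg (T : finType) (f g : T -> R) :
  (forall x, f x <= g x) -> avg f <= avg g.
Proof.
move=> le; rewrite ler_wpM2l ?invr_ge0 ?ler0n //; exact: ler_sum.
Qed.

Lemma avg_ge0 (T : finType) (f : T -> R) : (forall x, 0 <= f x) -> 0 <= avg f.
Proof.
by move=> le; rewrite mulr_ge0 ?invr_ge0 ?ler0n // sumr_ge0.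
Qed.

Lemma avg_le1 (T : finType) (f : T -> R) : (forall x, f x <= 1) -> avg f <= 1.
Proof.
move=> le; case: (pickP (@predT T)) => [x0 _|no].
  by rewrite -[leRHS](avg_const x0); apply: ler_avg.
by rewrite /avg big1 ?mulr0 ?ler01 // => x; have := no x.
Qed.

Lemma ler_norm_avg (T : finType) (f : T -> R) : `|avg f| <= avg (fun x => `|f x|).
Proof.
rewrite /avg normrM ger0_norm ?invr_ge0 ?ler0n // ler_wpM2l ?invr_ge0 ?ler0n //.
exact: ler_norm_sum.
Qed.

Lemma avg_fst (T U : finType) (u0 : U) (f : T -> R) :
  avg (fun p : T * U => f p.1) = avg f.
Proof.
by rewrite (avg_pair (fun x _ => f x)); apply: eq_avg => x; rewrite avg_const.
Qed.

End Average.

Section RealAverage.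
Variable R : realFieldType.

Lemma avg_exists_ge (T : finType) (x0 : T) (f : T -> R) : exists x, avg f <= f x.
Proof.
apply: contrapT => no.
have lt : forall x, f x < avg f.
  by move=> x; rewrite ltNge; apply/negP => le; apply: no; exists x.
suff: avg f < avg f by rewrite ltxx.
have c0 : 0 < (#|T|%:R : R).
  by rewrite ltr0n; apply/card_gt0P; exists x0.
rewrite {1}/avg ltr_pdivrMl //.
have -> : #|T|%:R * avg f = \sum_(x : T) avg f by rewrite sumr_const mulr_natl.
apply: ltr_sum => //; apply/hasP; exists x0 => //; exact: mem_index_enum.
Qed.

Lemma avg_exists_le (T : finType) (x0 : T) (f : T -> R) : exists x, f x <= avg f.
Proof.
have [x] := avg_exists_ge x0 (fun x => - f x).
by rewrite avgN lerN2; exists x.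
Qed.

End RealAverage.

(** * Tuples of vectors and changes of coordinates *)

Section Points.
Variables (F : finFieldType) (n k : nat).
Local Notation V := 'rV[F]_n.
Local Notation X := {ffun 'I_k -> V}.

Definition upd (x : X) (i : 'I_k) (v : V) : X :=
  [ffun j => if j == i then v else x j].

Definition mix (U : {set 'I_k}) (x w : X) : X :=
  [ffun j => if j \in U then x j else w j].

Lemma upd_same x i : upd x i (x i) = x.
Proof. by apply/ffunP => j; rewrite ffunE; case: eqP => // ->. Qed.

Lemma updK x i u v : upd (upd x i u) i v = upd x i v.
Proof. by apply/ffunP => j; rewrite !ffunE; case: eqP. Qed.

Lemma updE x i v : (upd x i v) i = v.
Proof. by rewrite ffunE eqxx. Qed.

Lemma updC x i j u v : i != j -> upd (upd x i u) j v = upd (upd x j v) i u.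
Proof.
move=> ne; apply/ffunP => l; rewrite !ffunE.
case: (l =P j) => // ->; by rewrite eq_sym (negbTE ne).
Qed.

Lemma upd_add x z i v : upd (x + z) i (v + z i) = upd x i v + z.
Proof. by apply/ffunP => j; rewrite !ffunE; case: eqP => // ->. Qed.

Lemma mix_upd_in (U : {set 'I_k}) x w i v : i \in U -> mix U (upd x i v) w = upd (mix U x w) i v.
Proof.
move=> iU; apply/ffunP => j; rewrite !ffunE; case: (j =P i) => [->|] //.
by rewrite iU.
Qed.

Lemma mix_upd_notin (U : {set 'I_k}) x w i v : i \notin U -> mix U (upd x i v) w = mix U x w.
Proof.
move=> iU; apply/ffunP => j; rewrite !ffunE; case: (j =P i) => [->|] //.
by rewrite (negbTE iU).
Qed.

Lemma mix_upd_out (U : {set 'I_k}) x w i v : i \notin U -> mix U x (upd w i v) = upd (mix U x w) i v.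
Proof.
move=> iU; apply/ffunP => j; rewrite !ffunE; case: (j =P i) => [->|] //.
by rewrite (negbTE iU).
Qed.

Lemma mix_upd_outin (U : {set 'I_k}) x w i v : i \in U -> mix U x (upd w i v) = mix U x w.
Proof.
move=> iU; apply/ffunP => j; rewrite !ffunE; case: (j =P i) => [->|] //.
by rewrite iU.
Qed.

Variable R : numFieldType.

(** Exchanging v with the i-th coordinate of x is an involution of the pairs (x, v), so it preserves
    averages; [avg_mix] holds for the same reason. *)
Lemma avg_upd (i : 'I_k) (f : X -> R) :
  avg f = avg (fun x => avg (fun v => f (upd x i v))).
Proof.
pose h (p : X * V) := (upd p.1 i p.2, p.1 i).
have hK : cancel h h.
  by case=> x v; rewrite /h /= updK upd_same updE.
rewrite -(avg_fst (0 : V) f) -(@avg_bij R _ _ h); last by exists h.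
by rewrite -(avg_pair (fun x v => f (upd x i v))).
Qed.

Lemma avg_mix (U : {set 'I_k}) (f : X -> R) :
  avg f = avg (fun x => avg (fun w => f (mix U x w))).
Proof.
pose h (p : X * X) := (mix U p.1 p.2, mix U p.2 p.1).
have hK : cancel h h.
  by case=> x w; rewrite /h /=; congr pair; apply/ffunP => j; rewrite !ffunE; case: (j \in U).
rewrite -(avg_fst (0 : X) f) -(@avg_bij R _ _ h); last by exists h.
by rewrite -(avg_pair (fun x w => f (mix U x w))).
Qed.

Lemma avg_shift (z : X) (f : X -> R) : avg (fun x : X => f (x + z)) = avg f.
Proof.
apply: (@avg_bij R X X (fun x => x + z) f).
by exists (fun x => x - z) => x; rewrite ?addrK ?subrK.
Qed.

End Points.

(** * The real kernel that replaces a character *)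

Section Psi.
Variables (R : realFieldType) (F : finFieldType).

(* The average of any nontrivial additive character over the F-multiples of an
   argument; it replaces the character in all sums that are linear in a coordinate. *)
Definition psi (a : F) : R := if a == 0 then 1 else - (#|F|.-1%:R)^-1.

Lemma card_F_gt1 : (1 < #|F|)%N.
Proof.
rewrite (cardD1 (0 : F)) (cardD1 (1 : F)) !inE oner_eq0 /=; lia.
Qed.

Lemma psi0 : psi 0 = 1. Proof. by rewrite /psi eqxx. Qed.

Lemma psi_le1 a : psi a <= 1.
Proof.
rewrite /psi; case: ifP => // _; apply: (@le_trans _ _ 0); last exact: ler01.
by rewrite oppr_le0 invr_ge0 ler0n.
Qed.

Lemma sum_psi (b : F) : b != 0 -> forall c, \sum_(a : F) psi (a * b + c) = 0.
Proof.
move=> b0 c; have hinj : injective (fun a : F => a * b + c).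
  by move=> x y /addIr /(mulIf b0).
have -> : \sum_(a : F) psi (a * b + c) = \sum_(a : F) psi a by rewrite [RHS](reindex_inj hinj).
rewrite (bigD1 (0 : F)) //= psi0.
rewrite (eq_bigr (fun=> - (#|F|.-1%:R)^-1)); last by move=> a; rewrite /psi => /negbTE ->.
rewrite sumr_const mulNrn -[X in 1 - X]mulr_natl.
have -> : #|[pred a : F | a != 0]| = #|F|.-1.
  by rewrite [#|F|](cardD1 (0 : F)) /=; apply: eq_card => a; rewrite !inE andbT.
by rewrite divff ?subrr // pnatr_eq0; have := card_F_gt1; lia.
Qed.

Lemma avg_psi_ind (c g : F) : avg (fun b : F => psi (b * g + c)) = (g == 0)%:R * psi c.
Proof.
case: eqP => [->|/eqP g0].
  rewrite mul1r -[RHS](avg_const (0 : F)); by apply: eq_avg => b; rewrite mulr0 add0r.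
by rewrite mul0r /avg sum_psi // mulr0.
Qed.

Variable V : finLmodType F.

Definition lin1 (l : V -> F) := forall a u v, l (a *: u + v) = a * l u + l v.

Lemma lin1D l u v : lin1 l -> l (u + v) = l u + l v.
Proof. by move=> h; rewrite -[u]scale1r h mul1r scale1r. Qed.
Lemma lin10 l : lin1 l -> l 0 = 0.
Proof. by move=> h; have /eqP := lin1D 0 0 h; rewrite addr0 eq_sym -subr_eq0 addrK => /eqP. Qed.
Lemma lin1Z l a u : lin1 l -> l (a *: u) = a * l u.
Proof. by move=> h; rewrite -[a *: u]addr0 h lin10 // addr0. Qed.
Lemma lin1N l u : lin1 l -> l (- u) = - l u.
Proof. by move=> h; rewrite -scaleN1r lin1Z // mulN1r. Qed.

Definition subsp (W : pred V) := forall a u v, W u -> W v -> W (a *: u + v).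

Lemma subspI W W' : subsp W -> subsp W' -> subsp (fun v => W v && W' v).
Proof. by move=> h h' a u v /andP[? ?] /andP[? ?]; rewrite h ?h'. Qed.

Lemma subsp_transl W v0 v : subsp W -> W v0 -> W (v + v0) = W v.
Proof.
move=> h w0; apply/idP/idP => w; last by rewrite -[v]scale1r h.
by have := h (-1) _ _ w0 w; rewrite scaleN1r addrC addrK.
Qed.

Lemma sum_psi_subsp (W : pred V) (l : V -> F) (c : F) : subsp W -> lin1 l ->
  \sum_(v | W v) psi (l v + c) =
  if [forall v, W v ==> (l v == 0)] then #|W|%:R * psi c else 0.
Proof.
move=> hW hl; case: ifP => [/forallP h|/negbT].
  rewrite (eq_bigr (fun=> psi c)); last first.
    by move=> v Wv; have := h v; rewrite Wv => /eqP ->; rewrite add0r.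
  by rewrite sumr_const mulr_natl.
rewrite negb_forall => /existsP[v0]; rewrite negb_imply => /andP[W0 l0].
set S := LHS.
(* Translation by a multiple of v0 preserves W. So S is its own average over a, and after exchanging
   the sums each inner sum vanishes by [sum_psi]. *)
have shift a : S = \sum_(v | W v) psi (a * l v0 + (l v + c)).
  rewrite /S (reindex_inj (addIr (a *: v0))) /=.
  apply: eq_big => [v|v _]; last first.
    by rewrite [v + _]addrC hl addrA.
  have W00 : W 0 by have := hW (-1) _ _ W0 W0; rewrite scaleN1r addNr.
  by rewrite subsp_transl // -[a *: v0]addr0 hW.
have q0 : (#|F|%:R : R) != 0 by rewrite pnatr_eq0; have := card_F_gt1; lia.
apply: (mulfI q0); rewrite mulr0 mulr_natl -sumr_const.
rewrite (eq_bigr (fun a => \sum_(v | W v) psi (a * l v0 + (l v + c)))); last by move=> a _; exact: shift.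
rewrite exchange_big /= big1 // => v _; exact: sum_psi.
Qed.

(** The v with [W v] and [W' (v + z)] form the empty set or a coset of the intersection of W and W'.
    Translating back leaves the same sum, up to the factor [psi] of a constant, which is at most
    1. *)
Lemma subsp_shift_le (W W' : pred V) (l : V -> F) (z : V) (c : F) :
  subsp W -> subsp W' -> lin1 l ->
  \sum_v (W v)%:R * (W' (v + z))%:R * psi (l v + c)
    <= \sum_v (W v)%:R * (W' v)%:R * psi (l v).
Proof.
move=> hW hW' hl.
have ind (A : pred V) (f : V -> R) : \sum_v (A v)%:R * f v = \sum_(v | A v) f v.
  by rewrite [RHS]big_mkcond; apply: eq_bigr => v _; case: (A v); rewrite ?mul1r ?mul0r.
have cnj (a b : bool) : (a%:R * b%:R = (a && b)%:R :> R) by case: a; case: b; rewrite ?mulr1 ?mulr0.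
under eq_bigr do rewrite cnj.
under [leRHS]eq_bigr do rewrite cnj -[l _]addr0.
rewrite (ind (fun v => W v && W' (v + z))) (ind (fun v => W v && W' v)).
rewrite (sum_psi_subsp 0 (subspI hW hW') hl) psi0 mulr1.
case: (pickP (fun v => W v && W' (v + z))) => [v0 /andP[w0 w0']|no]; last first.
  by rewrite big_pred0 //; case: ifP => // _; exact: ler0n.
rewrite (reindex_inj (addIr v0)) /=.
rewrite (eq_bigl (fun v => W v && W' v)); last first.
  by move=> v; rewrite (subsp_transl v hW w0) -addrA (subsp_transl v hW' w0').
rewrite (eq_bigr (fun v => psi (l v + (l v0 + c)))); last first.
  by move=> v _; rewrite lin1D // addrA.
rewrite (sum_psi_subsp _ (subspI hW hW') hl); case: ifP => // _.
by rewrite ler_piMr ?ler0n ?psi_le1.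
Qed.

(** Non-negative combinations of indicators of subspaces: a class of positive definite functions
    that is stable under products and averages and spares the Fourier transform. *)
Definition cone (phi : V -> R) := exists (T : finType) (c : T -> R) (W : T -> pred V),
  [/\ forall a, 0 <= c a, forall a, subsp (W a) &
      forall v, phi v = \sum_a c a * (W a v)%:R].

Lemma cone_const c : 0 <= c -> cone (fun=> c).
Proof.
move=> c0; exists unit, (fun=> c), (fun _ => xpredT); split=> // v.
by rewrite big_const card_unit /= mulr1 addr0.
Qed.

Lemma cone_subsp W : subsp W -> cone (fun v => (W v)%:R).
Proof.
move=> h; exists unit, (fun=> 1), (fun _ => W); split=> // v.
by rewrite big_const card_unit /= mul1r addr0.
Qed.

Lemma cone_eq f g : f =1 g -> cone f -> cone g.
Proof. by move=> e [T [c [W [h1 h2 h3]]]]; exists T, c, W; split=> // v; rewrite -e. Qed.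

Lemma coneM f g : cone f -> cone g -> cone (fun v => f v * g v).
Proof.
move=> [T [c [W [h1 h2 h3]]]] [T' [c' [W' [h1' h2' h3']]]].
exists (T * T')%type, (fun p => c p.1 * c' p.2), (fun p v => W p.1 v && W' p.2 v).
split=> [p|p|v]; first by rewrite mulr_ge0.
  exact: subspI.
rewrite h3 h3' mulr_suml -(pair_big predT predT (fun a b => c a * c' b * (W a v && W' b v)%:R)) /=.
apply: eq_bigr => a _; rewrite mulr_sumr; apply: eq_bigr => b _.
by rewrite mulrACA; congr (_ * _); case: (W a v); case: (W' b v); rewrite ?mulr1 ?mulr0.
Qed.

Lemma cone_avg (T : finType) (f : T -> V -> R) :
  (forall a, cone (f a)) -> cone (fun v => avg (fun a => f a v)).
Proof.
move=> h; have {}h a : exists p : {T0 : finType & ((T0 -> R) * (T0 -> pred V))%type},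
   [/\ forall b, 0 <= (projT2 p).1 b, forall b, subsp ((projT2 p).2 b) &
      forall v, f a v = \sum_b (projT2 p).1 b * ((projT2 p).2 b v)%:R].
  by have [T0 [c [W hh]]] := h a; exists (existT _ T0 (c, W)).
have [p hp] := choice h.
exists {a : T & projT1 (p a)},
  (fun ab => (#|T|%:R)^-1 * (projT2 (p (tag ab))).1 (tagged ab)),
  (fun ab => (projT2 (p (tag ab))).2 (tagged ab)).
split=> [ab|ab|v].
- by rewrite mulr_ge0 ?invr_ge0 ?ler0n //; case: (hp (tag ab)).
- by case: (hp (tag ab)).
rewrite /avg mulr_sumr.
rewrite (eq_bigr (fun a => \sum_b (#|T|%:R)^-1 * (projT2 (p a)).1 b * ((projT2 (p a)).2 b v)%:R)).
  by rewrite sig_big_dep.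
move=> a _; have [_ _ ->] := hp a; rewrite mulr_sumr; apply: eq_bigr => b _.
by rewrite mulrA.
Qed.

Lemma cone_ge0 f v : cone f -> 0 <= f v.
Proof.
by move=> [T [c [W [h1 h2 ->]]]]; apply: sumr_ge0 => a _; rewrite mulr_ge0 ?ler0n.
Qed.

Lemma cone_shift_le (f f' : V -> R) (l : V -> F) (z : V) (c : F) :
  cone f -> cone f' -> lin1 l ->
  avg (fun v => f v * f' (v + z) * psi (l v + c)) <= avg (fun v => f v * f' v * psi (l v)).
Proof.
move=> [T [b [W [h1 h2 h3]]]] [T' [b' [W' [h1' h2' h3']]]] hl.
have ex (g : V -> V) (p : V -> R) :
   \sum_v f v * f' (g v) * p v =
   \sum_a \sum_a' b a * b' a' * \sum_v (W a v)%:R * (W' a' (g v))%:R * p v.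
  under eq_bigr => v _.
    rewrite h3 h3' mulr_suml mulr_suml.
    under eq_bigr do rewrite mulr_sumr mulr_suml.
    over.
  rewrite exchange_big /=; apply: eq_bigr => a _.
  rewrite exchange_big /=; apply: eq_bigr => a' _.
  rewrite mulr_sumr; apply: eq_bigr => v _; ring.
rewrite ler_wpM2l ?invr_ge0 ?ler0n //.
rewrite (ex (fun v => v + z) (fun v => psi (l v + c))) (ex id (fun v => psi (l v))).
apply: ler_sum => a _; apply: ler_sum => a' _.
rewrite ler_wpM2l ?mulr_ge0 //; exact: subsp_shift_le.
Qed.

Lemma cone_psi_shift (f : V -> R) (l : V -> F) (c : F) :
  cone f -> lin1 l ->
  avg (fun v => f v * psi (l v + c)) = psi c * avg (fun v => f v * psi (l v)).
Proof.
move=> [T [b [W [h1 h2 h3]]]] hl.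
have ex (p : V -> R) :
   \sum_v f v * p v = \sum_a b a * \sum_(v | W a v) p v.
  under eq_bigr => v _ do rewrite h3 mulr_suml.
  rewrite exchange_big /=; apply: eq_bigr => a _.
  rewrite mulr_sumr [RHS]big_mkcond /=; apply: eq_bigr => v _.
  by case: (W a v); rewrite ?mulr1 ?mulr0 ?mul0r.
rewrite -avgZ /avg; congr (_ * _).
rewrite (ex (fun v => psi (l v + c))).
rewrite -mulr_sumr (ex (fun v => psi (l v))) mulr_sumr; apply: eq_bigr => a _.
rewrite mulrCA; congr (_ * _).
rewrite (sum_psi_subsp c (h2 a) hl).
rewrite (eq_bigr (fun v => psi (l v + 0))); last by move=> v _; rewrite addr0.
rewrite (sum_psi_subsp 0 (h2 a) hl); case: ifP => _; last by rewrite mulr0.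
by rewrite psi0 mulr1 mulrC.
Qed.

(** Replacing [l v] by [l v + 1] multiplies the average by [psi 1], which is negative, and does not
    increase it by [cone_shift_le]. Hence the average is not negative. *)
Lemma cone_psi_ge0 (f : V -> R) (l : V -> F) :
  cone f -> lin1 l -> 0 <= avg (fun v => f v * psi (l v)).
Proof.
move=> hf hl; have := @cone_shift_le f (fun=> 1) l 0 1 hf (cone_const ler01) hl.
have -> : avg (fun v => f v * 1 * psi (l v + 1)) = psi 1 * avg (fun v => f v * psi (l v)).
  by rewrite -cone_psi_shift //; apply: eq_avg => v; rewrite mulr1.
have -> : avg (fun v => f v * 1 * psi (l v)) = avg (fun v => f v * psi (l v)).
  by apply: eq_avg => v; rewrite mulr1.
rewrite {1}/psi oner_eq0 mulNr; set A := avg _; set c := _^-1 => h.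
have c0 : 0 <= c by rewrite invr_ge0 ler0n.
have : 0 <= (1 + c) * A by move: h; rewrite mulrDl mul1r -subr_ge0 opprK addrC.
by rewrite pmulr_rge0 // ltr_wpDr.
Qed.

End Psi.

(** * The correlation inequality *)

Section Correlation.
Variables (R : realFieldType) (F : finFieldType) (n k : nat).
Local Notation V := 'rV[F]_n.
Local Notation X := {ffun 'I_k -> V}.
Local Notation psi := (@psi R F).

Definition pd_at (i : 'I_k) (f : X -> R) := forall x, cone (fun v => f (upd x i v)).
Definition lin_at (i : 'I_k) (g : X -> F) := forall x, lin1 (fun v => g (upd x i v)).
Definition cst_at (T : Type) (i : 'I_k) (f : X -> T) := forall x v, f (upd x i v) = f x.

Lemma chain_le (Phi : X -> R) :
  (forall z i, Phi z <= Phi (upd z i 0)) -> forall z, Phi z <= Phi 0.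
Proof.
move=> h z.
have key (s : seq 'I_k) : Phi z <= Phi [ffun j => if j \in s then 0 else z j].
  elim: s => [|i s IH]; first by rewrite (_ : finfun _ = z) //; apply/ffunP => j; rewrite ffunE.
  apply: (le_trans IH); apply: (le_trans (h _ i)).
  rewrite le_eqVlt; apply/orP; left; apply/eqP; congr Phi.
  by apply/ffunP => j; rewrite !ffunE inE; case: eqP.
have := key (enum 'I_k); rewrite (_ : finfun _ = 0) //.
by apply/ffunP => j; rewrite !ffunE mem_enum.
Qed.

Lemma psi_factor (f : X -> R) (g : X -> F) (i : 'I_k) (c : F) :
  pd_at i f -> lin_at i g ->
  avg (fun x => f x * psi (g x + c)) = psi c * avg (fun x => f x * psi (g x)).
Proof.
move=> hf hg; rewrite (avg_upd i) [in RHS](avg_upd i) -avgZ.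
by apply: eq_avg => x; rewrite cone_psi_shift.
Qed.

Lemma pd_psi_ge0 (f : X -> R) (g : X -> F) (i : 'I_k) :
  pd_at i f -> lin_at i g -> 0 <= avg (fun x => f x * psi (g x)).
Proof.
by move=> hf hg; rewrite (avg_upd i); apply: avg_ge0 => x; apply: cone_psi_ge0.
Qed.

(* Substitute y = x + z in the product of the two averages; setting the
   coordinates of z to 0 one at a time can only increase the average over x. *)
Lemma correlation (f f' : X -> R) (g g' : X -> F) (i0 : 'I_k) :
  pd_at i0 f -> lin_at i0 g ->
  (forall i, [/\ pd_at i f, pd_at i f', lin_at i g & lin_at i g'] \/
             [/\ cst_at i f, cst_at i f', cst_at i g & cst_at i g']) ->
  avg (fun x => f x * psi (g x)) * avg (fun x => f' x * psi (g' x)) <=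
  avg (fun x => f x * f' x * psi (g x + g' x)).
Proof.
move=> hf hg hyp.
pose Phi (z : X) := avg (fun x => f x * f' (x + z) * psi (g x + g' (x + z))).
have step z i : Phi z <= Phi (upd z i 0).
  rewrite /Phi (avg_upd i) [leRHS](avg_upd i); apply: ler_avg => x.
  have e1 v : upd x i v + z = upd (x + z) i (v + z i) by rewrite upd_add.
  have e2 v : upd x i v + upd z i 0 = upd (x + z) i v.
    by apply/ffunP => j; rewrite !ffunE; case: eqP => //; rewrite addr0.
  case: (hyp i) => [[h1 h2 h3 h4]|[h1 h2 h3 h4]]; last first.
    by apply: ler_avg => v; rewrite e1 e2 !h1 !h2 !h3 !h4.
  under eq_avg do rewrite e1.
  under [leRHS]eq_avg do rewrite e2.
  set f1 := fun v => f (upd x i v); set f2 := fun v => f' (upd (x + z) i v).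
  pose l v := g (upd x i v) + g' (upd (x + z) i v).
  have hl : lin1 l by move=> a u v; rewrite /l h3 h4; ring.
  have -> : avg (fun v => f (upd x i v) * f' (upd (x + z) i (v + z i)) *
       psi (g (upd x i v) + g' (upd (x + z) i (v + z i)))) =
     avg (fun v => f1 v * f2 (v + z i) * psi (l v + g' (upd (x + z) i (z i)))).
    by apply: eq_avg => v; rewrite /l /f1 /f2 (lin1D _ _ (h4 _)) addrA.
  exact: (cone_shift_le _ _ (h1 x) (h2 (x + z)) hl).
have -> : avg (fun x => f x * f' x * psi (g x + g' x)) = Phi 0.
  by apply: eq_avg => x; rewrite addr0.
have -> : avg (fun x => f x * psi (g x)) * avg (fun x => f' x * psi (g' x)) = avg Phi.
  rewrite /Phi avg_exch.
  under [RHS]eq_avg => x.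
    under eq_avg => z do rewrite addrC.
    rewrite (avg_shift x (fun y => f x * f' y * psi (g x + g' y))).
    over.
  rewrite avg_exch -avgZ; apply: eq_avg => y.
  under [RHS]eq_avg => x do rewrite [f x * _]mulrC -mulrA.
  by rewrite avgZ (psi_factor _ hf hg); ring.
rewrite -[leRHS](avg_const (0 : X)); apply: ler_avg => z.
exact: chain_le.
Qed.

End Correlation.

(** * Multilinear forms *)

Section Forms.
Variables (F : finFieldType) (n k : nat).
Local Notation V := 'rV[F]_n.
Local Notation X := {ffun 'I_k -> V}.
Implicit Types (I J S U A : {set 'I_k}) (f g : X -> F) (x w y : X) (fs : seq (X -> F)).

Definition form I g :=
  (forall i, i \in I -> lin_at i g) /\ (forall i, i \notin I -> cst_at i g).

Lemma form_eq I f g : f =1 g -> form I f -> form I g.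
Proof. by move=> /funext ->. Qed.

Lemma cst_dep (T : Type) J (f : X -> T) x y :
  (forall i, i \notin J -> cst_at i f) -> (forall i, i \in J -> x i = y i) -> f x = f y.
Proof.
move=> hf e.
have key (s : seq 'I_k) : f x = f [ffun j => if j \in s then y j else x j].
  elim: s => [|i s IH]; first by congr f; apply/ffunP => j; rewrite ffunE.
  rewrite IH; set z := finfun _.
  have -> : [ffun j => if j \in i :: s then y j else x j] = upd z i (y i).
    by apply/ffunP => j; rewrite !ffunE inE; case: eqP => // ->.
  case: (boolP (i \in J)) => iJ; last by rewrite hf.
  congr f; apply/ffunP => j; rewrite !ffunE; case: eqP => // ->.
  by rewrite (e _ iJ); case: ifP.
rewrite (key (enum 'I_k)); congr f; apply/ffunP => j.
by rewrite ffunE mem_enum.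
Qed.

Lemma form_dep I g x y : form I g -> (forall i, i \in I -> x i = y i) -> g x = g y.
Proof. by case=> _ h; apply: cst_dep. Qed.

Lemma form_mixl I U g x w : form I g -> I \subset U -> g (mix U x w) = g x.
Proof.
move=> hg /subsetP IU; apply: (form_dep hg) => i iI; by rewrite ffunE IU.
Qed.

Lemma form_mixr I U g x w : form I g -> [disjoint I & U] -> g (mix U x w) = g w.
Proof.
move=> hg dj; apply: (form_dep hg) => i iI; rewrite ffunE.
by rewrite (disjointFr dj iI).
Qed.

Lemma form0 I : form I (fun=> 0).
Proof. by split=> i _ x a // u v; rewrite mulr0 addr0. Qed.

Lemma formD I f g : form I f -> form I g -> form I (fun x => f x + g x).
Proof.
move=> [f1 f2] [g1 g2]; split=> i iI x => [a u v|v]; first by rewrite f1 // g1 //; ring.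
by rewrite f2 // g2.
Qed.

Lemma formZ I c f : form I f -> form I (fun x => c * f x).
Proof.
move=> [f1 f2]; split=> i iI x => [a u v|v]; first by rewrite f1 //; ring.
by rewrite f2.
Qed.

Lemma formN I f : form I f -> form I (fun x => - f x).
Proof. by move=> /(formZ (-1)); apply: form_eq => x; rewrite mulN1r. Qed.

Lemma form_sum (T : Type) (r : seq T) (p : pred T) I (f : T -> X -> F) :
  (forall t, form I (f t)) -> form I (fun x => \sum_(t <- r | p t) f t x).
Proof.
move=> h; elim: r => [|t r IH].
  by apply: form_eq (form0 I) => x; rewrite big_nil.
case: (boolP (p t)) => pt.
  by apply: form_eq (formD (h t) IH) => x; rewrite big_cons pt.
by apply: form_eq IH => x; rewrite big_cons (negbTE pt).
Qed.

Lemma formM I J f g : form I f -> form J g -> [disjoint I & J] ->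
  form (I :|: J) (fun x => f x * g x).
Proof.
move=> [f1 f2] [g1 g2] dj; split=> i.
  rewrite in_setU => /orP[iI|iJ] x a u v.
    by rewrite f1 // !(g2 i) ?(disjointFr dj iI) //; ring.
  by rewrite g1 // !(f2 i) ?(disjointFl dj iJ) //; ring.
by rewrite in_setU negb_or => /andP[iI iJ] x v; rewrite f2 // g2.
Qed.

Lemma formMD S I f g : form I f -> form (S :\: I) g -> I \subset S ->
  form S (fun x => f x * g x).
Proof.
move=> hf hg sub; have <- : I :|: (S :\: I) = S.
  by apply/setP => i; rewrite !inE; case: (boolP (i \in I)) => // /(subsetP sub) ->.
apply: formM => //; rewrite -setI_eq0; apply/eqP/setP => i; rewrite !inE; by case: (i \in I).
Qed.

Lemma form_fibre I U f x : form I f -> form (I :\: U) (fun w => f (mix U x w)).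
Proof.
move=> [f1 f2]; split=> i.
  rewrite in_setD => /andP[iU iI] w a u v; by rewrite !mix_upd_out // f1.
rewrite in_setD negb_and negbK => /orP[iU|iI] w v; first by rewrite mix_upd_outin.
case: (boolP (i \in U)) => iU; first by rewrite mix_upd_outin.
by rewrite mix_upd_out // f2.
Qed.

Definition wfg (G : seq ({set 'I_k} * (X -> F))) :=
  forall p, p \in G -> p.1 != set0 /\ form p.1 p.2.

Definition zg (G : seq ({set 'I_k} * (X -> F))) (x : X) := all (fun p => p.2 x == 0) G.

Implicit Types G : seq ({set 'I_k} * (X -> F)).

Lemma wfg_cat G G' : wfg (G ++ G') <-> wfg G /\ wfg G'.
Proof.
split=> [h|[h h'] p]; last by rewrite mem_cat => /orP[/h|/h'].
by split=> p pG; apply: h; rewrite mem_cat pG ?orbT.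
Qed.

Lemma wfg_sub (P : pred ({set 'I_k} * (X -> F))) G : wfg G -> wfg [seq p <- G | P p].
Proof. by move=> h p; rewrite mem_filter => /andP[_ /h]. Qed.

Lemma zg_cat G G' x : zg (G ++ G') x = zg G x && zg G' x.
Proof. exact: all_cat. Qed.

Lemma form_at I f i : form I f -> lin_at i f \/ cst_at i f.
Proof. by move=> [h1 h2]; case: (boolP (i \in I)) => [/h1|/h2]; [left|right]. Qed.

Lemma zg_subsp G i x : wfg G -> subsp (fun v => zg G (upd x i v)).
Proof.
move=> h a u v /allP hu /allP hv; apply/allP => p pG.
have [_ hp] := h _ pG.
case: (form_at i hp) => hl.
  by rewrite hl (eqP (hu _ pG)) (eqP (hv _ pG)) mulr0 addr0.
by move: (hv _ pG); rewrite !hl.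
Qed.

Lemma zg_cst G S i : wfg G -> (forall p, p \in G -> p.1 \subset S) -> i \notin S ->
  cst_at i (zg G).
Proof.
move=> h sub iS x v; apply: eq_in_all => p pG; have [_ [_ ->]] := h _ pG => //.
by apply: contraNN iS; apply/subsetP/sub.
Qed.

Definition subg G U := [seq p : {set 'I_k} * (X -> F) <- G | p.1 \subset U].
Definition crossg G U := [seq p : {set 'I_k} * (X -> F) <- G | ~~ (p.1 \subset U)].

Lemma size_subg G U : (size (subg G U) + size (crossg G U))%N = size G.
Proof. by rewrite !size_filter count_predC. Qed.

Lemma zg_mix G U x w : wfg G ->
  zg G (mix U x w) = zg (subg G U) x && zg (crossg G U) (mix U x w).
Proof.
elim: G => [|p G IH] //= h.
have hG : wfg G by move=> p' p'G; apply: h; rewrite inE p'G orbT.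
have [_ hp] : p.1 != set0 /\ form p.1 p.2 by apply: h; rewrite inE eqxx.
rewrite /subg /crossg /= -/(subg G U) -/(crossg G U) IH //.
case: (boolP (p.1 \subset U)) => s /=; first by rewrite (form_mixl _ _ hp) // andbA.
by rewrite andbCA.
Qed.

(** With the coordinates in U fixed, the forms of G not supported in U become forms in the other
    coordinates, still with non-empty supports. *)
Definition fibreg G U x := [seq (p.1 :\: U, fun w => p.2 (mix U x w)) | p <- crossg G U].

Lemma wfg_fibreg G U x : wfg G -> wfg (fibreg G U x).
Proof.
move=> h p /mapP[p']; rewrite mem_filter => /andP[ns /h [_ hp]] -> /=; split.
  by rewrite setD_eq0.
exact: form_fibre.
Qed.

Lemma zg_fibreg G U x w : zg (fibreg G U x) w = zg (crossg G U) (mix U x w).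
Proof. by rewrite /zg all_map; apply: eq_all. Qed.

Definition comb (fs : seq (X -> F)) (c : 'rV[F]_(size fs)) (x : X) : F :=
  \sum_(j < size fs) c 0 j * nth (fun=> 0) fs j x.

Lemma form_nth I fs j : (forall f, f \in fs -> form I f) -> form I (nth (fun=> 0) fs j).
Proof.
move=> h; case: (ltnP j (size fs)) => js; first by apply: h; rewrite mem_nth.
by rewrite nth_default //; apply: form0.
Qed.

Lemma form_comb I fs c : (forall f, f \in fs -> form I f) -> form I (comb (fs := fs) c).
Proof.
by move=> h; apply: (@form_sum 'I_(size fs) _ _ I (fun j x => c 0 j * nth (fun=> 0) fs j x)) => j; apply/formZ/form_nth.
Qed.

End Forms.

(** * Densities of zero sets and relative bias *)

Section Density.
Variables (R : realFieldType) (F : finFieldType) (n k : nat).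
Local Notation V := 'rV[F]_n.
Local Notation X := {ffun 'I_k -> V}.
Local Notation psi := (@psi R F).
Implicit Types (I J S U A : {set 'I_k}) (f g : X -> F) (x w y : X) (fs : seq (X -> F)).
Implicit Types G : seq ({set 'I_k} * (X -> F)).
Local Notation q := (#|F|%:R : R).

Definition dens G : R := avg (fun x => (zg G x)%:R).
Definition beta G (P : X -> F) : R := avg (fun x => (zg G x)%:R * psi (P x)).

Lemma q_gt1 : 1 < q. Proof. by rewrite ltr1n; exact: card_F_gt1. Qed.
Lemma q_gt0 : 0 < q. Proof. exact: lt_trans ltr01 q_gt1. Qed.
Lemma qV_gt0 m : 0 < q ^- m. Proof. by rewrite invr_gt0 exprn_gt0 // q_gt0. Qed.
Lemma qV_le1 m : q ^- m <= 1.
Proof. by rewrite invf_le1 ?exprn_gt0 ?q_gt0 // exprn_ege1 // ltW // q_gt1. Qed.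
Lemma qVD m m' : q ^- (m + m') = q ^- m * q ^- m' :> R.
Proof. by rewrite exprD invfM. Qed.

Lemma zg_pd G i : wfg G -> pd_at i (fun x => (zg G x)%:R : R).
Proof. by move=> h x; apply: cone_subsp; apply: zg_subsp. Qed.

Lemma beta_eq G P P' : (forall x, zg G x -> P x = P' x) -> beta G P = beta G P'.
Proof. by move=> h; apply: eq_avg => x; case: (boolP (zg G x)) => [/h ->|]; rewrite ?mul0r. Qed.

Lemma beta0 G : beta G (fun=> 0) = dens G.
Proof. by apply: eq_avg => x; rewrite psi0 mulr1. Qed.

Lemma dens_ge0 G : 0 <= dens G.
Proof. by apply: avg_ge0 => x; case: zg; rewrite ?ler01. Qed.

Lemma dens_nil : dens [::] = 1.
Proof. by rewrite /dens (avg_const (0 : X)). Qed.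

Lemma beta_ge0 G S P : wfg G -> form S P -> S != set0 -> 0 <= beta G P.
Proof.
move=> hG [hP _] /set0Pn[i iS]; apply: (@pd_psi_ge0 _ _ _ _ _ _ i); last exact: hP.
exact: zg_pd.
Qed.

Lemma beta_corr G G' S P P' : wfg G -> wfg G' -> S != set0 ->
  (forall p, p \in G ++ G' -> p.1 \subset S) -> form S P -> form S P' ->
  beta G P * beta G' P' <= beta (G ++ G') (fun x => P x + P' x).
Proof.
move=> hG hG' /set0Pn[i0 i0S] sub hP hP'.
have -> : beta (G ++ G') (fun x => P x + P' x) =
   avg (fun x => (zg G x)%:R * (zg G' x)%:R * psi (P x + P' x)).
  by apply: eq_avg => x; rewrite zg_cat; case: (zg G x); case: (zg G' x); rewrite ?mulr1 ?mulr0.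
apply: (@correlation _ _ _ _ _ _ _ _ i0); [exact: zg_pd|exact: hP.1|].
move=> i; case: (boolP (i \in S)) => iS.
  by left; split; [exact: zg_pd|exact: zg_pd|exact: hP.1|exact: hP'.1].
right; split.
- by move=> x v; rewrite (zg_cst hG _ iS) // => p pG; apply: sub; rewrite mem_cat pG.
- by move=> x v; rewrite (zg_cst hG' _ iS) // => p pG; apply: sub; rewrite mem_cat pG orbT.
- exact: hP.2.
- exact: hP'.2.
Qed.

Lemma dens_cat_ge G G' : wfg G -> wfg G' -> dens G * dens G' <= dens (G ++ G').
Proof.
move=> hG hG'; case: (pickP (fun i : 'I_k => true)) => [i0 _|no].
  rewrite -!beta0; have -> : beta (G ++ G') (fun=> 0) = beta (G ++ G') (fun x : X => 0 + 0).
    by apply: beta_eq => x _; rewrite addr0.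
  apply: (@beta_corr _ _ setT) => //; try exact: form0.
  by apply/set0Pn; exists i0; rewrite inE.
suff e G0 : wfg G0 -> G0 = [::] by rewrite (e _ hG) (e _ hG') dens_nil mulr1.
case: G0 => // p G0 /(_ p); rewrite inE eqxx => /(_ isT)[/set0Pn[i _] _].
by have := no i.
Qed.

(** Expand the indicator as the average of [psi (b * l v)] over b: the term b = 0 alone gives q^-1,
    and the others are non-negative. *)
Lemma avg_lin1_ge (l : V -> F) : lin1 l -> q^-1 <= avg (fun v => (l v == 0)%:R : R).
Proof.
move=> hl; have -> : avg (fun v => (l v == 0)%:R : R) = avg (fun b : F => avg (fun v => psi (b * l v))).
  rewrite avg_exch; apply: eq_avg => v; rewrite -[LHS]mulr1 -[X in _ * X](psi0 R F) -avg_psi_ind.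
  by apply: eq_avg => b; rewrite addr0.
rewrite /avg [X in _ * X](bigD1 (0 : F)) //= mulrDr.
have -> : (#|V|%:R)^-1 * (\sum_(v : V) psi (0 * l v)) = 1.
  rewrite -[RHS](avg_const (0 : V)); apply: eq_avg => v; by rewrite mul0r psi0.
rewrite mulr1 lerDl mulr_ge0 ?invr_ge0 ?ler0n // sumr_ge0 // => b _.
have := @cone_psi_ge0 R F V (fun=> 1) (fun v => b * l v) (@cone_const R F V 1 ler01).
rewrite (eq_avg (g := fun v => psi (b * l v))) => [|v]; last by rewrite mul1r.
by apply=> a u v; rewrite hl; ring.
Qed.

Lemma dens1_ge I f : I != set0 -> form I f -> q^-1 <= dens [:: (I, f)].
Proof.
move=> /set0Pn[i iI] [hf _]; rewrite /dens (avg_upd i).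
rewrite -[leLHS](avg_const (0 : X)); apply: ler_avg => x.
apply: le_trans (avg_lin1_ge (hf i iI x)) _.
by apply: ler_avg => v; rewrite /zg /= andbT.
Qed.

Lemma dens_ge G : wfg G -> q ^- size G <= dens G.
Proof.
elim: G => [|[I f] G IH] h; first by rewrite dens_nil expr0 invr1.
have [h1 h2] : wfg [:: (I, f)] /\ wfg G by apply/wfg_cat.
apply: le_trans (dens_cat_ge h1 h2).
have [i0 hf] : I != set0 /\ form I f by apply: (h (I, f)); rewrite inE eqxx.
rewrite /= exprS invfM; apply: ler_pM; rewrite ?invr_ge0 ?ler0n ?IH ?dens1_ge //.
by rewrite exprn_ge0 ?ler0n.
Qed.

Lemma fibre_dens_ge G U x : wfg G ->
  q ^- size (crossg G U) <= avg (fun w => (zg (crossg G U) (mix U x w))%:R : R).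
Proof.
move=> h; apply: le_trans (_ : dens (fibreg G U x) <= _).
  have := dens_ge (@wfg_fibreg _ _ _ _ U x h); by rewrite size_map.
by apply: ler_avg => w; rewrite zg_fibreg.
Qed.

Lemma dens_fibre G U : wfg G ->
  dens G = avg (fun x => (zg (subg G U) x)%:R *
                avg (fun w => (zg (crossg G U) (mix U x w))%:R : R)).
Proof.
move=> h; rewrite /dens (avg_mix U); apply: eq_avg => x; rewrite -avgZ.
by apply: eq_avg => w; rewrite zg_mix //; case: zg; case: zg; rewrite ?mulr1 ?mulr0.
Qed.

(* The fibre densities are bounded below pointwise, so an upper bound on the
   total density controls their deviation in L^1. *)
Lemma fibre_excess G U delta : wfg G -> dens G <= (1 + delta) * q ^- size G ->
  avg (fun x => (zg (subg G U) x)%:R *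
    (avg (fun w => (zg (crossg G U) (mix U x w))%:R : R) - q ^- size (crossg G U)))
  <= delta * q ^- size G.
Proof.
move=> h le.
rewrite (eq_avg (g := fun x => (zg (subg G U) x)%:R *
    avg (fun w => (zg (crossg G U) (mix U x w))%:R : R) - (zg (subg G U) x)%:R * q ^- size (crossg G U))); last first.
  by move=> x; rewrite mulrBr.
rewrite avgB -dens_fibre // avgZr -/(dens _).
have := dens_ge (wfg_sub (P := fun p => p.1 \subset U) h); rewrite -/(subg G U).
rewrite -(ler_pM2r (qV_gt0 (size (crossg G U)))) -qVD size_subg => ?; lra.
Qed.

(** As g ignores the coordinates outside I, these can be averaged first. The fibre densities [e] are
    at least [c] and [psi] is at most 1, so replacing [e] by [c] costs no more than the total excess
    of the fibre densities. *)
Lemma beta_restrict G I g delta : wfg G -> form I g ->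
  dens G <= (1 + delta) * q ^- size G ->
  beta G g <= q ^- size (crossg G I) * beta (subg G I) g + delta * q ^- size G.
Proof.
move=> h hg le; apply: le_trans (lerD (lexx _) (fibre_excess I h le)).
rewrite -avgZ -avgD /beta (avg_mix I); apply: ler_avg => x.
under eq_avg => w.
  rewrite zg_mix // (form_mixl _ _ hg) // -mulnb natrM -mulrA [_ * psi _]mulrC mulrA.
  over.
rewrite avgZ; set e := avg _; set c := q ^- _; set b := (zg _ x)%:R; set p := psi _.
have ce : c <= e by exact: fibre_dens_ge.
have p1 : p <= 1 by exact: psi_le1.
have : b * (1 - p) * (e - c) >= 0.
  by rewrite mulr_ge0 ?subr_ge0 // mulr_ge0 ?subr_ge0 // /b ler0n.
lra.
Qed.

Lemma avg_psi_vec m (a : 'I_m -> F) (t : F) :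
  avg (fun c : 'rV[F]_m => psi (\sum_j c 0 j * a j + t)) = [forall j, a j == 0]%:R * psi t.
Proof.
pose l (c : 'rV[F]_m) := \sum_j c 0 j * a j.
have hl : lin1 l.
  move=> b u v; rewrite /l mulr_sumr -big_split /=; apply: eq_bigr => j _.
  by rewrite !mxE; ring.
have := @sum_psi_subsp R F 'rV[F]_m xpredT l t (fun _ _ _ _ _ => isT) hl.
rewrite /avg /l => ->.
case: forallP => [h|h]; case: forallP => [h'|h'] //=; rewrite ?mulr0 ?mul0r //.
- rewrite mulrA mulVf //; rewrite pnatr_eq0 -lt0n; apply/card_gt0P; by exists 0.
- case: h' => j; have := h (delta_mx 0 j); rewrite /l (bigD1 j) //= big1 => [|i /negbTE ni].
    by rewrite addr0 mxE !eqxx mul1r.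
  by rewrite mxE eqxx ni mul0r.
- case: h => c; apply/implyP => _; rewrite /l big1 // => j _.
  by rewrite (eqP (h' j)) mulr0.
Qed.

Lemma all_nth0 (fs : seq (X -> F)) x :
  [forall j : 'I_(size fs), nth (fun=> 0) fs j x == 0] = all (fun f => f x == 0) fs.
Proof.
apply/forallP/allP => [h f /(nthP (fun=> 0))[j js <-]|h j]; first exact: (h (Ordinal js)).
by apply: h; rewrite mem_nth.
Qed.

Definition lay I (fs : seq (X -> F)) := [seq (I, f) | f <- fs].

Lemma zg_lay I fs x : zg (lay I fs) x = all (fun f => f x == 0) fs.
Proof. by rewrite /zg all_map; apply: eq_all. Qed.

(** The indicator that all forms of the layer vanish is the average of [psi] over their linear
    combinations. *)
Lemma dens_lay G I fs :
  dens (G ++ lay I fs) = avg (fun c : 'rV[F]_(size fs) => beta G (comb c)).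
Proof.
rewrite /beta avg_exch; apply: eq_avg => x; rewrite avgZ zg_cat zg_lay -all_nth0.
under [in RHS]eq_avg do rewrite -[comb _ x]addr0 /comb.
by rewrite avg_psi_vec psi0 mulr1; case: zg; case: [forall _, _]; rewrite ?mulr1 ?mulr0.
Qed.

(* The values of the forms fs are equidistributed, so they can be replaced by free variables. *)
Lemma substitution_bound G S A fs (B : 'I_(size fs) -> X -> F) delta : wfg G ->
  A != set0 -> A \subset S -> (forall p, p \in G -> p.1 \subset S) ->
  (forall f, f \in fs -> form A f) -> (forall j, form (S :\: A) (B j)) ->
  dens (G ++ lay A fs) <= (1 + delta) * q ^- (size G + size fs) ->
  dens G <= (1 + delta) * q ^- size G ->
  beta G (fun x => \sum_(j < size fs) nth (fun=> 0) fs j x * B j x) <=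
    q ^- size (crossg G (S :\: A)) *
      avg (fun x => (zg (subg G (S :\: A)) x && [forall j, B j x == 0])%:R)
    + 2 * delta * q ^- size G.
Proof.
move=> h A0 AS GS hfs hB le1 le2; set U := S :\: A.
have dj : [disjoint A & U].
  by rewrite -setI_eq0; apply/eqP/setP => i; rewrite !inE; case: (i \in A).
pose al x w : R := (zg (crossg G U) (mix U x w))%:R.
(* The fibre average twisted by a combination of the fs. In the sum to be bounded, the combination
   that occurs at x has the values of the B_j at x as coefficients. *)
pose phi (c : 'rV[F]_(size fs)) x := avg (fun w => al x w * psi (comb c w)).
have phi_ge0 c x : 0 <= phi c x.
  have := beta_ge0 (@wfg_fibreg _ _ _ _ U x h) (form_comb c hfs) A0.
  by rewrite /beta /phi; under eq_avg do rewrite zg_fibreg.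
have hlay : wfg (lay A fs) by move=> p /mapP[f ff ->] /=; split=> //; exact: hfs.
have sumphi : avg (fun c => avg (fun x => (zg (subg G U) x)%:R * phi c x)) = dens (G ++ lay A fs).
  rewrite dens_lay; apply: eq_avg => c; rewrite /beta [RHS](avg_mix U); apply: eq_avg => x.
  rewrite /phi -avgZ; apply: eq_avg => w; rewrite zg_mix // (form_mixr _ _ (form_comb c hfs)) //.
  by rewrite -mulnb natrM mulrA.
pose Bv x : 'rV[F]_(size fs) := \row_j B j x.
have -> : beta G (fun x => \sum_(j < size fs) nth (fun=> 0) fs j x * B j x) =
   avg (fun x => (zg (subg G U) x)%:R * phi (Bv x) x).
  rewrite /beta (avg_mix U); apply: eq_avg => x; rewrite /phi -avgZ; apply: eq_avg => w.
  rewrite zg_mix // -mulnb natrM -mulrA; congr (_ * (_ * psi _)).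
  apply: eq_bigr => j _; rewrite mxE mulrC (form_mixl _ _ (hB j)) //.
  by rewrite (form_mixr _ _ (form_nth j hfs)).
have phi0E x : phi 0 x = avg (al x).
  apply: eq_avg => w; rewrite /comb big1 ?psi0 ?mulr1 // => j _; by rewrite mxE mul0r.
have exc := fibre_excess U h le2.
set c0 := q ^- size (crossg G U); rewrite -/c0 in exc.
(* All twists are non-negative, and their sum over c is governed by the density with the layer
   added. The twist c = 0 already gives the density of G, which nearly exhausts the sum, so all
   others together are of order delta. *)
pose Q x : R := \sum_(c | c != 0) phi c x.
have Qtot : avg (fun x => (zg (subg G U) x)%:R * Q x) <= delta * q ^- size G.
  have e0 : \sum_c avg (fun x => (zg (subg G U) x)%:R * phi c x) = q ^+ size fs * dens (G ++ lay A fs).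
    rewrite -sumphi /avg mulrA card_mx mul1n natrX mulfV ?mul1r //.
    by rewrite expf_neq0 // gt_eqF // q_gt0.
  have : q ^+ size fs * dens (G ++ lay A fs) <= (1 + delta) * q ^- size G.
    rewrite mulrC -ler_pdivlMr ?exprn_gt0 ?q_gt0 //; move: le1.
    by rewrite qVD mulrA.
  rewrite -e0 (bigD1 0) //= => le.
  have -> : avg (fun x => (zg (subg G U) x)%:R * Q x) =
     \sum_(c | c != 0) avg (fun x => (zg (subg G U) x)%:R * phi c x).
    rewrite /avg -mulr_sumr exchange_big /=; congr (_ * _); apply: eq_bigr => x _.
    by rewrite mulr_sumr.
  have e1 : avg (fun x => (zg (subg G U) x)%:R * phi 0 x) = dens G.
    rewrite (dens_fibre U h); apply: eq_avg => x; by rewrite phi0E.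
  rewrite e1 in le; have := dens_ge h; lra.
apply: le_trans (_ : avg (fun x => c0 * (zg (subg G U) x && [forall j, B j x == 0])%:R +
    ((zg (subg G U) x)%:R * (avg (al x) - c0) + (zg (subg G U) x)%:R * Q x)) <= _); last first.
  rewrite avgD avgZ avgD lerD2l; lra.
apply: ler_avg => x; case: (zg (subg G U) x); rewrite ?mul0r ?mul1r ?mulr0 ?addr0 //=.
case: forallP => hB0 /=.
  have -> : Bv x = 0 by apply/rowP => j; rewrite !mxE; apply/eqP.
  rewrite phi0E mulr1 addrA [c0 + _]addrC subrK lerDl; by apply: sumr_ge0.
have Bn : Bv x != 0.
  apply/negP => /eqP e; apply: hB0 => j; have := congr1 (fun M : 'rV_(size fs) => M 0 j) e.
  by rewrite !mxE => ->.
rewrite mulr0 add0r /Q (bigD1 (Bv x)) //= addrA addrAC lerDr addr_ge0 //.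
  rewrite subr_ge0; exact: fibre_dens_ge.
by apply: sumr_ge0.
Qed.

End Density.
Arguments form0 {F n k} I.

(** * Decompositions into products modulo a system of forms *)

Section Decomposition.
Variables (F : finFieldType) (n k : nat).
Local Notation V := 'rV[F]_n.
Local Notation X := {ffun 'I_k -> V}.
Local Notation system := (seq ({set 'I_k} * (X -> F))).
Implicit Types (I J S U A N : {set 'I_k}) (f g P Q : X -> F) (x w : X) (fs : seq (X -> F)).
Implicit Types G : system.

(* Dec G S r P is the multilinear counterpart of "the rank of P relative to G is at most r". *)
Inductive Dec G S : nat -> (X -> F) -> Prop :=
| DecZ P : (forall x, P x = 0) -> Dec G S 0 P
| DecM r P Q A f g : Dec G S r P -> A != set0 -> A \subset S -> S :\: A != set0 ->
    form A f -> form (S :\: A) g -> (forall x, Q x = P x + f x * g x) -> Dec G S r.+1 Q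
| DecI r P Q p g : Dec G S r P -> p \in G -> p.1 \subset S -> form (S :\: p.1) g ->
    (forall x, Q x = P x + p.2 x * g x) -> Dec G S r Q.

Lemma Dec_eq G S r P Q : Dec G S r P -> P =1 Q -> Dec G S r Q.
Proof. by move=> h /funext <-. Qed.

Lemma Dec_form G S r P : wfg G -> Dec G S r P -> form S P.
Proof.
move=> wf; elim=> {r P} [P h|r P Q A f g _ IH A0 AS _ hf hg e|r P Q p g _ IH pG pS hg e].
- by apply: form_eq (form0 S) => x; rewrite h.
- apply: form_eq (formD IH (formMD hf hg AS)) => x; by rewrite e.
- apply: form_eq (formD IH (formMD (wf _ pG).2 hg pS)) => x; by rewrite e.
Qed.

Lemma DecD G S r r' P Q : Dec G S r P -> Dec G S r' Q -> Dec G S (r + r') (fun x => P x + Q x).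
Proof.
move=> hP; elim=> {r' Q} [Q h|r' Q Q' A f g _ IH A0 AS SA hf hg e|r' Q Q' p g _ IH pG pS hg e].
- by rewrite addn0; apply: Dec_eq hP _ => x; rewrite h addr0.
- by rewrite addnS; apply: (DecM IH A0 AS SA hf hg) => x; rewrite e addrA.
- by apply: (DecI IH pG pS hg) => x; rewrite e addrA.
Qed.

Lemma DecS G S r c P : Dec G S r P -> Dec G S r (fun x => c * P x).
Proof.
elim=> {r P} [P h|r P Q A f g _ IH A0 AS SA hf hg e|r P Q p g _ IH pG pS hg e].
- by apply: DecZ => x; rewrite h mulr0.
- by apply: (DecM IH A0 AS SA hf (formZ c hg)) => x; rewrite e; ring.
- by apply: (DecI IH pG pS (formZ c hg)) => x; rewrite e; ring.
Qed.

Lemma DecN G S r P : Dec G S r P -> Dec G S r (fun x => - P x).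
Proof. by move=> /(DecS (-1)) h; apply: Dec_eq h _ => x; rewrite mulN1r. Qed.

Lemma Dec_sum (T : Type) (s : seq T) G S (P : T -> X -> F) :
  (forall t, Dec G S 0 (P t)) -> Dec G S 0 (fun x => \sum_(t <- s) P t x).
Proof.
move=> h; elim: s => [|t s IH]; first by apply: DecZ => x; rewrite big_nil.
by apply: Dec_eq (DecD (h t) IH) _ => x; rewrite big_cons.
Qed.

Lemma Dec_gen G S p g : p \in G -> p.1 \subset S -> form (S :\: p.1) g ->
  Dec G S 0 (fun x => p.2 x * g x).
Proof. by move=> pG pS hg; apply: (DecI (DecZ (P := fun=> 0) _ _ _) pG pS hg) => // x; rewrite add0r. Qed.

Lemma form_set0 g c : (forall x, g x = c) -> form set0 g.
Proof. by move=> h; split=> [i|i _ x v]; rewrite ?inE // !h. Qed.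

Lemma Dec_gen1 G p : p \in G -> Dec G p.1 0 p.2.
Proof.
move=> pG; have h : form (p.1 :\: p.1) (fun _ : X => 1 : F).
  by rewrite setDv; exact: (@form_set0 (fun=> 1) 1).
by apply: Dec_eq (Dec_gen pG (subxx _) h) _ => x; rewrite mulr1.
Qed.

Lemma Dec_mulform G I S q g : Dec G I 0 q -> I \subset S -> form (S :\: I) g ->
  Dec G S 0 (fun x => q x * g x).
Proof.
move=> + IS hg; suff key r q0 : Dec G I r q0 -> r = 0%N -> Dec G S 0 (fun x => q0 x * g x) by move/key; apply.
elim=> {r q0}
  [P h|r P' Q A f f' _ _ _ _ _ _ _ _|r P' Q p g' _ IH pG pI hg' e] // r0.
  by apply: DecZ => x; rewrite h mul0r.
have pS := subset_trans pI IS.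
have hg2 : form (S :\: p.1) (fun x => g' x * g x).
  have -> : S :\: p.1 = (I :\: p.1) :|: (S :\: I).
    apply/setP => i; rewrite !inE; case: (boolP (i \in I)) => iI; rewrite ?andbT ?andbF ?orbF /=.
      by rewrite (subsetP IS _ iI) andbT.
    by case: (boolP (i \in p.1)) => // /(subsetP pI); rewrite (negbTE iI).
  apply: formM => //; rewrite -setI_eq0; apply/eqP/setP => i; rewrite !inE.
  by case: (i \in I); rewrite ?andbF.
by apply: (DecI (IH r0) pG pS hg2) => x; rewrite e; ring.
Qed.

(** Each generator of G is replaced by its expression in the ideal of G', which creates no
    products. *)
Lemma Dec_trans G G' S r P :
  (forall p, p \in G -> p.1 \subset S -> Dec G' p.1 0 p.2) ->
  Dec G S r P -> Dec G' S r P.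
Proof.
move=> h; elim=> {r P} [P hP|r P Q A f g _ IH A0 AS SA hf hg e|r P Q p g _ IH pG pS hg e].
- exact: DecZ.
- exact: (DecM IH A0 AS SA hf hg).
- have := DecD IH (Dec_mulform (h _ pG pS) pS hg); rewrite addn0 => h'.
  by apply: Dec_eq h' _ => x; rewrite e.
Qed.

Lemma Dec_incl G G' S r P : {subset G <= G'} -> Dec G S r P -> Dec G' S r P.
Proof. by move=> h; apply: Dec_trans => p /h pG _; apply: Dec_gen1. Qed.

Lemma Dec_subg G S r P : Dec G S r P <-> Dec (subg G S) S r P.
Proof.
split; last by apply: Dec_incl => p; rewrite mem_filter => /andP[].
by apply: Dec_trans => p pG pS; apply: Dec_gen1; rewrite mem_filter pS pG.
Qed.

Lemma Dec0_zero G S P x : Dec G S 0 P -> zg G x -> P x = 0.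
Proof.
move=> + hx; suff key r P0 : Dec G S r P0 -> r = 0%N -> P0 x = 0 by move/key; apply.
elim=> {r P0}
  [P' h|r P' Q A f f' _ _ _ _ _ _ _ _|r P' Q p g' _ IH pG pI hg' e] // r0.
by rewrite e IH // (eqP (allP hx _ pG)) mul0r addr0.
Qed.

Lemma Dec_layer G A fs S r P : A \subset S -> Dec (G ++ lay A fs) S r P ->
  exists P' (B : 'I_(size fs) -> X -> F),
  [/\ Dec G S r P', forall j, form (S :\: A) (B j) &
      forall x, P x = P' x + \sum_(j < size fs) nth (fun=> 0) fs j x * B j x].
Proof.
move=> AS; elim=> {r P} [P hP|r P Q A' f g _ [P' [B [h1 h2 h3]]] A0 A'S SA hf hg e|
   r P Q p g _ [P' [B [h1 h2 h3]]] pG pS hg e].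
- exists (fun=> 0), (fun _ _ => 0); split=> [|j|x]; [exact: DecZ|exact: form0|].
  by rewrite hP big1 ?addr0 // => j _; rewrite mulr0.
- exists (fun x => P' x + f x * g x), B; split=> // [|x]; first exact: (DecM h1 A0 A'S SA hf hg).
  by rewrite e h3; ring.
move: pG; rewrite mem_cat => /orP[pG|/mapP[f ff ep]].
  exists (fun x => P' x + p.2 x * g x), B; split=> // [|x]; first exact: (DecI h1 pG pS hg).
  by rewrite e h3; ring.
have hj : (index f fs < size fs)%N by rewrite index_mem.
pose j0 := Ordinal hj.
exists P', (fun j x => B j x + (j == j0)%:R * g x); split=> // [j|x].
  by apply: formD => //; apply: formZ; move: hg; rewrite ep.
rewrite e h3 -addrA; congr (_ + _).
under [RHS]eq_bigr do rewrite mulrDr.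
rewrite big_split /=; congr (_ + _).
rewrite (bigD1 j0) //= big1 => [|j /negbTE ->]; last by rewrite mul0r mulr0.
by rewrite eqxx mul1r addr0 nth_index // ep.
Qed.

(** Separates the products, whose number controls the loss of bias, from the part in the ideal,
    which vanishes on the zeros of G. *)
Lemma Dec_split G S r P : Dec G S r P ->
  exists P0 P1, [/\ Dec [::] S r P0, Dec G S 0 P1 & forall x, P x = P0 x + P1 x].
Proof.
elim=> {r P} [P hP|r P Q A f g _ [P0 [P1 [h1 h2 h3]]] A0 AS SA hf hg e|
   r P Q p g _ [P0 [P1 [h1 h2 h3]]] pG pS hg e].
- exists (fun=> 0), (fun=> 0); split=> [||x]; [exact: DecZ|exact: DecZ|by rewrite hP addr0].
- exists (fun x => P0 x + f x * g x), P1; split=> // [|x]; first exact: (DecM h1 A0 AS SA hf hg).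
  by rewrite e h3; ring.
- exists P0, (fun x => P1 x + p.2 x * g x); split=> // [|x]; first exact: (DecI h2 pG pS hg).
  by rewrite e h3; ring.
Qed.

(* One factor of each product, chosen to involve a coordinate of N, generates P. *)
Lemma Dec_absorb G S N r P : S :&: N != set0 -> Dec G S r P ->
  exists Gs : system,
  [/\ size Gs = r, wfg Gs,
      forall p, p \in Gs -> p.1 \proper S /\ p.1 :&: N != set0 &
      forall G', {subset G <= G'} -> {subset Gs <= G'} -> Dec G' S 0 P].
Proof.
move=> SN; elim=> {r P} [P hP|r P Q A f g _ [Gs [h1 h2 h3 h4]] A0 AS SA hf hg e|
   r P Q p g _ [Gs [h1 h2 h3 h4]] pG pS hg e].
- by exists [::]; split=> // G' _ _; apply: DecZ.
- suff [p [g' [p0 hp ps [hg' e']]]] : exists p g', [/\ p.1 != set0, form p.1 p.2,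
     p.1 \proper S /\ p.1 :&: N != set0 &
     form (S :\: p.1) g' /\ forall x, f x * g x = p.2 x * g' x].
    exists (p :: Gs); split=> /= [|p'|p'|G' GG' Gs'].
    + by rewrite h1.
    + by rewrite inE => /orP[/eqP ->|/h2].
    + by rewrite inE => /orP[/eqP ->|/h3].
    have Gs2 : {subset Gs <= G'} by move=> p' p'G; apply: Gs'; rewrite inE p'G orbT.
    have pG' : p \in G' by apply: Gs'; rewrite inE eqxx.
    apply: (DecI (h4 _ GG' Gs2) pG' (proper_sub ps.1) hg') => x; by rewrite e e'.
  have SSA : S :\: (S :\: A) = A.
    apply/setP => i; rewrite !inE; case: (boolP (i \in A)) => [/(subsetP AS) -> //|_].
    by case: (i \in S).
  have [/set0Pn[i]] := SN; rewrite inE => /andP[iS iN].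
  case: (boolP (i \in A)) => iA.
    exists (A, f), g; split=> //=; split.
      by rewrite properEneq AS andbT; apply: contraNneq SA => ->; rewrite setDv.
    by apply/set0Pn; exists i; rewrite inE iA.
  exists (S :\: A, g), f; split=> //=; last by rewrite SSA; split=> // x; rewrite mulrC.
  split; last by apply/set0Pn; exists i; rewrite !inE iA iS.
  rewrite properE subsetDl /=; apply: contraNN A0 => sub.
  apply/eqP/setP => j; rewrite inE; apply/negbTE/negP => jA.
  by have := subsetP sub _ (subsetP AS _ jA); rewrite inE jA.
- exists Gs; split=> // G' GG' Gs'.
  exact: (DecI (h4 _ GG' Gs') (GG' _ pG) pS hg).
Qed.

Lemma Dec0_coef G S P : Dec G S 0 P ->
  exists T : 'I_(size G) -> X -> F,
  (forall j : 'I_(size G), form (S :\: (nth (set0, fun=> 0) G j).1) (T j)) /\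
  forall x, P x = \sum_(j < size G | (nth (set0, fun=> 0) G j).1 \subset S)
      (nth (set0, fun=> 0) G j).2 x * T j x.
Proof.
suff key r P0 : Dec G S r P0 -> r = 0%N -> exists T : 'I_(size G) -> X -> F,
  (forall j : 'I_(size G), form (S :\: (nth (set0, fun=> 0) G j).1) (T j)) /\
  forall x, P0 x = \sum_(j < size G | (nth (set0, fun=> 0) G j).1 \subset S)
      (nth (set0, fun=> 0) G j).2 x * T j x by move/key; apply.
elim=> {r P0}
  [P0 h|r P' Q A f f' _ _ _ _ _ _ _ _|r P' Q p g _ IH pG pS hg e] // r0.
  exists (fun _ _ => 0); split=> [j|x]; first exact: form0.
  by rewrite h big1 // => j _; rewrite mulr0.
have [T [h1 h2]] := IH r0.
have hj : (index p G < size G)%N by rewrite index_mem.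
pose j0 := Ordinal hj.
have ej0 : nth (set0, fun=> 0) G j0 = p by rewrite nth_index.
exists (fun j x => T j x + (j == j0)%:R * g x); split=> [j|x].
  apply: formD => //; case: eqP => [->|_]; first by rewrite ej0; apply: formZ.
  by apply: form_eq (form0 _) => x; rewrite mul0r.
under [RHS]eq_bigr do rewrite mulrDr.
rewrite e h2 big_split /=; congr (_ + _).
rewrite (bigD1 j0) ?ej0 //= big1 => [|j /andP[_ /negbTE ->]]; last by rewrite mul0r mulr0.
by rewrite eqxx mul1r addr0.
Qed.

End Decomposition.

Section Substitution.
Variables (F : finFieldType) (n1 n2 k : nat).
Local Notation X1 := {ffun 'I_k -> 'rV[F]_n1}.
Local Notation X2 := {ffun 'I_k -> 'rV[F]_n2}.
Variables (sigma : X1 -> X2) (tau : {set 'I_k} -> {set 'I_k}) (S1 S2 : {set 'I_k}).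

(** A coordinate of X2 may come from several coordinates of X1; [tau I] collects those on which the
    pull-back of a form on I depends. This generality serves the substitution [back]; for
    coordinatewise linear maps [tau] is the identity. *)
Lemma Dec_subst (G2 : seq ({set 'I_k} * (X2 -> F))) (G1 : seq ({set 'I_k} * (X1 -> F))) r P :
  (forall (I : {set 'I_k}) (f : X2 -> F), I \subset S2 -> form I f -> form (tau I) (fun x => f (sigma x))) ->
  (forall I : {set 'I_k}, I \subset S2 ->
     [/\ tau I \subset S1, tau (S2 :\: I) = S1 :\: tau I & I != set0 -> tau I != set0]) ->
  (forall p, p \in G2 -> p.1 \subset S2 -> Dec G1 (tau p.1) 0 (fun x => p.2 (sigma x))) ->
  Dec G2 S2 r P -> Dec G1 S1 r (fun x => P (sigma x)).
Proof.
move=> hf hI hG; elim=> {r P} [P hP|r P Q A f g _ IH A0 AS SA hf' hg e|r P Q p g _ IH pG pS hg e].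
- by apply: DecZ => x; rewrite hP.
- have [t1 t2 t3] := hI _ AS.
  have [_ _ t4] := hI _ (subsetDl S2 A).
  apply: (DecM IH (t3 A0) t1 _ (hf _ _ AS hf') _ (fun x => e (sigma x))).
    by rewrite -t2 t4.
  by rewrite -t2; apply: hf => //; exact: subsetDl.
- have [t1 t2 t3] := hI _ pS.
  have hg' : form (S1 :\: tau p.1) (fun x => g (sigma x)).
    by rewrite -t2; apply: hf => //; exact: subsetDl.
  have := DecD IH (Dec_mulform (hG _ pG pS) t1 hg'); rewrite addn0 => h'.
  by apply: Dec_eq h' _ => x; rewrite e.
Qed.

End Substitution.

Section LinearSubstitution.
Variables (F : finFieldType) (n1 n2 k : nat).
Local Notation X1 := {ffun 'I_k -> 'rV[F]_n1}.
Local Notation X2 := {ffun 'I_k -> 'rV[F]_n2}.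

Definition cmap (L : 'I_k -> 'rV[F]_n1 -> 'rV[F]_n2) (x : X1) : X2 := [ffun j => L j (x j)].

Lemma cmap_upd L x i v : cmap L (upd x i v) = upd (cmap L x) i (L i v).
Proof. by apply/ffunP => j; rewrite !ffunE; case: eqP => // ->. Qed.

Lemma form_cmap (L : 'I_k -> 'rV[F]_n1 -> 'rV[F]_n2) I f : (forall i, linear (L i)) -> form I f ->
  form I (fun x => f (cmap L x)).
Proof.
move=> hL [f1 f2]; split=> i iI x => [a u v|v]; first by rewrite !cmap_upd hL f1.
by rewrite cmap_upd f2.
Qed.

Lemma Dec_cmap (L : 'I_k -> 'rV[F]_n1 -> 'rV[F]_n2)
    (G2 : seq ({set 'I_k} * (X2 -> F))) (G1 : seq ({set 'I_k} * (X1 -> F))) (S : {set 'I_k}) r P :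
  (forall i, linear (L i)) ->
  (forall p, p \in G2 -> p.1 \subset S -> Dec G1 p.1 0 (fun x => p.2 (cmap L x))) ->
  Dec G2 S r P -> Dec G1 S r (fun x => P (cmap L x)).
Proof.
move=> hL hG; apply: (@Dec_subst _ _ _ _ _ id S S) => // I f IS.
exact: form_cmap.
Qed.

End LinearSubstitution.

Section RankBias.
Variables (R : realFieldType) (F : finFieldType) (n k : nat).
Local Notation V := 'rV[F]_n.
Local Notation X := {ffun 'I_k -> V}.
Local Notation psi := (@psi R F).
Local Notation q := (#|F|%:R : R).
Implicit Types (S A : {set 'I_k}) (f g P : X -> F) (G : seq ({set 'I_k} * (X -> F))).

(** Average over the coordinates outside A first: the result is 1 where f vanishes and non-negative
    elsewhere, so the bias is at least the density of the zeros of f. *)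
Lemma beta_prod S A f g : A != set0 -> A \subset S -> S :\: A != set0 ->
  form A f -> form (S :\: A) g -> q^-1 <= beta R [::] (fun x => f x * g x).
Proof.
move=> A0 AS SA hf hg; apply: le_trans (dens1_ge R A0 hf) _.
rewrite /beta (avg_mix A); apply: ler_avg => x; rewrite /zg /= andbT.
have e : avg (fun w => (zg [::] (mix A x w))%:R * psi (f (mix A x w) * g (mix A x w))) =
   beta R [::] (fun w => f x * g w).
  apply: eq_avg => w; rewrite (form_mixl _ _ hf) // (form_mixr _ _ hg) //.
  by rewrite -setI_eq0; apply/eqP/setP => i; rewrite !inE; case: (i \in A); rewrite ?andbF.
rewrite e; case: eqP => [->|_] /=; last first.
  have wf0 : wfg ([::] : seq ({set 'I_k} * (X -> F))) by [].
  exact: (beta_ge0 R wf0 (formZ (f x) hg) SA).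
rewrite (beta_eq R (P' := fun=> 0)) ?beta0 ?dens_nil // => w _; exact: mul0r.
Qed.

Lemma Dec_beta_ge S r P : S != set0 -> Dec [::] S r P -> q ^- r <= beta R [::] P.
Proof.
move=> S0; elim=> {r P} [P hP|r P Q A f g hP IH A0 AS SA hf hg e|r P Q p g _ IH //].
  by rewrite expr0 invr1 (beta_eq R (P' := fun=> 0)) ?beta0 ?dens_nil.
rewrite (beta_eq R (P' := fun x => P x + f x * g x)) => [|x _]; last exact: e.
have wf0 : wfg ([::] : seq ({set 'I_k} * (X -> F))) by [].
apply: le_trans (beta_corr (S := S) R (G := [::]) (G' := [::]) wf0 wf0 S0 _ (Dec_form wf0 hP) (formMD hf hg AS)) => //.
rewrite exprSr invfM; apply: ler_pM => //; rewrite ?invr_ge0 ?exprn_ge0 ?ler0n //.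
exact: (beta_prod A0 AS SA hf hg).
Qed.

(** Subtracting a form of rank r costs at most a factor q^-r: correlate P over G with the negative
    of P0 over the empty system. *)
Lemma beta_sub_rank G S r P P0 : wfg G -> S != set0 -> (forall p, p \in G -> p.1 \subset S) ->
  form S P -> Dec [::] S r P0 -> beta R G P * q ^- r <= beta R G (fun x => P x - P0 x).
Proof.
move=> wf S0 GS hP h0; have wf0 : wfg ([::] : seq ({set 'I_k} * (X -> F))) by [].
have h0' := DecN h0.
have := beta_corr (S := S) R (G := G) (G' := [::]) wf wf0 S0 _ hP (Dec_form wf0 h0').
rewrite cats0 => /(_ GS); apply: le_trans; apply: ler_wpM2l.
  exact: beta_ge0 hP S0.
exact: Dec_beta_ge h0'.
Qed.

End RankBias.

Lemma leq_expl (e m n : nat) : (m <= n)%N -> (m ^ e <= n ^ e)%N.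
Proof. by case: e => [|e] mn; rewrite ?expn0 // leq_exp2r. Qed.

(** One number serves as factor and as exponent in all bounds, so that constants may always be
    enlarged. *)
Lemma pow_bound_le (a b M N : nat) : (a <= b)%N -> (M <= N)%N -> (0 < N)%N ->
  (a * M ^ a <= b * N ^ b)%N.
Proof.
move=> ab MN N0; apply: leq_mul => //; apply: (@leq_trans (N ^ a)); first exact: leq_expl.
by rewrite leq_pexp2l.
Qed.

(** * Towers of multilinear forms *)

Section Towers.
Variables (F : finFieldType) (n k : nat).
Local Notation V := 'rV[F]_n.
Local Notation X := {ffun 'I_k -> V}.
Local Notation tower := (seq ({set 'I_k} * seq (X -> F))).
Implicit Types (I U : {set 'I_k}) (T : tower) (P : X -> F).

Definition gens T := flatten [seq lay L.1 L.2 | L <- T].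
Definition msz T := size (gens T).
Definition wft T := forall L, L \in T -> L.1 != set0 /\ forall f, f \in L.2 -> form L.1 f.
Definition subt T U : tower := [seq L : {set 'I_k} * seq (X -> F) <- T | L.1 \subset U].

Lemma gens_cat T T' : gens (T ++ T') = gens T ++ gens T'.
Proof. by rewrite /gens map_cat flatten_cat. Qed.

Lemma gens1 L : gens [:: L] = lay L.1 L.2.
Proof. by rewrite /gens /= cats0. Qed.

Lemma msz_cat T T' : msz (T ++ T') = (msz T + msz T')%N.
Proof. by rewrite /msz gens_cat size_cat. Qed.

Lemma msz1 L : msz [:: L] = size L.2.
Proof. by rewrite /msz gens1 size_map. Qed.

Lemma msz_cons L T : msz (L :: T) = (size L.2 + msz T)%N.
Proof. by rewrite -cat1s msz_cat msz1. Qed.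

Lemma mem_gens T p : reflect (exists2 L, L \in T & p \in lay L.1 L.2) (p \in gens T).
Proof. exact: flatten_mapP. Qed.

Lemma wfg_gens T : wft T -> wfg (gens T).
Proof. by move=> h p /mem_gens[L LT /mapP[f ff ->]]; have [? hf] := h _ LT; split=> //; apply: hf. Qed.

Lemma gens_subt T U : gens (subt T U) = subg (gens T) U.
Proof.
elim: T => [|L T IH] //; rewrite -cat1s gens_cat /subg filter_cat -/(subg (gens T) U) -IH.
rewrite gens1 /subt /=; case: ifP => LU.
  rewrite -cat1s gens_cat gens1; congr (_ ++ _); apply/esym/all_filterP/allP.
  by move=> p /mapP[f _ ->].
rewrite [X in X ++ _](_ : _ = [::]) //; apply/eqP; rewrite -[_ == _]negbK -has_filter.
by apply/hasPn => p /mapP[f _ ->] /=; rewrite LU.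
Qed.

Lemma wft_cat T T' : wft (T ++ T') <-> wft T /\ wft T'.
Proof.
split=> [h|[h h'] p]; last by rewrite mem_cat => /orP[/h|/h'].
by split=> p pT; apply: h; rewrite mem_cat pT ?orbT.
Qed.

Lemma wft_subt T U : wft T -> wft (subt T U).
Proof. by move=> h L; rewrite mem_filter => /andP[_ /h]. Qed.

Lemma msz_subt T U : (msz (subt T U) <= msz T)%N.
Proof. by rewrite /msz gens_subt size_filter count_size. Qed.

Lemma subt_id T U : (forall L, L \in T -> L.1 \subset U) -> subt T U = T.
Proof. by move=> h; apply/all_filterP/allP => L /h. Qed.

(** Here [a] stands for both constants A and B, and [t.+1] for the parameter s. *)
Definition regular (a t : nat) T := forall T1 L T2, T = T1 ++ L :: T2 ->
  forall c : 'rV[F]_(size L.2), c != 0 ->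
  forall r, (r <= a * (size L.2 + msz T2 + t.+1) ^ a)%N -> ~ Dec (gens T1) L.1 r (comb c).

Lemma regular_weaken a t a' t' T :
  (forall s, (a' * (s + t'.+1) ^ a' <= a * (s + t.+1) ^ a)%N) ->
  regular a t T -> regular a' t' T.
Proof.
move=> h reg T1 L T2 e c c0 r rle; apply: (reg _ _ _ e c c0).
exact: leq_trans rle (h _).
Qed.

(** The layers cut off still count, through the level. *)
Lemma regular_prefix a t T1 T2 : regular a t (T1 ++ T2) -> regular a (t + msz T2) T1.
Proof.
move=> reg T3 L T4 e c c0 r rle; apply: (reg T3 L (T4 ++ T2)) c c0 _ _.
  by rewrite e -catA.
have -> // : (size L.2 + msz (T4 ++ T2) + t.+1 = size L.2 + msz T4 + (t + msz T2).+1)%N.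
by rewrite msz_cat; lia.
Qed.

Lemma filter_split (E : Type) (p : pred E) (s s1 s2 : seq E) x :
  filter p s = s1 ++ x :: s2 ->
  exists u1 u2, [/\ s = u1 ++ x :: u2, filter p u1 = s1 & filter p u2 = s2].
Proof.
elim: s s1 => [|y s IH] s1 /=; first by case: s1.
case: ifP => py; last first.
  move=> /IH[u1 [u2 [-> <- <-]]]; exists (y :: u1), u2; by rewrite /= py.
case: s1 => [[-> <-]|z s1 [<- /IH[u1 [u2 [-> <- <-]]]]]; first by exists [::], s.
by exists (y :: u1), u2; rewrite /= py.
Qed.

Lemma regular_subt a t T U : regular a t T -> regular a t (subt T U).
Proof.
move=> reg T1 L T2 e c c0 r rle h.
have [u1 [u2 [e0 e1 e2]]] := filter_split e.
apply: (reg u1 L u2 e0 c c0 r).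
  apply: leq_trans rle _; rewrite leq_mul2l; apply/orP; right.
  apply: leq_expl.
  by rewrite leq_add2r leq_add2l -e2 msz_subt.
apply: Dec_incl h => p; rewrite -e1 -/(subt u1 U) gens_subt mem_filter.
by case/andP.
Qed.

End Towers.

(** Each layer consumes precision: the lower layers are needed with C + 3 in place of C. The second
    summand makes regularity beat the rank that [Rloc] yields at level (C + 3)(t + m + 1), m being
    the size of the last layer. *)
Fixpoint eqexp (a0 h C : nat) : nat :=
  if h is h'.+1 then (eqexp a0 h' (C + 3) + a0 * (C + 4) ^ a0)%N else 0%N.

(** * Local bias-rank statements and equidistribution of towers of forms *)

Section Local.
Variables (R : realFieldType) (F : finFieldType) (n k : nat).
Local Notation V := 'rV[F]_n.
Local Notation X := {ffun 'I_k -> V}.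
Local Notation tower := (seq ({set 'I_k} * seq (X -> F))).
Local Notation q := (#|F|%:R : R).
Implicit Types (I U : {set 'I_k}) (T : tower) (P : X -> F) (G : seq ({set 'I_k} * (X -> F))).

(** At t = 0 the value q^-0 = 1 would leave no room for the errors of equidistribution; 2^-a is that
    room. *)
Definition theta (a t : nat) : R := if t == 0%N then 1 - 2%:R ^- a else q ^- t.

Lemma theta_mono a a' t : (a <= a')%N -> theta a t <= theta a' t.
Proof.
move=> h; rewrite /theta; case: eqP => // _; rewrite lerD2l lerN2.
by rewrite lef_pV2 ?posrE ?exprn_gt0 // ler_weXn2l // ler1n.
Qed.

Lemma theta_ge0 a t : 0 <= theta a t.
Proof.
rewrite /theta; case: eqP => _; last by rewrite ltW // qV_gt0.
by rewrite subr_ge0 invf_le1 ?exprn_gt0 // exprn_ege1 // ler1n.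
Qed.

(* The level t = 0 asks for a bias close to 1 and yields membership in the ideal. *)
Definition Rloc (a : nat) T I := forall t P, form I P -> regular a t T ->
  theta a t * dens R (gens T) <= beta R (gens T) P ->
  exists2 r, (r <= a * t ^ a)%N & Dec (gens T) I r P.

Lemma Rloc_mono a a' T I : (a <= a')%N -> Rloc a T I -> Rloc a' T I.
Proof.
move=> aa h t P hP reg le.
have [r rle hr] : exists2 r, (r <= a * t ^ a)%N & Dec (gens T) I r P.
  apply: h => //.
    by apply: regular_weaken reg => s; apply: pow_bound_le => //; rewrite addnS.
  apply: le_trans le; rewrite ler_wpM2r ?dens_ge0 //; exact: theta_mono.
exists r => //; apply: leq_trans rle _.
case: t {reg le hr} => [|t]; last exact: pow_bound_le.
by case: a {aa h} => // a; rewrite exp0n ?muln0.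
Qed.

Lemma dens_subg_le G U delta : wfg G -> dens R G <= (1 + delta) * q ^- size G ->
  dens R (subg G U) <= (1 + delta) * q ^- size (subg G U).
Proof.
move=> wf le; rewrite -(ler_pM2r (qV_gt0 R F (size (crossg G U)))) -[leRHS]mulrA -qVD size_subg.
apply: le_trans le; rewrite (dens_fibre R U wf) -avgZr; apply: ler_avg => x.
rewrite ler_wpM2l ?ler0n //; exact: fibre_dens_ge.
Qed.

(** Expand the indicator of the last layer L in combinations of its forms; the zero combination
    gives the main term. A nonzero combination with a large bias over the lower layers would have
    one over those supported in L.1, by [beta_restrict], hence small rank by [Rloc], against
    regularity. *)
Lemma equidistribution h a0 C T t : wft T -> (size T <= h)%N ->
  (forall T1 L T2, T = T1 ++ L :: T2 -> Rloc a0 (subt T1 L.1) L.1) ->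
  regular (eqexp a0 h C) t T -> dens R (gens T) <= (1 + q ^- (C * t.+1)) * q ^- msz T.
Proof.
elim: h C T t => [|h IH] C T t.
  move=> _; rewrite leqn0 size_eq0 => /eqP -> _ _.
  rewrite dens_nil /msz /= invr1 mulr1 lerDl; exact/ltW/qV_gt0.
have ha1 := IH (C + 3)%N; rewrite [eqexp _ _ _]/=; move: (eqexp a0 h _) ha1 => a1 ha1 {IH}.
case/lastP: T => [|T L] wf sz loc reg.
  rewrite dens_nil /msz /= invr1 mulr1 lerDl; exact/ltW/qV_gt0.
move: wf sz loc reg; rewrite size_rcons ltnS -cats1 => /wft_cat[wf wfL] sz loc reg.
have [L0 LF] : L.1 != set0 /\ forall f, f \in L.2 -> form L.1 f by apply: wfL; rewrite inE.
set m := size L.2; have reg1 := regular_prefix reg; rewrite msz1 -/m in reg1.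
(* The level must beat the q^m combinations and a factor 4, which is at most q^2, and still leave an
   error q^-(C(t+1)). *)
set ti := ((C + 3) * (t + m).+1)%N.
have d1 : dens R (gens T) <= (1 + q ^- ti) * q ^- msz T.
  apply: ha1 => // [T1 L' T2 e|].
    by apply: (loc T1 L' (T2 ++ [:: L])); rewrite e -catA.
  apply: regular_weaken reg1 => s; apply: pow_bound_le => //; [exact: leq_addr|by rewrite addnS].
have wfG := wfg_gens wf.
have bc (c : 'rV[F]_m) : c != 0 -> beta R (gens T) (comb c) <= 3%:R * q ^- ti * q ^- msz T.
  move=> c0; apply: le_trans (beta_restrict wfG (form_comb c LF) d1) _.
  have dsub := dens_subg_le L.1 wfG d1.
  have bsub : beta R (subg (gens T) L.1) (comb c) <= q ^- ti * dens R (subg (gens T) L.1).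
    rewrite leNgt; apply/negP => /ltW le.
    have [r rle hr] : exists2 r, (r <= a0 * ti ^ a0)%N & Dec (gens (subt T L.1)) L.1 r (comb c).
      apply: (loc T L [::] erefl ti); rewrite ?gens_subt //; first exact: form_comb.
        apply: regular_subt; apply: regular_weaken reg1 => s.
        apply: (@leq_trans ((a0 * (C + 4) ^ a0) * (s + (t + m).+1) ^ a0)).
          rewrite -mulnA leq_mul2l -expnMn; apply/orP; right; apply: leq_expl.
          rewrite /ti; nia.
        apply: leq_mul; first exact: leq_addl.
        rewrite leq_pexp2l ?addnS //; case: (posnP a0) => [->//|a00].
        apply: leq_trans (leq_addl _ _); rewrite leq_pmulr // expn_gt0; lia.
      by rewrite /theta (_ : (ti == 0)%N = false) // /ti; lia.
    apply: (reg T L [::] erefl c c0 r); last first.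
      by apply: Dec_incl hr => p; rewrite gens_subt mem_filter => /andP[].
    apply: leq_trans rle _; rewrite /ti expnMn mulnA [msz [::]]/msz /= addn0 -/m.
    apply: leq_mul.
      apply: leq_trans (leq_addl _ _); rewrite leq_mul2l; apply/orP; right.
      by apply: leq_expl; rewrite leq_add2l.
    apply: (@leq_trans ((m + t.+1) ^ a0)); last first.
      rewrite leq_pexp2l ?addnS //; case: (posnP a0) => [->//|a00].
      apply: leq_trans (leq_addl _ _); rewrite leq_pmulr // expn_gt0; lia.
    apply: leq_expl; lia.
  have e : q ^- msz T = q ^- size (subg (gens T) L.1) * q ^- size (crossg (gens T) L.1).
    by rewrite -qVD size_subg.
  have p1 := qV_gt0 R F ti; have p2 := qV_le1 R F ti.
  have p3 := qV_gt0 R F (size (subg (gens T) L.1)).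
  have p4 := qV_gt0 R F (size (crossg (gens T) L.1)).
  have : q ^- size (crossg (gens T) L.1) * beta R (subg (gens T) L.1) (comb c) <=
     q ^- size (crossg (gens T) L.1) * (q ^- ti * ((1 + q ^- ti) * q ^- size (subg (gens T) L.1))).
    apply: ler_wpM2l; first exact: ltW.
    by apply: le_trans bsub _; apply: ler_wpM2l; first exact: ltW.
  rewrite -/(msz T) e; set A := q ^- ti in p1 p2 *; set B := q ^- _ in p3 *; set D := q ^- _ in p4 *.
  have : 0 <= A * (1 - A) * (B * D).
    by apply: mulr_ge0; [apply: mulr_ge0; [exact: ltW|rewrite subr_ge0]|apply/ltW/mulr_gt0].
  move=> ? ?; lra.
rewrite gens_cat gens1 dens_lay msz_cat msz1 -/m.
rewrite {1}/avg (bigD1 0) //= card_mx mul1n natrX.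
have -> : beta R (gens T) (comb (0 : 'rV[F]_m)) = dens R (gens T).
  rewrite -beta0; apply: beta_eq => x _; rewrite /comb big1 // => j _; by rewrite mxE mul0r.
have sumle : \sum_(c : 'rV[F]_m | c != 0) beta R (gens T) (comb c) <=
    q ^+ m * (3%:R * q ^- ti * q ^- msz T).
  apply: le_trans (_ : \sum_(c : 'rV[F]_m | c != 0) 3%:R * q ^- ti * q ^- msz T <= _).
    by apply: ler_sum => c /bc.
  rewrite sumr_const -[leLHS]mulr_natl; apply: ler_wpM2r.
    by apply: mulr_ge0; [apply: mulr_ge0|]; rewrite ?ler0n // ltW // qV_gt0.
  rewrite -natrX ler_nat; have := card_mx F 1 m; rewrite mul1n => <-; exact: max_card.
have qm := exprn_gt0 m (q_gt0 R F).
rewrite addnC qVD mulrCA ler_pM2l ?invr_gt0 //.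
apply: le_trans (lerD d1 sumle) _.
rewrite !mulrA -mulrDl ler_pM2r ?qV_gt0 // -addrA lerD2l.
have le4 : 4%:R <= q ^+ 2.
  rewrite expr2; apply: le_trans (_ : 2%:R * 2%:R <= _); first by rewrite -natrM.
  by apply: ler_pM; rewrite ?ler0n // ler_nat card_F_gt1.
have qm1 : 1 <= q ^+ m by rewrite exprn_ege1 // ltW // q_gt1.
apply: le_trans (_ : q ^+ 2 * q ^+ m * q ^- ti <= _).
  rewrite -[X in X + _]mul1r -mulrDl; apply: ler_wpM2r; first exact/ltW/qV_gt0.
  apply: le_trans (_ : 4%:R * q ^+ m <= _); first by lra.
  by apply: ler_wpM2r => //; exact: ltW.
rewrite -exprD ler_pdivrMr ?exprn_gt0 ?q_gt0 // mulrC ler_pdivlMr ?exprn_gt0 ?q_gt0 // -exprD.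
rewrite ler_weXn2l ?ltW ?q_gt1 //; rewrite /ti; nia.
Qed.

End Local.

(* R(k,c,h): the relative bias-rank theorem for forms on k coordinates, towers of
   height at most h whose forms involve at most c of these coordinates. *)
Definition RBR (R : realFieldType) (k c h a : nat) := forall (F : finFieldType) (n kk : nat)
  (I : {set 'I_kk}) (T : seq ({set 'I_kk} * seq ({ffun 'I_kk -> 'rV[F]_n} -> F))),
  #|I| = k -> I != set0 -> wft T -> (forall L, L \in T -> L.1 \subset I) ->
  (#|\bigcup_(L <- T) L.1| <= c)%N -> (size T <= h)%N -> Rloc R a T I.

Lemma RBR_mono R k c h a a' : (a <= a')%N -> RBR R k c h a -> RBR R k c h a'.
Proof.
move=> aa H F n kk I T h1 h2 h3 h4 h5 h6; apply: Rloc_mono aa _; exact: H.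
Qed.

(** * Regularization of systems of forms *)

Section Weights.
Variables (a t r k : nat).

(* size_bound i bounds the number of generators on at least k - i coordinates. *)
Fixpoint size_bound (i : nat) : nat :=
  if i is j.+1 then (size_bound j * (a * (size_bound j + t.+1) ^ a).+1)%N else r.
Definition rank_bound i := (a * (size_bound i + t.+1) ^ a)%N.
(** Chosen so that a form on e + 1 coordinates outweighs [rank_bound (k - e.+1)] forms on e
    coordinates, the largest number of forms for which it may be exchanged. *)
Definition weight (e : nat) : nat := (\prod_(j < e) (rank_bound (k - j.+1)).+1)%N.

Lemma weight_gt0 e : (0 < weight e)%N.
Proof. exact: prodn_gt0. Qed.

Lemma weightS e : weight e.+1 = (weight e * (rank_bound (k - e.+1)).+1)%N.
Proof. by rewrite /weight big_ord_recr. Qed.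

Lemma weight_le e e' : (e <= e')%N -> (weight e <= weight e')%N.
Proof.
move=> /subnKC <-; elim: (e' - e)%N => [|d IH]; first by rewrite addn0.
by rewrite addnS weightS (leq_trans IH) // leq_pmulr.
Qed.

(** Thus a total weight of at most [r * weight k] leaves room for no more than [size_bound d] forms
    on k - d or more coordinates. *)
Lemma weight_size_bound d : (d <= k)%N -> (weight (k - d) * size_bound d = r * weight k)%N.
Proof.
elim: d => [|d IH] dk; first by rewrite subn0 mulnC.
rewrite -IH ?(ltnW dk) //= -[in RHS](subnSK dk) weightS.
have -> : (k - (k - d.+1).+1 = d)%N by lia.
by rewrite /rank_bound; ring.
Qed.

End Weights.

Lemma size_bound_le (a k : nat) : exists b, forall t r, (size_bound a t r k <= b * (r + t.+1) ^ b)%N.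
Proof.
elim: k => [|k [b IH]].
  by exists 1%N => t r /=; rewrite mul1n expn1 leq_addr.
exists (b * (1 + a * (b + 1) ^ a) + b + (b + 1) * a)%N => t r /=.
set M := (r + t.+1)%N; set B := size_bound a t r k.
have M1 : (0 < M)%N by rewrite /M; lia.
have hB : (B <= b * M ^ b)%N := IH t r.
have hBt : (B + t.+1 <= (b + 1) * M ^ (b + 1))%N.
  rewrite mulnDl mul1n; apply: leq_add.
    by apply: leq_trans hB _; rewrite leq_mul2l leq_pexp2l ?leq_addr ?orbT.
  apply: (@leq_trans M); first by rewrite /M leq_addl.
  by rewrite -{1}[M]expn1 leq_pexp2l // addn1.
have h2 : ((a * (B + t.+1) ^ a).+1 <= (1 + a * (b + 1) ^ a) * M ^ ((b + 1) * a))%N.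
  rewrite -add1n mulnDl; apply: leq_add; first by rewrite mul1n expn_gt0 M1.
  by rewrite -mulnA leq_mul2l expnM -expnMn leq_expl ?orbT.
apply: leq_trans (leq_mul hB h2) _.
rewrite mulnACA -expnD; apply: leq_mul; first by rewrite -addnA leq_addr.
by rewrite leq_pexp2l // -addnA leq_addl.
Qed.

Section Regularization.
Variables (F : finFieldType) (n kk : nat).
Local Notation V := 'rV[F]_n.
Local Notation X := {ffun 'I_kk -> V}.
Local Notation tower := (seq ({set 'I_kk} * seq (X -> F))).
Local Notation system := (seq ({set 'I_kk} * (X -> F))).
Implicit Types (us : seq {set 'I_kk}) (G : system) (A S N : {set 'I_kk}).

Definition layers_of us G : tower := [seq (A, [seq p.2 | p <- G & p.1 == A]) | A <- us].

Lemma gens_layers_of us G p : (p \in gens (layers_of us G)) = (p.1 \in us) && (p \in G).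
Proof.
apply/idP/idP.
  case/mem_gens => L /mapP[A Aus ->] /mapP[f /mapP[p']]; rewrite mem_filter.
  by case: p' => A' f' /= /andP[/eqP -> pG] -> -> /=; rewrite Aus.
case/andP => pus pG; apply/mem_gens; exists (p.1, [seq p'.2 | p' <- G & p'.1 == p.1]).
  by apply/mapP; exists p.1.
apply/mapP; exists p.2; last by case: p {pus pG}.
by apply/mapP; exists p; rewrite ?mem_filter ?eqxx.
Qed.

Lemma msz_layers_of us G : uniq us -> msz (layers_of us G) = count (fun p => p.1 \in us) G.
Proof.
elim: us => [|A us IH] /=.
  by move=> _; rewrite /msz /=; elim: G => //= p G <-.
case/andP => Aus uus; rewrite msz_cons IH //= size_map size_filter.
elim: G {IH} => //= p G <-; rewrite inE; case: (p.1 =P A) => [->|_] /=; first by rewrite (negbTE Aus); lia.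
lia.
Qed.

Lemma map_split (E E' : Type) (g : E -> E') (s : seq E) s1 x s2 :
  map g s = s1 ++ x :: s2 ->
  exists u1 y u2, [/\ s = u1 ++ y :: u2, map g u1 = s1, g y = x & map g u2 = s2].
Proof.
elim: s1 s => [|z s1 IH] [|y s] //=.
  by case=> <- <-; exists [::], y, s.
by case=> <- /IH[u1 [y' [u2 [-> <- <- <-]]]]; exists (y :: u1), y', u2.
Qed.

Lemma cat_split (E : Type) (s s' s1 s2 : seq E) x : s ++ s' = s1 ++ x :: s2 ->
  (exists u, s = s1 ++ x :: u /\ s2 = u ++ s') \/
  (exists u, s' = u ++ x :: s2 /\ s1 = s ++ u).
Proof.
elim: s s1 => [|y s IH] s1 /=; first by right; exists s1.
case: s1 => [|z s1] /= [].
  by move=> -> <-; left; exists s.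
by move=> -> /IH[[u [-> ->]]|[u [-> ->]]]; [left|right]; exists u.
Qed.

(** Sorted by size, so that the forms on proper subsets of A belong to layers before that of A.
    Meeting N is what makes the induction of [RBR_step] terminate. *)
Definition subsets_of S N : seq {set 'I_kk} :=
  sort (fun A B : {set 'I_kk} => #|A| <= #|B|)%N [seq A : {set 'I_kk} <- enum {: {set 'I_kk}} | (A \proper S) && (A :&: N != set0)].

Lemma mem_subsets_of S N A : (A \in subsets_of S N) = (A \proper S) && (A :&: N != set0).
Proof. by rewrite mem_sort mem_filter mem_enum andbT. Qed.

Lemma uniq_subsets_of S N : uniq (subsets_of S N).
Proof. by rewrite sort_uniq filter_uniq // enum_uniq. Qed.

Lemma size_subsets_of S N : (size (subsets_of S N) <= 2 ^ #|S|)%N.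
Proof.
rewrite -card_powerset cardE; apply: uniq_leq_size; first exact: uniq_subsets_of.
by move=> A; rewrite mem_subsets_of mem_enum inE => /andP[/proper_sub].
Qed.

Lemma subsets_of_sorted S N u1 A u2 B : subsets_of S N = u1 ++ A :: u2 -> B \in u2 ->
  (#|A| <= #|B|)%N.
Proof.
move=> e Bu; have tr : transitive (fun A B : {set 'I_kk} => #|A| <= #|B|)%N.
  by move=> x y z; exact: leq_trans.
have : sorted (fun A B : {set 'I_kk} => #|A| <= #|B|)%N (subsets_of S N).
  by apply: sort_sorted => x y; exact: leq_total.
rewrite e; case/cat_sorted2 => _ /= /(order_path_min tr) /allP; exact.
Qed.

Lemma sum_rem_nth (T : eqType) (w : T -> nat) (s : seq T) x : x \in s ->
  (\sum_(y <- s) w y = w x + \sum_(y <- rem x s) w y)%N.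
Proof. by move=> xs; rewrite (perm_big _ (perm_to_rem xs)) big_cons. Qed.

Section MinimalWeight.
Variables (a t : nat) (S N : {set 'I_kk}) (T : tower) (Gs : system).
Let us := subsets_of S N.
Let w A := weight a t (size Gs) #|S| #|A|.
Let Phi G := (\sum_(p <- G) w p.1)%N.

(** Descent on the total weight. If a nonzero combination of the layer of A has small rank over the
    earlier layers, [Dec_absorb] puts it in the ideal of these and of few forms on proper subsets of
    A; a generator that occurs in the combination is exchanged for those forms. *)
Lemma minimal_weight (G : system) :
  (forall p, p \in G -> p.1 \in us /\ form p.1 p.2) -> (Phi G <= size Gs * weight a t (size Gs) #|S| #|S|)%N ->
  (forall p, p \in Gs -> Dec (gens T ++ G) p.1 0 p.2) ->
  exists G' : system, [/\ forall p, p \in G' -> p.1 \in us /\ form p.1 p.2,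
    (Phi G' <= size Gs * weight a t (size Gs) #|S| #|S|)%N,
    forall p, p \in Gs -> Dec (gens T ++ G') p.1 0 p.2 &
    forall u1 A u2, us = u1 ++ A :: u2 ->
    forall c : 'rV[F]_(size [seq p.2 | p <- G' & p.1 == A]), c != 0 ->
    forall r, (r <= rank_bound a t (size Gs) (#|S| - #|A|))%N ->
      ~ Dec (gens T ++ gens (layers_of u1 G')) A r (comb c)].
Proof.
have [m] := ubnP (Phi G); elim: m G => // m IH G lem hG hPhi hDec.
case: (pselect (forall u1 A u2, us = u1 ++ A :: u2 ->
    forall c : 'rV[F]_(size [seq p.2 | p <- G & p.1 == A]), c != 0 ->
    forall r, (r <= rank_bound a t (size Gs) (#|S| - #|A|))%N ->
      ~ Dec (gens T ++ gens (layers_of u1 G)) A r (comb c))) => [reg|nreg].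
  by exists G.
have [u1 [A [u2 [e [c [c0 [r [rle hr]]]]]]]] : exists u1 A u2, us = u1 ++ A :: u2 /\
    exists c : 'rV[F]_(size [seq p.2 | p <- G & p.1 == A]), c != 0 /\
    exists r, (r <= rank_bound a t (size Gs) (#|S| - #|A|))%N /\
      Dec (gens T ++ gens (layers_of u1 G)) A r (comb c).
  apply: contrapT => no; apply: nreg => u1 A u2 e c c0 r rle hr; apply: no.
  by exists u1, A, u2; split=> //; exists c; split=> //; exists r.
have Aus : A \in us by rewrite e mem_cat inE eqxx orbT.
have /andP[AS AN] : (A \proper S) && (A :&: N != set0) by rewrite -mem_subsets_of.
have [Gn [sGn wfGn hGn absGn]] := Dec_absorb AN hr.
have [j cj] : exists j, c 0 j != 0.
  apply: contrapT => no; move/eqP: c0; apply; apply/rowP => j; rewrite mxE.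
  by apply/eqP; apply: contrapT => /negP cj; apply: no; exists j.
set fs := [seq p.2 | p <- G & p.1 == A] in c cj c0 hr absGn.
set p0 : {set 'I_kk} * (X -> F) := (A, nth (fun=> 0) fs j).
have p0G : p0 \in G.
  have : nth (fun=> 0) fs j \in fs by rewrite mem_nth.
  by case/mapP => -[A' f']; rewrite mem_filter /= => /andP[/eqP -> ?] ff; rewrite /p0 ff.
pose G' := rem p0 G ++ Gn.
have Gn_us p : p \in Gn -> p.1 \in us /\ form p.1 p.2.
  move=> pGn; have [pA pN] := hGn _ pGn; split; last exact: (wfGn _ pGn).2.
  by rewrite mem_subsets_of (proper_sub_trans pA (proper_sub AS)).
have A1 : (0 < #|A|)%N.
  rewrite card_gt0; apply: contraNneq AN => ->; by rewrite set0I.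
have AcS : (#|A| <= #|S|)%N by rewrite subset_leq_card // proper_sub.
have wdec : (Phi G' < Phi G)%N.
  rewrite /Phi (sum_rem_nth _ p0G) /G' big_cat /= addnC ltn_add2r.
  apply: (@leq_ltn_trans (\sum_(p <- Gn) weight a t (size Gs) #|S| #|A|.-1)).
    rewrite big_seq [X in (_ <= X)%N]big_seq; apply: leq_sum => p /hGn[/proper_card pA _].
    by apply: weight_le; rewrite -ltnS prednK.
  rewrite big_const_seq count_predT iter_addn_0 sGn /w /= -{2}(prednK A1) weightS.
  rewrite prednK // ltn_mul2l weight_gt0 ltnS; exact: rle.
have hG'us p : p \in G' -> p.1 \in us /\ form p.1 p.2.
  by rewrite mem_cat => /orP[/mem_rem/hG|/Gn_us].
(* The combination lies in the ideal of the new system, and so do its terms other than the j-th; the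
   coefficient of p0 is invertible. *)
have hp0 : Dec (gens T ++ G') A 0 p0.2.
  have h1 : Dec (gens T ++ G') A 0 (comb c).
    apply: (@Dec_trans _ _ _ (gens T ++ gens (layers_of u1 G) ++ Gn)).
      move=> p; rewrite !mem_cat => /or3P[pT|pu|pGn] pA.
      + by apply: Dec_gen1; rewrite mem_cat pT.
      + move: pu; rewrite gens_layers_of => /andP[pu pG]; apply: Dec_gen1.
        rewrite !mem_cat (_ : p \in rem p0 G) ?orbT //.
        suff ne : p != p0.
          by have := pG; rewrite (perm_mem (perm_to_rem p0G)) inE (negbTE ne).
        apply: contraTneq pu => ->; rewrite /=.
        have := uniq_subsets_of S N; rewrite -/us e cat_uniq => /and3P[_ /hasPn h _].
        by apply: h; rewrite inE eqxx.
      + by apply: Dec_gen1; rewrite !mem_cat pGn !orbT.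
    apply: absGn => p pp; rewrite !mem_cat; first by move: pp; rewrite mem_cat orbA => ->.
    by rewrite pp !orbT.
  (* The list fs may contain repetitions: it is the entry at position j that leaves it, not every
     entry with that value. *)
  have pe : perm_eq (take j fs ++ drop j.+1 fs) [seq p.2 | p <- rem p0 G & p.1 == A].
    rewrite -(perm_cons (nth (fun=> 0) fs j)) -cat1s perm_catCA /= -drop_nth // cat_take_drop.
    by rewrite /fs (perm_trans (perm_map _ (perm_filter _ (perm_to_rem p0G)))) //= eqxx.
  have mem_rest (i : 'I_(size fs)) : i != j -> (A, nth (fun=> 0) fs i) \in rem p0 G.
    move=> ij; have : nth (fun=> 0) fs i \in take j fs ++ drop j.+1 fs.
      rewrite mem_cat; case: (ltngtP i j) => [lt|gt|/val_inj eq]; last by rewrite eq eqxx in ij.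
        by rewrite -(nth_take _ lt) mem_nth // size_take ltn_ord.
      apply/orP; right; rewrite -(subnKC gt) -nth_drop mem_nth // size_drop.
      by rewrite ltn_sub2r // (leq_ltn_trans gt).
    rewrite (perm_mem pe) => /mapP[[A' f']]; rewrite mem_filter /= => /andP[/eqP -> ?] ->.
    by [].
  have h2 : Dec (gens T ++ G') A 0 (fun x => \sum_(i < size fs)
      (if i != j then c 0 i * nth (fun=> 0) fs i x else 0)).
    apply: (@Dec_sum F n kk _ (index_enum 'I_(size fs)) (gens T ++ G') A
      (fun i x => if i != j then c 0 i * nth (fun=> 0) fs i x else 0)).
    move=> i; case: (boolP (i != j)) => ij; last exact: DecZ.
    have mi : (A, nth (fun=> 0) fs i) \in gens T ++ G' by rewrite !mem_cat mem_rest ?orbT.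
    exact: (DecS (c 0 i) (Dec_gen1 mi)).
  have := DecS (c 0 j)^-1 (DecD h1 (DecN h2)); rewrite addn0 => h3.
  apply: Dec_eq h3 _ => x; rewrite /comb /= -big_mkcond /= (bigD1 j) //= addrK.
  by rewrite mulKf.
have [|||G2 hG2] := IH G' _ hG'us; last by exists G2.
- exact: leq_trans wdec _.
- exact: leq_trans (ltnW wdec) hPhi.
move=> p pGs; apply: Dec_trans (hDec _ pGs) => p' + _.
rewrite mem_cat => /orP[pT|pG]; first by apply: Dec_gen1; rewrite mem_cat pT.
case: (p' =P p0) => [->|/eqP ne]; first exact: hp0.
apply: Dec_gen1; rewrite !mem_cat; have := pG.
by rewrite (perm_mem (perm_to_rem p0G)) inE (negbTE ne) /= => ->; rewrite orbT.
Qed.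
End MinimalWeight.

Lemma layers_of_wft S N G : (forall p, p \in G -> p.1 \in subsets_of S N /\ form p.1 p.2) ->
  wft (layers_of (subsets_of S N) G).
Proof.
move=> hG L /mapP[A]; rewrite mem_subsets_of => /andP[_ AN] -> /=; split.
  by apply: contraNneq AN => ->; rewrite set0I.
by move=> f /mapP[p]; rewrite mem_filter => /andP[/eqP <- /hG[_ hp]] ->.
Qed.

End Regularization.

(** The new layers come after T, whose regularity at a higher level absorbs their number. From the
    layer of A on, the new forms involve at least #|A| coordinates, so their number is at most
    [size_bound (k - #|A|)], as required by the rank bound of [minimal_weight]. *)
Lemma regularize (a k : nat) : exists b, forall (F : finFieldType) (n kk : nat) (S N : {set 'I_kk})
  (T : seq ({set 'I_kk} * seq ({ffun 'I_kk -> 'rV[F]_n} -> F))) t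
  (Gs : seq ({set 'I_kk} * ({ffun 'I_kk -> 'rV[F]_n} -> F))), #|S| = k ->
  (forall p, p \in Gs -> p.1 \in subsets_of S N /\ form p.1 p.2) ->
  regular a (t + b * (size Gs + t.+1) ^ b) T ->
  exists G, [/\ forall p, p \in G -> p.1 \in subsets_of S N /\ form p.1 p.2,
    (size G <= b * (size Gs + t.+1) ^ b)%N,
    regular a t (T ++ layers_of (subsets_of S N) G) &
    forall p, p \in Gs -> Dec (gens (T ++ layers_of (subsets_of S N) G)) p.1 0 p.2].
Proof.
have [b hb] := size_bound_le a k; exists b => F n kk S N T t Gs Sk hGs reg.
have cardle A : A \in subsets_of S N -> (#|A| <= k)%N.
  by rewrite mem_subsets_of -Sk => /andP[/proper_sub/subset_leq_card].
have [||G [h1 h2 h3 h4]] := @minimal_weight F n kk a t S N T Gs Gs hGs.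
- rewrite big_seq -sum1_size big_distrl /= [X in (_ <= X)%N]big_seq; apply: leq_sum => p /hGs[/cardle pk _].
  by rewrite mul1n; apply: weight_le; rewrite Sk.
- by move=> p pG; apply: Dec_gen1; rewrite mem_cat pG orbT.
rewrite Sk in h2 h4.
have cnt e : (e <= k)%N -> (count (fun p : {set 'I_kk} * ({ffun 'I_kk -> 'rV[F]_n} -> F) => e <= #|p.1|)%N G <= size_bound a t (size Gs) (k - e))%N.
  move=> ek; rewrite -(leq_pmul2l (weight_gt0 a t (size Gs) k e)).
  have := @weight_size_bound a t (size Gs) k (k - e) (leq_subr _ _).
  rewrite subKn // => ->; apply: leq_trans h2.
  rewrite -sum1_count big_distrr /= big_mkcond /=; apply: leq_sum => p _.
  by case: ifP => // ep; rewrite muln1; apply: weight_le.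
have sG : (size G <= b * (size Gs + t.+1) ^ b)%N.
  apply: leq_trans (hb _ _); rewrite -[k]subn0; apply: leq_trans (cnt _ (leq0n _)).
  by rewrite -count_predT; apply: sub_count.
have gensE p : p \in gens T ++ G -> p \in gens (T ++ layers_of (subsets_of S N) G).
  rewrite gens_cat !mem_cat gens_layers_of; case/orP => [->//|pG].
  by rewrite pG (h1 _ pG).1 orbT.
exists G; split=> //; last by move=> p /h3; apply: Dec_incl.
move=> T1 L T2 e c c0 r; case: (cat_split e) => [[u [eT e2]]|[u [eT e1]]] {e}.
  rewrite e2 msz_cat => rle; apply: (reg T1 L u eT c c0); apply: leq_trans rle _.
  rewrite leq_mul2l leq_expl ?orbT // -!addnA !leq_add2l addnC addSn ltnS leq_add2l.
  rewrite msz_layers_of ?uniq_subsets_of //; apply: leq_trans (count_size _ _) sG.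
have [u1 [A [u2 [eus eu eL eT2]]]] := map_split eT; move: c c0; rewrite -{}eL => c c0 rle.
rewrite e1 -eu gens_cat; apply: (h4 _ _ _ eus c c0 r); apply: leq_trans rle _.
have Aus : A \in subsets_of S N by rewrite eus mem_cat inE eqxx orbT.
rewrite leq_mul2l leq_expl ?orbT // leq_add2r; apply: leq_trans (cnt _ (cardle _ Aus)).
rewrite -eT2; have -> : (size [seq p.2 | p <- G & p.1 == A] + msz (layers_of u2 G))%N =
   msz (layers_of (A :: u2) G) by rewrite /= msz_cons.
rewrite msz_layers_of; last first.
  by have := uniq_subsets_of S N; rewrite eus cat_uniq => /and3P[].
apply: sub_count => p; rewrite inE => /orP[/eqP ->//|]; exact: subsets_of_sorted eus.
Qed.

(** * Random multipliers of the forms of a layer *)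

Section RandomMultipliers.
Variables (R : realFieldType) (F : finFieldType) (n kk : nat).
Local Notation V := 'rV[F]_n.
Local Notation X := {ffun 'I_kk -> V}.
Local Notation psi := (@psi R F).
Implicit Types (I J S : {set 'I_kk}) (P : X -> F) (fs : seq (X -> F)).
Implicit Types (G : seq ({set 'I_kk} * (X -> F))).

Definition monom J (v : {ffun 'I_kk -> 'I_n}) (x : X) : F := \prod_(i in J) x i 0 (v i).

Lemma form_monom J v : form J (monom J v).
Proof.
split=> i iJ x.
  move=> a u w; rewrite /monom !(bigD1 i iJ) /= !ffunE eqxx !mxE.
  have e (z : V) : \prod_(j in J | j != i) (upd x i z) j 0 (v j) = \prod_(j in J | j != i) x j 0 (v j).
    by apply: eq_bigr => j /andP[_ /negbTE ji]; rewrite ffunE ji.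
  by rewrite !e; ring.
move=> w; apply: eq_bigr => j jJ; rewrite ffunE; case: eqP => // e.
by rewrite -e jJ in iJ.
Qed.

(* Averaging over the coefficients of the T_j turns the factor psi(sum f_j T_j) into the
   indicator that all f_j(x) vanish or some coordinate of x outside I vanishes. *)
Lemma exists_multipliers G I S fs P : I \subset S -> I != set0 ->
  (forall f, f \in fs -> form I f) -> form S P ->
  exists T : 'I_(size fs) -> X -> F, (forall j, form (S :\: I) (T j)) /\
    beta R (G ++ lay I fs) P <=
    beta R G (fun x => P x + \sum_(j < size fs) nth (fun=> 0) fs j x * T j x).
Proof.
move=> IS I0 hfs hP; set J := S :\: I; set m := size fs.
pose D : finType := ('I_m * {ffun 'I_kk -> 'I_n})%type.
pose T (b : 'rV[F]_#|D|) (j : 'I_m) (x : X) : F :=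
  \sum_(c < #|D| | (enum_val c).1 == j) b 0 c * monom J (enum_val c).2 x.
have hT b j : form J (T b j) by apply: form_sum => c; apply/formZ/form_monom.
pose al (x : X) (c : 'I_#|D|) : F := nth (fun=> 0) fs (enum_val c).1 x * monom J (enum_val c).2 x.
have eT b x : \sum_(j < m) nth (fun=> 0) fs j x * T b j x = \sum_c b 0 c * al x c.
  rewrite [RHS](partition_big (fun c => (enum_val c).1) predT) //=.
  apply: eq_bigr => j _; rewrite mulr_sumr; apply: eq_bigr => c /eqP <-.
  by rewrite /al; ring.
have [b hb] := avg_exists_ge (0 : 'rV[F]_#|D|)
  (fun b => beta R G (fun x => P x + \sum_(j < m) nth (fun=> 0) fs j x * T b j x)).
exists (T b); split=> //; apply: le_trans hb; rewrite /beta avg_exch.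
apply: ler_avg => x; rewrite avgZ zg_cat zg_lay -all_nth0 -/m.
under [in leRHS]eq_avg do rewrite eT addrC.
rewrite avg_psi_vec; case: (zg G x); rewrite ?mul0r ?mul1r //=.
case: (boolP [forall j, _]) => [/forallP h|]; rewrite ?mul1r.
  rewrite (_ : [forall c, al x c == 0]) ?mul1r //; apply/forallP => c.
  by rewrite /al (eqP (h _)) mul0r.
rewrite mul0r negb_forall => /existsP[j fj].
case: forallP => [al0|]; last by rewrite mul0r.
rewrite mul1r; suff -> : P x = 0 by rewrite psi0 ler01.
have nz i : i \in I -> x i != 0.
  move=> iI; apply: contraNneq fj => xi0; apply/eqP.
  have hf := form_nth j hfs; rewrite -(upd_same x i) xi0.
  exact: (lin10 (hf.1 i iI x)).
have [i0 i0I] := set0Pn _ I0.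
have coord (z : V) : z != 0 -> exists l, z 0 l != 0.
  by move=> /eqP z0; apply: contrapT => no; apply: z0; apply/rowP => l; rewrite mxE;
     apply/eqP; apply: contrapT => /negP zl; apply: no; exists l.
have [l0 _] := coord _ (nz _ i0I).
case: (pickP (fun i => (i \in J) && (x i == 0))) => [i /andP[iJ /eqP xi0]|nJ].
  have iS : i \in S by move: iJ; rewrite inE => /andP[].
  by rewrite -(upd_same x i) xi0; exact: (lin10 (hP.1 i iS x)).
have cho i : exists l, i \in J -> x i 0 l != 0.
  case: (boolP (i \in J)) => iJ; last by exists l0.
  have := nJ i; rewrite iJ /= => /negbT /coord[l hl]; by exists l.
have [v hv] := choice cho.
have := al0 (enum_rank (j, [ffun i => v i])); rewrite /al enum_rankK /=.
rewrite mulf_eq0 (negbTE fj) /= => /prodf_eq0[i iJ]; rewrite ffunE.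
by rewrite (negbTE (hv i iJ)).
Qed.

End RandomMultipliers.

Section CombMap.
Variables (F : finFieldType) (n1 n2 kk : nat).
Local Notation X1 := {ffun 'I_kk -> 'rV[F]_n1}.
Local Notation X2 := {ffun 'I_kk -> 'rV[F]_n2}.

Lemma comb_map (g : (X1 -> F) -> (X2 -> F)) (fs : seq (X1 -> F)) (c : 'rV[F]_(size (map g fs))) :
  g (fun=> 0) =1 (fun=> 0) -> c != 0 ->
  exists2 c' : 'rV[F]_(size fs), c' != 0 &
    comb c =1 fun x => \sum_(j < size fs) c' 0 j * g (nth (fun=> 0) fs j) x.
Proof.
move=> g0 c0; have e : size fs = size (map g fs) by rewrite size_map.
exists (castmx (erefl, esym e) c).
  apply: contraNneq c0 => h; apply/eqP/rowP => j; rewrite mxE.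
  have := congr1 (fun M : 'rV_(size fs) => M 0 (cast_ord (esym e) j)) h.
  by rewrite castmxE mxE /= => <-; congr (c _ _); apply: val_inj.
move=> x; rewrite /comb (reindex (cast_ord e)) /=; last first.
  by exists (cast_ord (esym e)) => j _; rewrite ?cast_ordK ?cast_ordKV.
apply: eq_bigr => j _; rewrite castmxE /=; congr (c _ _ * _); try exact: val_inj.
by rewrite (nth_map (fun=> 0)).
Qed.

End CombMap.

(** * Adding free variables to every coordinate *)

Section Lift.
Variables (F : finFieldType) (n m kk : nat).
Local Notation X := {ffun 'I_kk -> 'rV[F]_n}.
Local Notation X' := {ffun 'I_kk -> 'rV[F]_(n + m)}.
Local Notation tower := (seq ({set 'I_kk} * seq (X -> F))).

Definition lproj (x : X') : X := cmap (fun _ => lsubmx) x.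
Definition linj (x : X) : X' := cmap (fun _ v => row_mx v 0) x.

Lemma lsub_linear : linear (@lsubmx F 1 n m).
Proof. by move=> a u v; apply/rowP => j; rewrite !mxE. Qed.

Lemma row_mx0_linear : linear (fun v : 'rV[F]_n => row_mx v (0 : 'rV[F]_m)).
Proof. by move=> a u v; rewrite scale_row_mx add_row_mx scaler0 addr0. Qed.

Lemma linjK x : lproj (linj x) = x.
Proof. by apply/ffunP => j; rewrite !ffunE row_mxKl. Qed.

Definition lift_form (f : X -> F) (x : X') : F := f (lproj x).
Definition tlift (T : tower) : seq ({set 'I_kk} * seq (X' -> F)) :=
  [seq (L.1, map lift_form L.2) | L <- T].

Lemma form_lift I f : form I f -> form I (lift_form f).
Proof. by move=> h; apply: (form_cmap (L := fun _ => lsubmx)) => // i; exact: lsub_linear. Qed.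

Lemma mem_lift T L : L \in tlift T -> exists2 L0, L0 \in T & L = (L0.1, map lift_form L0.2).
Proof. by case/mapP => L0 ? ->; exists L0. Qed.

Lemma mem_gens_lift T p : p \in gens (tlift T) ->
  exists2 p0, p0 \in gens T & p = (p0.1, lift_form p0.2).
Proof.
case/mem_gens => L /mem_lift[L0 L0T ->] /mapP[f /mapP[f0 f0L ->]] ->.
by exists (L0.1, f0) => //; apply/mem_gens; exists L0 => //; apply/mapP; exists f0.
Qed.

Lemma gens_lift T : gens (tlift T) = [seq (p.1, lift_form p.2) | p <- gens T].
Proof.
elim: T => [|L T IH] //; rewrite /tlift map_cons -/(tlift T) -cat1s gens_cat IH gens1.
by rewrite -[in RHS]cat1s gens_cat map_cat gens1 /= /lay -!map_comp.
Qed.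

Lemma wft_lift T : wft T -> wft (tlift T).
Proof.
move=> h L /mem_lift[L0 /h[h1 h2] ->] /=; split=> // f /mapP[f0 /h2 hf0 ->].
exact: form_lift.
Qed.

Lemma msz_lift T : msz (tlift T) = msz T.
Proof. by rewrite /msz gens_lift size_map. Qed.

Lemma regular_lift a t T : regular a t T -> regular a t (tlift T).
Proof.
move=> reg T1 L T2 e c c0 r rle h.
have [u1 [L0 [u2 [eT e1 eL e2]]]] := map_split e.
move: c c0 rle h; rewrite -{}eL /= => c c0 rle h.
have [c' c'0 ec] := comb_map (g := lift_form) (fun _ => erefl) c0.
apply: (reg u1 L0 u2 eT c' c'0 r).
  by move: rle; rewrite size_map -e2 -/(tlift u2) msz_lift.
have hl : Dec (gens u1) L0.1 r (fun x => comb c (linj x)).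
  apply: (@Dec_cmap _ _ _ _ (fun _ v => row_mx v 0) _ _ _ _ _ _ _ h) => [_|p]; first exact: row_mx0_linear.
  rewrite -e1 => /mem_gens_lift[p0 p0T ->] pS /=.
  apply: Dec_eq (Dec_gen1 p0T) _ => x; by rewrite /lift_form linjK.
apply: Dec_eq hl _ => x; rewrite ec; apply: eq_bigr => j _.
by rewrite /lift_form linjK.
Qed.

End Lift.

(** * Removing a layer from a tower *)

Section Removal.
Variables (R : realFieldType) (F : finFieldType) (n kk : nat).
Local Notation V := 'rV[F]_n.
Local Notation X := {ffun 'I_kk -> V}.
Local Notation tower := (seq ({set 'I_kk} * seq (X -> F))).
Local Notation psi := (@psi R F).
Local Notation q := (#|F|%:R : R).
Implicit Types (I J S A : {set 'I_kk}) (P : X -> F) (fs : seq (X -> F)) (T : tower).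
Implicit Types (G : seq ({set 'I_kk} * (X -> F))).

Section FreeVariables.
Variables (m : nat) (i : 'I_kk).
Local Notation X' := {ffun 'I_kk -> 'rV[F]_(n + m)}.
Local Notation Y := {ffun 'I_kk -> 'rV[F]_m}.

Definition rproj (x : X') : Y := cmap (fun _ => rsubmx) x.

(** A model of the sum of the f_j B_j in which the values of the f_j are replaced by the free
    entries of the single coordinate i. *)
Definition free_form (B : 'I_m -> X -> F) (x : X') : F :=
  \sum_j rproj x i 0 j * B j (lproj x).

Lemma avg_free (f : X -> Y -> R) :
  avg (fun x : X' => f (lproj x) (rproj x)) = avg (fun x => avg (fun y => f x y)).
Proof.
rewrite -avg_pair; apply: (@avg_bij R X' (X * Y)%type (fun x => (lproj x, rproj x)) (fun p => f p.1 p.2)).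
exists (fun p : X * Y => [ffun j => row_mx (p.1 j) (p.2 j)]) => [x|[x y]].
  by apply/ffunP => j; rewrite !ffunE hsubmxK.
by congr pair; apply/ffunP => j; rewrite !ffunE ?row_mxKl ?row_mxKr.
Qed.

Lemma beta_free (G : seq ({set 'I_kk} * (X -> F))) (B : 'I_m -> X -> F) :
  beta R [seq (p.1, @lift_form F n m kk p.2) | p <- G] (free_form B) =
  avg (fun x => (zg G x && [forall j, B j x == 0])%:R).
Proof.
pose f (x : X) (y : Y) := (zg G x)%:R * psi (\sum_j y i 0 j * B j x).
have -> : beta R [seq (p.1, @lift_form F n m kk p.2) | p <- G] (free_form B) =
   avg (fun x : X' => f (lproj x) (rproj x)).
  by apply: eq_avg => x; rewrite /zg all_map.
rewrite avg_free; apply: eq_avg => x; rewrite /f avgZ (avg_upd i).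
under eq_avg => y do under eq_avg => v do under eq_bigr => j _ do rewrite updE.
rewrite (avg_const (0 : Y)).
under eq_avg => v do rewrite -[\sum_j _]addr0.
by rewrite avg_psi_vec psi0 mulr1 -mulnb natrM.
Qed.

Lemma form_free S (B : 'I_m -> X -> F) : i \notin S -> (forall j, form S (B j)) ->
  form (i |: S) (free_form B).
Proof.
move=> iS hB.
have hr j : form [set i] (fun x : X' => rproj x i 0 j).
  split=> l; rewrite inE => /eqP li x.
    by subst l; move=> a u v; rewrite /rproj !cmap_upd !updE !mxE.
  by move=> v; rewrite /rproj cmap_upd ffunE; case: eqP => // e; case: li.
apply: form_sum => j; apply: formM (hr j) (form_lift m (hB j)) _.
by rewrite disjoints1.
Qed.

End FreeVariables.

(** Puts the values of the f_j in the free entries of coordinate i. The old entries of that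
    coordinate are set to 0: neither the B_j nor the forms supported outside A involve it. *)
Definition back A fs (i : 'I_kk) (x : X) : {ffun 'I_kk -> 'rV[F]_(n + size fs)} :=
  [ffun j => if j == i then row_mx 0 (\row_l nth (fun=> 0) fs l x) else row_mx (x j) 0].

(** As the f_j are forms on A, a form involving i pulls back to one that involves all of A instead;
    this is [tau]. Disjoint supports stay disjoint, so products pull back to products. *)
Lemma Dec_back G S A fs i r (B : 'I_(size fs) -> X -> F) :
  A \subset S -> i \in A -> (forall f, f \in fs -> form A f) ->
  (forall j, form (S :\: A) (B j)) ->
  Dec [seq (p.1, @lift_form F n (size fs) kk p.2) | p <- subg G (S :\: A)]
    (i |: (S :\: A)) r (free_form i B) -> wfg G ->
  Dec G S r (fun x => \sum_(j < size fs) nth (fun=> 0) fs j x * B j x).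
Proof.
move=> AS iA hfs hB hD wf; set U := S :\: A in hB hD.
have iU : i \notin U by rewrite inE iA.
have backl I f x : i \notin I -> form I f -> lift_form f (back A fs i x) = f x.
  move=> iI hf; apply: (form_dep hf) => j jI; rewrite !ffunE.
  case: eqP => [e|_]; last by rewrite row_mxKl.
  by rewrite -e jI in iI.
have up j x v : j \notin A -> back A fs i (upd x j v) = upd (back A fs i x) j (row_mx v 0).
  move=> jA; apply/ffunP => l; rewrite !ffunE; case: (l =P i) => [->|_].
    case: eqP => [e|_]; first by rewrite -e iA in jA.
    congr row_mx; apply/rowP => s; rewrite !mxE.
    by have [_ ->] := form_nth s hfs.
  by case: eqP.
have upA j x v : j \in A -> j != i -> forall l, l != i -> l \notin A -> (back A fs i (upd x j v)) l = (back A fs i x) l.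
  move=> jA ji l li lA; rewrite !ffunE (negbTE li); case: eqP => // e.
  by rewrite e jA in lA.
pose tau (I : {set 'I_kk}) := if i \in I then (I :\ i) :|: A else I.
have h := @Dec_subst F n (n + size fs) kk (back A fs i) tau S (i |: U) _ G _ _ _ _ _ hD.
apply: Dec_eq (h _ _ _) _ => [I f|I|p|x].
- move=> IS hf; rewrite /tau; case: ifP => iI; last first.
    have sub : I \subset U.
      apply/subsetP => j jI; have := subsetP IS _ jI; rewrite in_setU1; case: eqP => // e.
      by rewrite -e jI in iI.
    split=> j jI x.
      have jA : j \notin A by have := subsetP sub _ jI; rewrite inE => /andP[].
      by move=> a u v; rewrite !up // row_mx0_linear hf.1.
    move=> v; apply: (form_dep hf) => l lI; rewrite !ffunE.
    case: eqP => [e|_]; first by rewrite -e lI in iI.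
    case: eqP => // e; by rewrite -e lI in jI.
  have subI l : l \in I -> l != i -> l \in U.
    by move=> lI li; have := subsetP IS _ lI; rewrite in_setU1 (negbTE li).
  have only x j v : j \in A -> f (back A fs i (upd x j v)) =
      f (upd (back A fs i x) i (row_mx 0 (\row_l nth (fun=> 0) fs l (upd x j v)))).
    move=> jA; apply: (form_dep hf) => l lI; rewrite !ffunE; case: (l =P i) => // /eqP li.
    case: eqP => // e; have := subI _ lI li; by rewrite e inE jA.
  split=> j.
    rewrite in_setU in_setD1; case: (boolP (j \in A)) => [jA _ x a u v|jA]; last first.
      rewrite orbF => /andP[ji jI] x a u v; by rewrite !up // row_mx0_linear hf.1.
    rewrite !only // -(hf.1 i iI); congr (f (upd _ _ _)).
    rewrite scale_row_mx add_row_mx scaler0 addr0; congr row_mx; apply/rowP => s; rewrite !mxE.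
    by have [-> //] := form_nth s hfs.
  rewrite in_setU in_setD1 negb_or negb_and negbK => /andP[h1 jA] x v.
  rewrite up //; case/orP: h1 => [/eqP e|jI]; first by rewrite e iA in jA.
  by rewrite hf.2.
- move=> IS; rewrite /tau in_setD in_setU1 eqxx /= andbT.
  have memU j : (j \in U) = (j \notin A) && (j \in S) by rewrite in_setD.
  have subI l : l \in I -> l != i -> l \in U.
    by move=> lI li; have := subsetP IS _ lI; rewrite in_setU1 (negbTE li).
  have iS := subsetP AS _ iA.
  case: (boolP (i \in I)) => iI /=; split.
  + apply/subsetP => j; rewrite in_setU in_setD1 => /orP[/andP[ji jI]|/(subsetP AS) //].
    by have := subI _ jI ji; rewrite memU => /andP[].
  + apply/setP => j; rewrite !inE; case: (boolP (j == i)) => [/eqP ->|ji] /=; first by rewrite iA iI.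
    by rewrite negb_or andbA.
  + by move=> _; apply/set0Pn; exists i; rewrite in_setU iA orbT.
  + apply/subsetP => j jI; have ji : j != i by apply: contraNneq iI => <-.
    by have := subI _ jI ji; rewrite memU => /andP[].
  + apply/setP => j; rewrite !inE; case: (boolP (j == i)) => [/eqP ->|ji] /=; first by rewrite iA iI iS.
    case: (boolP (j \in A)) => jA /=; rewrite ?andbT ?andbF ?orbF //=.
    rewrite (subsetP AS _ jA) andbT; apply/esym; apply/negP => jI.
    by have := subI _ jI ji; rewrite memU jA.
  + by [].
- case/mapP => p0; rewrite mem_filter => /andP[p0U p0G] -> /= _.
  have ip : i \notin p0.1 by apply: contraNN iU => ip; apply: (subsetP p0U).
  rewrite /tau (negbTE ip); apply: Dec_eq (Dec_gen1 p0G) _ => x.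
  by rewrite (backl _ _ _ ip (wf _ p0G).2).
rewrite /free_form; apply: eq_bigr => j _.
have -> : B j (lproj (back A fs i x)) = B j x := backl _ _ x iU (hB j).
by rewrite !ffunE eqxx row_mxKr mxE.
Qed.

End Removal.

(** The level after g removals: a removal at level t yields at most a(2t)^a products, and
    subtracting them costs as many powers of q in bias. *)
Fixpoint step_iter (a g t : nat) : nat :=
  if g is g'.+1 then step_iter a g' (t + a * (2 * t) ^ a) else t.

Lemma step_iter_mono a g t t' : (t <= t')%N -> (step_iter a g t <= step_iter a g t')%N.
Proof.
elim: g t t' => //= g IH t t' h; apply: IH; apply: leq_add => //.
by rewrite leq_mul2l leq_expl ?orbT // leq_mul2l h orbT.
Qed.

Lemma step_iter_ge a g t : (t <= step_iter a g t)%N.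
Proof. by elim: g t => //= g IH t; apply: leq_trans (IH _); rewrite leq_addr. Qed.

Lemma step_iter_mono_g a g g' t : (g <= g')%N -> (step_iter a g t <= step_iter a g' t)%N.
Proof.
elim: g g' t => [|g IH] g' t; first by move=> _; exact: step_iter_ge.
by case: g' => //= g' h; apply: IH.
Qed.

Lemma step_iter0 a g : step_iter a g 0 = 0%N.
Proof.
elim: g => //= g IH; have -> : (0 + a * (2 * 0) ^ a = 0)%N.
  by rewrite muln0 add0n; case: (a) => [|b]; rewrite ?mul0n // exp0n ?muln0.
exact: IH.
Qed.

Section RemovalLoop.
Variables (R : realFieldType) (F : finFieldType) (n kk : nat).
Local Notation V := 'rV[F]_n.
Local Notation X := {ffun 'I_kk -> V}.
Local Notation tower := (seq ({set 'I_kk} * seq (X -> F))).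
Local Notation q := (#|F|%:R : R).
Implicit Types (I J S A : {set 'I_kk}) (P : X -> F) (fs : seq (X -> F)) (T LA : tower).
Implicit Types (G : seq ({set 'I_kk} * (X -> F))).

(** For t > 0 the doubled level absorbs the error delta. At t = 0 doubling changes nothing, and the
    gap between 2^-a0 and 2^-(a0+1) takes its place. *)
Lemma theta_step a0 t tm C (delta : R) : (t <= tm)%N -> (a0 + 4 <= C)%N ->
  delta = q ^- (C * tm.+1) -> theta R F a0 (2 * t) * (1 + delta) <= theta R F a0.+1 t - 2%:R * delta.
Proof.
move=> tt aC ->; have d0 := qV_gt0 R F (C * tm.+1).
have q2 : 2%:R <= q by rewrite ler_nat card_F_gt1.
have le2 e : q ^- e <= 2%:R ^- e.
  by rewrite lef_pV2 ?posrE ?exprn_gt0 ?q_gt0 // lerXn2r ?nnegrE ?ler0n.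
have mono e e' : (e <= e')%N -> q ^- e' <= q ^- e.
  by move=> h; rewrite lef_pV2 ?posrE ?exprn_gt0 ?q_gt0 // ler_weXn2l // ltW // q_gt1.
rewrite /theta muln_eq0 /=; case: eqP => [t0|/eqP t0].
  have : q ^- (C * tm.+1) <= 2%:R ^- (a0 + 3).+1.
    apply: le_trans (mono (a0 + 3).+1 _ _) (le2 _).
    by apply: leq_trans (_ : (C <= _)%N); [lia|rewrite leq_pmulr].
  rewrite -addSn exprD (exprS _ a0) !invfM; set x := 2%:R ^- a0; set d := q ^- _ in d0 * => h.
  have x0 : 0 < x by rewrite invr_gt0 exprn_gt0.
  have : 0 <= x * d by rewrite mulr_ge0 ?ltW.
  lra.
have : q ^- (C * tm.+1) <= q ^- (2 * t) * 2%:R ^- 4.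
  apply: le_trans (mono (2 * t + 4)%N _ _) _; first by nia.
  rewrite qVD ler_wpM2l ?le2 //; exact/ltW/qV_gt0.
have h16 : (2%:R ^- 4 : R) = 16%:R^-1 by rewrite -natrX.
rewrite h16 mul2n -addnn qVD; set y := q ^- t; set d := q ^- _ in d0 * => h.
have y0 : 0 < y by exact: qV_gt0.
have y1 : y <= 2%:R^-1.
  by apply: le_trans (mono 1%N t _) _; rewrite ?lt0n // expr1 -[q^-1]/(q ^- 1) (le2 1%N).
have d1 : d <= 1 by exact: qV_le1.
have : y * y <= y * 2%:R^-1 by rewrite ler_pM2l.
have : 0 <= y * y * (1 - d) by rewrite mulr_ge0 ?subr_ge0 // mulr_ge0 // ltW.
have : 0 <= y * y * d by rewrite !mulr_ge0 // ltW.
have : y * y * d <= y * y * 16%:R^-1.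
  rewrite ler_wpM2l ?mulr_ge0 ?(ltW y0) //; apply: le_trans h _.
  rewrite ler_piMl ?invr_ge0 ?ler0n //; apply: le_trans (_ : 1 * 1 <= _); last by rewrite mulr1.
  by apply: ler_pM; rewrite ?(ltW y0) //; exact: qV_le1.
lra.
Qed.

Lemma dens_cat_le G G' (delta : R) : wfg G -> wfg G' ->
  dens R (G ++ G') <= (1 + delta) * q ^- size (G ++ G') -> dens R G <= (1 + delta) * q ^- size G.
Proof.
move=> wf wf' le; rewrite -(ler_pM2r (qV_gt0 R F (size G'))) -[leRHS]mulrA -qVD -size_cat.
apply: le_trans le; apply: le_trans (dens_cat_ge R wf wf').
by rewrite ler_wpM2l ?dens_ge0 // dens_ge.
Qed.

(** On the zeros of T only the sum of the f_j B_j is left of P. By [substitution_bound] the B_j have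
    many common zeros among those of the forms of T supported in S minus A; by [beta_free] this is a
    bias of [free_form], to which [Rloc] applies. *)
Lemma removal_step T A fs S i P a0 t (th delta : R) : wft T -> (forall L, L \in T -> L.1 \subset S) ->
  A \subset S -> i \in A -> (forall f, f \in fs -> form A f) ->
  dens R (gens T ++ lay A fs) <= (1 + delta) * q ^- (msz T + size fs) ->
  dens R (gens T) <= (1 + delta) * q ^- msz T ->
  theta R F a0 (2 * t) * (1 + delta) <= th - 2%:R * delta ->
  th * q ^- msz T <= beta R (gens T) P ->
  Rloc R a0 (tlift (size fs) (subt T (S :\: A))) (i |: (S :\: A)) ->
  regular a0 (2 * t) T -> Dec (gens T ++ lay A fs) S 0 P ->
  exists2 r, (r <= a0 * (2 * t) ^ a0)%N & Dec (gens T) S r P.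
Proof.
move=> wf TS AS iA hfs d1 d2 hth hbeta loc reg hP.
have wfG := wfg_gens wf; set U := S :\: A in loc *.
have GS p : p \in gens T -> p.1 \subset S by case/mem_gens => L /TS LS /mapP[f _ ->].
have A0 : A != set0 by apply/set0Pn; exists i.
have [P' [B [hP' hB eP]]] := Dec_layer AS hP.
have eb : beta R (gens T) P = beta R (gens T) (fun x => \sum_(j < size fs) nth (fun=> 0) fs j x * B j x).
  by apply: beta_eq => x zx; rewrite eP (Dec0_zero hP' zx) add0r.
have sub := substitution_bound wfG A0 AS GS hfs hB d1 d2.
rewrite -eb -/U in sub; set av := avg _ in sub.
have avge : theta R F a0 (2 * t) * dens R (subg (gens T) U) <= av.
  have h1 := dens_subg_le U wfG d2.
  have h2 := le_trans hbeta sub.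
  rewrite {1}/msz -(size_subg (gens T) U) qVD in h2.
  set x := q ^- size (subg _ _) in h1 h2; set y := q ^- size (crossg _ _) in h2.
  have x0 : 0 < x by exact: qV_gt0.
  have y0 : 0 < y by exact: qV_gt0.
  apply: le_trans (_ : theta R F a0 (2 * t) * ((1 + delta) * x) <= _).
    by apply: ler_wpM2l h1; exact: theta_ge0.
  rewrite mulrA; apply: le_trans (_ : (th - 2%:R * delta) * x <= _); first by rewrite ler_pM2r.
  by rewrite -(ler_pM2l y0); clear -h2; lra.
set B' := fun j => B j; pose Pf := @free_form F n kk (size fs) i B'.
have bf := beta_free R i (subg (gens T) U) B'.
have iU : i \notin U by rewrite inE iA.
have gl : gens (tlift (size fs) (subt T U)) = [seq (p.1, @lift_form F n (size fs) kk p.2) | p <- subg (gens T) U].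
  by rewrite gens_lift gens_subt.
have [|||r rle hr] := loc (2 * t)%N Pf.
- exact: form_free.
- exact/regular_lift/regular_subt.
- rewrite gl bf; apply: le_trans avge; rewrite le_eqVlt; apply/orP; left; apply/eqP; congr (_ * _).
  (* With all B_j equal to 0, [beta_free] gives the density of the lifted tower. *)
  have := beta_free R i (subg (gens T) U) (fun (_ : 'I_(size fs)) _ => 0).
  rewrite (beta_eq R (P' := fun=> 0)) ?beta0 => [->|x _].
    apply: eq_avg => x; rewrite (_ : [forall j, _]) ?andbT //; by apply/forallP.
  by rewrite /free_form big1 // => j _; rewrite mulr0.
exists r => //; rewrite gl in hr.
have := DecD hP' (Dec_back AS iA hfs hB hr wfG); rewrite add0n => h.
by apply: Dec_eq h _ => x; rewrite eP.
Qed.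

(** The layers of LA go from the last to the first. A removal at level t leaves r1 products and a
    form in the ideal of the remaining layers; the latter keeps its bias over T up to q^-r1 and goes
    on at level t + r1. *)
Lemma removal_loop T S a0 tm C (delta : R) : wft T -> (forall L, L \in T -> L.1 \subset S) ->
  S != set0 -> (a0 + 4 <= C)%N -> delta = q ^- (C * tm.+1) ->
  forall LA t P, wft LA -> (forall L, L \in LA -> L.1 \subset S) ->
  dens R (gens (T ++ LA)) <= (1 + delta) * q ^- msz (T ++ LA) ->
  regular a0 (2 * tm) (T ++ LA) ->
  (forall LA0 L LA1, LA = LA0 ++ L :: LA1 -> exists2 i, i \in L.1 &
     Rloc R a0 (tlift (size L.2) (subt (T ++ LA0) (S :\: L.1))) (i |: (S :\: L.1))) ->
  Dec (gens (T ++ LA)) S 0 P ->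
  theta R F a0.+1 t * dens R (gens T) <= beta R (gens T) P ->
  (step_iter a0 (size LA) t <= tm)%N ->
  exists2 r, (r + t <= step_iter a0 (size LA) t)%N & Dec (gens T) S r P.
Proof.
move=> wf TS S0 aC ed; elim/last_ind => [|LA L IH] t P wfLA LAS dd reg loc hP hb ht.
  by exists 0%N => //; rewrite cats0 in hP.
rewrite size_rcons /= in ht *; move: wfLA LAS dd reg loc hP.
rewrite -cats1 => /wft_cat[wfA wfL] LAS dd reg loc hP.
have LAS' L' : L' \in LA -> L'.1 \subset S by move=> LL; apply: LAS; rewrite mem_cat LL.
have LS : L.1 \subset S by apply: LAS; rewrite mem_cat inE eqxx orbT.
have [L0 LF] : L.1 != set0 /\ forall f, f \in L.2 -> form L.1 f by apply: wfL; rewrite inE.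
have wfT : wft (T ++ LA) by apply/wft_cat.
have TS' L' : L' \in T ++ LA -> L'.1 \subset S by rewrite mem_cat => /orP[/TS|/LAS'].
have [i iL hloc] := loc LA L [::] erefl.
have wfG := wfg_gens wf; have wfGA := wfg_gens wfA; have wfGT := wfg_gens wfT.
have wfGL : wfg (gens [:: L]) by apply: wfg_gens.
have GS p : p \in gens (T ++ LA) -> p.1 \subset S by case/mem_gens => L' /TS' LS' /mapP[f _ ->].
rewrite catA in dd reg hP.
have dd' : dens R (gens (T ++ LA)) <= (1 + delta) * q ^- msz (T ++ LA).
  by apply: (dens_cat_le (wfg_gens wfT) wfGL); rewrite -gens_cat.
have hPf : form S P.
  by apply: Dec_form hP; rewrite gens_cat; apply/wfg_cat.
(* Correlating P over T with the zero form over LA: passing to the larger tower costs at most the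
   density of LA. *)
have hb' : theta R F a0.+1 t * q ^- msz (T ++ LA) <= beta R (gens (T ++ LA)) P.
  have h := beta_corr (S := S) R wfG wfGA S0 _ hPf (form0 S).
  have e : beta R (gens T ++ gens LA) (fun x => P x + 0) = beta R (gens T ++ gens LA) P.
    by apply: beta_eq => x _; rewrite addr0.
  rewrite e -gens_cat beta0 in h; apply: le_trans (h _); last first.
    by move=> p; rewrite -?gens_cat; exact: GS.
  rewrite msz_cat qVD mulrA; apply: ler_pM.
  - by rewrite mulr_ge0 ?theta_ge0 // ltW // qV_gt0.
  - by rewrite ltW // qV_gt0.
  - apply: le_trans hb; rewrite ler_wpM2l ?theta_ge0 //; exact: dens_ge.
  - exact: dens_ge.
have tt : (t <= tm)%N by apply: leq_trans (step_iter_ge _ _ _) (leq_trans (step_iter_mono _ _ _) ht); rewrite leq_addr.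
have [||||r1 r1le hr1] := @removal_step (T ++ LA) L.1 L.2 S i P a0 t _ delta wfT TS' LS iL LF _ dd' _ hb' hloc.
- by rewrite -gens1 -gens_cat -msz1 -msz_cat.
- exact: theta_step ed.
- have reg' := regular_prefix reg; apply: regular_weaken reg' => s.
  by apply: pow_bound_le; rewrite ?addnS //; clear -tt; lia.
- by rewrite -gens1 -gens_cat.
have [P0 [P1 [h0 h1 eP]]] := Dec_split hr1.
have hb1 : theta R F a0.+1 (t + r1) * dens R (gens T) <= beta R (gens T) P1.
  have h := beta_sub_rank R wfG S0 _ hPf h0.
  rewrite (_ : (fun x => P x - P0 x) = P1) in h; last by apply/funext => x; rewrite eP addrAC subrr add0r.
  apply: le_trans (h _); last by move=> p /mem_gens[L' /TS LS' /mapP[f _ ->]].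
  apply: le_trans (_ : theta R F a0.+1 t * dens R (gens T) * q ^- r1 <= _).
    rewrite mulrAC ler_wpM2r ?dens_ge0 // /theta.
    case: (t =P 0%N) r1le => [->|/eqP t0] r1le.
      (* At level 0 no products appear, so the level stays 0 and membership in the ideal is
         preserved. *)
      have -> : r1 = 0%N.
        by apply/eqP; rewrite -leqn0; move: r1le; rewrite muln0; case: (a0) => [|a]; rewrite ?mul0n ?exp0n ?muln0.
      by rewrite expr0 invr1 mulr1.
    by rewrite addn_eq0 (negbTE t0) /= -qVD.
  by rewrite ler_wpM2r // ltW // qV_gt0.
have st : (step_iter a0 (size LA) (t + r1) <= step_iter a0 (size LA) (t + a0 * (2 * t) ^ a0))%N.
  by apply: step_iter_mono; rewrite leq_add2l.
have [|||r2 r2le hr2] := IH (t + r1)%N P1 wfA LAS' dd' _ _ h1 hb1.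
- have reg' := regular_prefix reg; apply: regular_weaken reg' => s.
  by apply: pow_bound_le; rewrite ?addnS //; clear -tt; lia.
- move=> LA0 L' LA1 e; apply: (loc LA0 L' (LA1 ++ [:: L])); by rewrite e -catA.
- exact: leq_trans st ht.
exists (r1 + r2)%N; first by apply: leq_trans st; lia.
have h0' : Dec (gens T) S r1 P0 by apply: Dec_incl h0.
by apply: Dec_eq (DecD h0' hr2) _ => x; rewrite eP.
Qed.

End RemovalLoop.

(** * Polynomially bounded functions *)

Definition polyb (f : nat -> nat) := exists b, forall M, (0 < M)%N -> (f M <= b * M ^ b)%N.

Lemma polyb_cst c : polyb (fun=> c).
Proof. by exists c => M M0; rewrite leq_pmulr // expn_gt0 M0. Qed.

Lemma polyb_id : polyb id.
Proof. by exists 1%N => M M0; rewrite mul1n expn1. Qed.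

Lemma polybD f g : polyb f -> polyb g -> polyb (fun M => f M + g M)%N.
Proof.
move=> [b hb] [c hc]; exists (b + c)%N => M M0; rewrite mulnDl; apply: leq_add.
  by apply: leq_trans (hb _ M0) _; rewrite leq_mul2l leq_pexp2l ?orbT // leq_addr.
by apply: leq_trans (hc _ M0) _; rewrite leq_mul2l leq_pexp2l ?orbT // leq_addl.
Qed.

Lemma polybM f g : polyb f -> polyb g -> polyb (fun M => f M * g M)%N.
Proof.
move=> [b hb] [c hc]; exists (b * c + (b + c))%N => M M0.
apply: leq_trans (leq_mul (hb _ M0) (hc _ M0)) _.
rewrite mulnACA -expnD; apply: leq_mul; first exact: leq_addr.
by rewrite leq_pexp2l // leq_addl.
Qed.

Lemma polybX f e : polyb f -> polyb (fun M => f M ^ e)%N.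
Proof.
move=> hf; elim: e => [|e IH]; first exact: polyb_cst.
have [b hb] := polybM hf IH; exists b => M M0; rewrite expnS; exact: hb.
Qed.

Lemma polyb_iter a g f : polyb f -> polyb (fun M => step_iter a g (f M)).
Proof.
elim: g f => [|g IH] f hf //=; apply: (IH (fun M => f M + a * (2 * f M) ^ a)%N).
apply: polybD => //; apply: polybM; first exact: polyb_cst.
apply: polybX; apply: polybM => //; exact: polyb_cst.
Qed.

Lemma polyb_le f a : polyb f -> exists b, (a <= b)%N /\ forall M, (0 < M)%N -> (f M <= b * M ^ b)%N.
Proof.
move=> [b hb]; exists (a + b)%N; split=> [|M M0]; first exact: leq_addr.
by apply: leq_trans (hb _ M0) _; apply: pow_bound_le => //; exact: leq_addl.
Qed.

Lemma RBR_lt R k : (forall k' c h, (k' < k)%N -> exists a, RBR R k' c h a) ->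
  forall c h, exists a, forall k', (k' < k)%N -> RBR R k' c h a.
Proof.
elim: k => [|k IH] H c h; first by exists 0%N.
have [a ha] := IH (fun k' c h hk => H k' c h (leqW hk)) c h.
have [b hb] := H k c h (leqnn _); exists (a + b)%N => k'.
rewrite ltnS leq_eqVlt => /orP[/eqP ->|hk].
  exact: RBR_mono (leq_addl _ _) hb.
exact: RBR_mono (leq_addr _ _) (ha _ hk).
Qed.

Lemma mem_bigcup_seq (E : finType) (Ty : eqType) (s : seq Ty) (f : Ty -> {set E}) x :
  (x \in \bigcup_(L <- s) f L) = has (fun L => x \in f L) s.
Proof. by elim: s => [|L s IH]; rewrite ?big_nil ?big_cons ?inE //= IH. Qed.

Section Bounds.
Variables (a0 a3 aeq ar b g : nat).
Let r1 M := (a3 * (2 * M) ^ a3)%N.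
Let tm M := step_iter a0 g M.
Let lvl M := (2 * tm M + b * (r1 M + (2 * tm M).+1) ^ b)%N.

(** In [RBR_step], M is the number of forms from some layer on, plus t + 1. There [r1] bounds the
    number of products after peeling, [tm] the level after all removals, and [lvl] is the level at
    which the tower must be regular for [regularize] to apply. *)
Lemma step_bounds : exists a, [/\ (a0 < a)%N,
  forall M, (0 < M)%N -> (r1 M <= a * M ^ a)%N,
  forall M, (0 < M)%N -> (tm M <= a * M ^ a)%N &
  forall M, (0 < M)%N -> (ar * (M + lvl M) ^ ar <= a * M ^ a)%N].
Proof.
have p1 : polyb r1.
  apply: polybM; first exact: polyb_cst.
  by apply: polybX; apply: polybM; [exact: polyb_cst|exact: polyb_id].
have p2 : polyb tm by apply: polyb_iter; exact: polyb_id.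
have p2' : polyb (fun M => 2 * tm M)%N by apply: polybM => //; exact: polyb_cst.
have p3 : polyb (fun M => ar * (M + lvl M) ^ ar)%N.
  apply: polybM; first exact: polyb_cst.
  apply: polybX; apply: polybD; first exact: polyb_id.
  apply: polybD => //; apply: polybM; first exact: polyb_cst.
  apply: polybX; apply: polybD => //.
  have [c hc] := polybD (polyb_cst 1) p2'; exists c => M M0; exact: hc.
have [a [h0 ha]] := polyb_le a0.+1 (polybD p1 (polybD p2 p3)).
exists a; split=> // M M0; apply: leq_trans (ha M M0); lia.
Qed.

End Bounds.

(** * The inductive step for towers of forms *)

Section Step.
Variables (R : realFieldType) (F : finFieldType) (n kk : nat).
Local Notation V := 'rV[F]_n.
Local Notation X := {ffun 'I_kk -> V}.
Local Notation tower := (seq ({set 'I_kk} * seq (X -> F))).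
Local Notation q := (#|F|%:R : R).
Implicit Types (I J S A : {set 'I_kk}) (P : X -> F) (fs : seq (X -> F)) (T LA : tower).

Lemma theta_geS a t : (0 < a)%N -> q ^- t.+1 <= theta R F a t.
Proof.
move=> a0; rewrite /theta; case: eqP => [->|_].
  have q2 : 2%:R <= q by rewrite ler_nat card_F_gt1.
  rewrite expr1; apply: (@le_trans _ _ (2%:R^-1)).
    by rewrite lef_pV2 ?posrE ?q_gt0.
  have : 2%:R ^- a <= 2%:R^-1 :> R.
    by rewrite -[X in _ <= X^-1]expr1 lef_pV2 ?posrE ?exprn_gt0 // ler_weXn2l // ler1n.
  lra.
by rewrite lef_pV2 ?posrE ?exprn_gt0 ?q_gt0 // ler_weXn2l ?leqnSn // ltW // q_gt1.
Qed.

(* Adding multipliers of the last layer turns the bias on T0 ++ [:: L] into a bias on T0, at the price of size L.2 in the level. *)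
Lemma peel_layer a a3 T0 L S P t : wft (T0 ++ [:: L]) -> (forall L', L' \in T0 ++ [:: L] -> L'.1 \subset S) ->
  form S P -> (0 < a)%N -> regular a t (T0 ++ [:: L]) ->
  (forall M, (0 < M)%N -> (a3 * (2 * M) ^ a3 <= a * M ^ a)%N) ->
  theta R F a t * dens R (gens (T0 ++ [:: L])) <= beta R (gens (T0 ++ [:: L])) P ->
  Rloc R a3 T0 S ->
  exists2 r, (r <= a3 * (t + size L.2).+1 ^ a3)%N & Dec (gens (T0 ++ [:: L])) S r P.
Proof.
move=> wf TS hP a0 reg h3 hb loc; have [wf0 wfL] := (wft_cat _ _).1 wf.
have [L0 LF] : L.1 != set0 /\ forall f, f \in L.2 -> form L.1 f by apply: wfL; rewrite inE.
have LS : L.1 \subset S by apply: TS; rewrite mem_cat inE eqxx orbT.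
have eg : gens (T0 ++ [:: L]) = gens T0 ++ lay L.1 L.2 by rewrite gens_cat gens1.
rewrite eg in hb *.
have [Tj [hTj hle]] := exists_multipliers R (gens T0) LS L0 LF hP.
set P' := (fun x => P x + \sum_(j < size L.2) nth (fun=> 0) L.2 j x * Tj j x) in hle.
have hP' : form S P'.
  apply: formD => //; apply: form_sum => j; apply: (formMD (I := L.1)) => //.
  exact: form_nth.
set m := size L.2 in hle *.
have [||r rle hr] := loc (t + m).+1 P' hP'.
- have reg' := regular_prefix reg; rewrite msz1 -/m in reg'.
  apply: regular_weaken reg' => s; apply: leq_trans (h3 (s + (t + m).+1)%N _); last by lia.
  rewrite leq_mul2l; apply/orP; right; apply: leq_expl; lia.
- rewrite /theta /=; apply: le_trans hle; apply: le_trans hb.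
  have d : dens R (gens T0) * q ^- m <= dens R (gens T0 ++ lay L.1 L.2).
    apply: le_trans (dens_cat_ge R (wfg_gens wf0) _); last first.
      by rewrite -gens1; exact: wfg_gens wfL.
    rewrite ler_wpM2l ?dens_ge0 //.
    have := @dens_ge R F n kk (lay L.1 L.2); rewrite size_map; apply.
    by rewrite -gens1; exact: wfg_gens wfL.
  have -> : q ^- (t + m).+1 * dens R (gens T0) = q ^- t.+1 * (dens R (gens T0) * q ^- m).
    by rewrite -addSn qVD; ring.
  apply: le_trans (ler_wpM2l (theta_ge0 _ _ _ _) d); apply: ler_wpM2r (theta_geS _ a0).
  by rewrite mulr_ge0 ?dens_ge0 // ltW // qV_gt0.
exists r => //.
have hr' : Dec (gens T0 ++ lay L.1 L.2) S r P'.
  by apply: Dec_incl hr => p pG; rewrite mem_cat pG.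
have hs : Dec (gens T0 ++ lay L.1 L.2) S 0 (fun x => \sum_(j < size L.2) nth (fun=> 0) L.2 j x * Tj j x).
  apply: Dec_sum => j; apply: (@Dec_gen _ _ _ _ _ (L.1, nth (fun=> 0) L.2 j)) => //.
  by rewrite mem_cat; apply/orP; right; apply/map_f/mem_nth.
have := DecD hr' (DecN hs); rewrite addn0 => h; apply: Dec_eq h _ => x.
by rewrite /P' addrK.
Qed.

Lemma bigcup_seq_sub (T : tower) S : (forall L, L \in T -> L.1 \subset S) -> \bigcup_(L <- T) L.1 \subset S.
Proof.
move=> h; apply/subsetP => i; rewrite mem_bigcup_seq => /hasP[L LT]; exact: (subsetP (h _ LT)).
Qed.

End Step.

(** A new layer on A is removed through forms on k + 1 - #|A| coordinates. If A has two elements or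
    more, the first hypothesis applies. If A = {i}, the number k is unchanged, but i is a coordinate
    of the tower which the remaining layers avoid, and the second applies. The third is used to peel
    off the last layer, and for the equidistribution of layers on all of I. *)
Lemma RBR_step (R : realFieldType) k c h :
  (forall k' c' h', (k' < k)%N -> exists a, RBR R k' c' h' a) ->
  (forall h', exists a, RBR R k c h' a) ->
  (exists a, RBR R k c.+1 h a) -> exists a, RBR R k c.+1 h.+1 a.
Proof.
(* At most one new layer for each subset of I. *)
move=> H1 H2 [a3 H3]; pose g := (2 ^ k)%N.
have [a1 {}H1] := RBR_lt H1 k (h.+1 + g)%N.
have [a2 {}H2] := H2 (h.+1 + g)%N.
pose a0 := (a1 + a2 + a3)%N; pose C := (a0 + 4)%N.
pose aeq := eqexp a0 (h.+1 + g) C; pose ar := (a0 + aeq)%N.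
have [b Hreg] := regularize ar k.
have [a [a0a B1 B2 B3]] := step_bounds a0 a3 ar b g.
have a_gt0 : (0 < a)%N by apply: leq_ltn_trans a0a.
exists a => F n kk I T Ik I0 wf TI cN szT; case: (leqP (size T) h) => [szT'|szT'].
  apply: Rloc_mono (H3 F n kk I T Ik I0 wf TI cN szT').
  by apply: leq_trans (ltnW a0a); rewrite leq_addl.
move=> t P hP reg hb; case/lastP: T => [|T0 L] // in wf TI cN szT szT' reg hb *.
rewrite size_rcons ltnS in szT; rewrite -cats1 in wf TI cN reg hb *.
set T := T0 ++ [:: L] in wf TI cN reg hb *.
have [wf0 wfL] := (wft_cat _ _).1 wf.
have T0I L' : L' \in T0 -> L'.1 \subset I by move=> h'; apply: TI; rewrite mem_cat h'.
have LI : L.1 \subset I by apply: TI; rewrite mem_cat inE eqxx orbT.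
have [L0 LF] : L.1 != set0 /\ forall f, f \in L.2 -> form L.1 f by apply: wfL; rewrite inE.
pose N := \bigcup_(L <- T) L.1.
have NI : N \subset I by exact: bigcup_seq_sub.
have TN L' : L' \in T -> L'.1 \subset N.
  move=> LT; apply/subsetP => i iL; rewrite mem_bigcup_seq; apply/hasP; by exists L'.
have IN : I :&: N != set0.
  have /set0Pn[i iL] := L0; apply/set0Pn; exists i; rewrite inE (subsetP LI) // (subsetP (TN L _)) //.
  by rewrite mem_cat inE eqxx orbT.
have c0 : (#|\bigcup_(L' <- T0) L'.1| <= c.+1)%N.
  apply: leq_trans (subset_leq_card _) cN; apply/bigcup_seq_sub => L' LT.
  by apply: TN; rewrite mem_cat LT.
have [r rle hr] := peel_layer wf TI hP a_gt0 reg B1 hb (H3 F n kk I T0 Ik I0 wf0 T0I c0 szT).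
have [Gs [sGs wGs Gs1 hGs]] := Dec_absorb IN hr.
pose tm := step_iter a0 g t.
have Gs2 p : p \in Gs -> p.1 \in subsets_of I N /\ form p.1 p.2.
  move=> pG; split; last by have [] := wGs p pG.
  by rewrite mem_subsets_of; have [-> ->] := Gs1 p pG.
have reg1 : regular ar (2 * tm + b * (size Gs + (2 * tm).+1) ^ b) T.
  move=> T1 L1 T2 e c' c'0 r' r'le; apply: (reg T1 L1 T2 e c' c'0).
  apply: leq_trans r'le _.
  (* L is the last layer, so its size is counted in the regularity of every layer of T. Hence
     regularity also beats bounds in terms of the rank obtained by peeling, a power of t + size L.2
     + 1. *)
  have ms : (size L.2 <= size L1.2 + msz T2)%N.
    case/lastP: T2 e => [|T2 L2]; rewrite /T !cats1.
      by move/eqP; rewrite eqseq_rcons => /andP[_ /eqP ->]; exact: leq_addr.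
    rewrite -rcons_cons -rcons_cat => /eqP; rewrite eqseq_rcons => /andP[_ /eqP <-].
    by rewrite -cats1 msz_cat msz1; clear; lia.
  set M := (size L1.2 + msz T2 + t.+1)%N.
  apply: leq_trans (B3 M _); last by rewrite /M; clear; lia.
  have tM : (tm <= step_iter a0 g M)%N by apply: step_iter_mono; rewrite /M; clear; lia.
  have rM : (size Gs <= a3 * (2 * M) ^ a3)%N.
    rewrite sGs; apply: leq_trans rle _; rewrite leq_mul2l leq_expl ?orbT // /M; clear -ms; lia.
  rewrite leq_mul2l leq_expl ?orbT //.
  have : ((size Gs + (2 * tm).+1) ^ b <= (a3 * (2 * M) ^ a3 + (2 * step_iter a0 g M).+1) ^ b)%N.
    by apply: leq_expl; apply: leq_add => //; rewrite ltnS leq_mul2l tM orbT.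
  move=> hpow; rewrite addnS -addSn; apply: leq_add; first by rewrite /M; clear; lia.
  apply: leq_add; first by rewrite leq_mul2l tM orbT.
  by rewrite leq_mul2l hpow orbT.
have [G [hG sG reg2 hG2]] := Hreg F n kk I N T _ Gs Ik Gs2 reg1.
set LA := layers_of _ _ in reg2 hG2.
have wfLA : wft LA by exact: layers_of_wft hG.
have wfTA : wft (T ++ LA) by apply/wft_cat.
have LA1 L' : L' \in LA -> L'.1 \in subsets_of I N by case/mapP => A AI ->.
have LAI L' : L' \in LA -> L'.1 \proper I by move/LA1; rewrite mem_subsets_of => /andP[].
have TAI L' : L' \in T ++ LA -> L'.1 \subset I by rewrite mem_cat => /orP[/TI //|/LAI/proper_sub].
have sLA : (size LA <= g)%N by rewrite size_map /g -Ik; exact: size_subsets_of.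
have sTA : (size (T ++ LA) <= h.+1 + g)%N by rewrite size_cat leq_add // size_cat addn1 ltnS.
have hP2 : Dec (gens (T ++ LA)) I 0 P.
  have : Dec (gens (T ++ LA) ++ Gs) I 0 P.
    apply: hGs => p pG; rewrite mem_cat; last by rewrite pG orbT.
    by rewrite gens_cat mem_cat pG.
  apply: Dec_trans => p; rewrite mem_cat => /orP[pG _|pG _]; [exact: Dec_gen1|exact: hG2].
pose delta : R := #|F|%:R ^- (C * tm.+1).
have dd : dens R (gens (T ++ LA)) <= (1 + delta) * #|F|%:R ^- msz (T ++ LA).
  apply: (equidistribution wfTA sTA) => [T1 L1 T2 e|]; last first.
    apply: regular_weaken reg2 => s; apply: pow_bound_le; [exact: leq_addl|clear; lia|clear; lia].
  have L1T : L1 \in T ++ LA by rewrite e mem_cat inE eqxx orbT.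
  have [L10 _] := wfTA _ L1T.
  have wf1 : wft (subt T1 L1.1).
    by apply: wft_subt; move: wfTA; rewrite e => /wft_cat[].
  have sz1 : (size (subt T1 L1.1) <= size T1)%N by rewrite size_filter count_size.
  have sub1 L' : L' \in subt T1 L1.1 -> L'.1 \subset L1.1 by rewrite mem_filter => /andP[].
  case: (ltnP #|L1.1| k) => hk.
    apply: (@Rloc_mono R F n kk a1); first by rewrite /a0; clear; lia.
    apply: (H1 #|L1.1| hk F n kk) => //.
      apply: leq_trans (ltnW hk); apply: subset_leq_card; exact: bigcup_seq_sub.
    apply: leq_trans sz1 _; apply: leq_trans sTA; rewrite e size_cat; exact: leq_addr.
  have L1k : #|L1.1| = k.
    by apply/eqP; rewrite eqn_leq hk -Ik andbT; apply: subset_leq_card; exact: TAI.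
  apply: (@Rloc_mono R F n kk a3); first by rewrite /a0; clear; lia.
  case: (cat_split e) => [[u [eT _]]|[u [eLA _]]]; last first.
    have : L1 \in LA by rewrite eLA mem_cat inE eqxx orbT.
    by move/LAI/proper_card; rewrite L1k Ik ltnn.
  apply: (H3 F n kk) => //.
    apply: leq_trans (subset_leq_card _) cN; apply: bigcup_seq_sub => L'.
    rewrite mem_filter => /andP[_ LT]; apply: TN; rewrite eT mem_cat LT //.
  apply: leq_trans sz1 _; rewrite -ltnS; apply: leq_trans (_ : size T <= _)%N.
    by rewrite eT size_cat /= addnS ltnS leq_addr.
  by rewrite size_cat addn1 ltnS.
have [||||r' r'le hr'] := @removal_loop R F n kk T I a0 tm C delta wf TI I0 (leqnn _) erefl
    LA t P wfLA (fun L' h' => proper_sub (LAI L' h')) dd _ _ hP2.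
- by apply: regular_weaken reg2 => s; apply: pow_bound_le; [exact: leq_addr|clear; lia|clear; lia].
- move=> LA0 L1 LA2 e.
  have L1A : L1 \in LA by rewrite e mem_cat inE eqxx orbT.
  have := LA1 _ L1A; rewrite mem_subsets_of => /andP[L1I /set0Pn[i]]; rewrite inE => /andP[iL iN].
  exists i => //; set U := I :\: L1.1; have iI := subsetP (proper_sub L1I) i iL.
  have wf1 : wft (tlift (size L1.2) (subt (T ++ LA0) U)).
    apply/wft_lift/wft_subt/wft_cat; split=> //; by move: wfLA; rewrite e => /wft_cat[].
  have sub1 L' : L' \in tlift (size L1.2) (subt (T ++ LA0) U) -> L'.1 \subset U.
    by case/mem_lift => L2; rewrite mem_filter => /andP[h' _] ->.
  have sub2 L' : L' \in tlift (size L1.2) (subt (T ++ LA0) U) -> L'.1 \subset i |: U.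
    by move/sub1 => h'; apply: subset_trans h' (subsetUr _ _).
  have sz1 : (size (tlift (size L1.2) (subt (T ++ LA0) U)) <= h.+1 + g)%N.
    rewrite size_map; apply: leq_trans (_ : size (T ++ LA0) <= _)%N.
      by rewrite size_filter count_size.
    apply: leq_trans sTA; rewrite e !size_cat; clear; lia.
  have cU : (#|i |: U| + #|L1.1| = k.+1)%N.
    rewrite cardsU1 !inE iL /= add1n addSn -Ik cardsD.
    by rewrite (setIidPr (proper_sub L1I)) subnK // subset_leq_card // proper_sub.
  have iU0 : i |: U != set0 by apply/set0Pn; exists i; rewrite setU11.
  case: (leqP #|L1.1| 1) => hL1; last first.
    have hk : (#|i |: U| < k)%N by clear -cU hL1; lia.
    apply: (@Rloc_mono R F _ kk a1); first by rewrite /a0; clear; lia.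
    apply: (H1 _ hk) => //; apply: leq_trans (ltnW hk); apply: subset_leq_card; exact: bigcup_seq_sub.
  have L1i : L1.1 = [set i].
    apply/esym/eqP; rewrite eqEcard sub1set iL cards1; exact: hL1.
  apply: (@Rloc_mono R F _ kk a2); first by rewrite /a0; clear; lia.
  apply: H2 => //; first by move: cU; rewrite L1i cards1; clear; lia.
  have cNi : (#|N :\ i| < c.+1)%N.
    by apply: leq_trans cN; rewrite -/N [X in (_ < X)%N](cardsD1 i) iN.
  rewrite -ltnS; apply: leq_ltn_trans cNi; apply: subset_leq_card; apply: bigcup_seq_sub => L' hL'.
  apply/subsetP => j jL; have := subsetP (sub1 _ hL') j jL.
  rewrite !inE L1i inE => /andP[-> _] /=.
  case/mem_lift: hL' jL => L2; rewrite mem_filter => /andP[_ L2T] -> /= jL.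
  move: L2T; rewrite mem_cat => /orP[/TN/subsetP/(_ j jL) //|L2A].
  have L2LA : L2 \in LA by rewrite e mem_cat L2A.
  have := LA1 _ L2LA; rewrite mem_subsets_of => /andP[_ /set0Pn[j']]; rewrite inE => /andP[j'L j'N].
  (* As the new layers are sorted by size, those before a singleton are singletons too. They meet N,
     hence lie in N. *)
  suff -> : j = j' by [].
  have [u1 [A [u2 [eu eu1 eA eu2]]]] := map_split e.
  have : L2.1 \in u1 by move: L2A; rewrite -eu1 => /mapP[B Bu ->].
  move=> L2u; have [v1 [v2 ev]] : exists v1 v2, u1 = v1 ++ L2.1 :: v2 by case/splitPr: L2u => v1 v2; exists v1, v2.
  have : (#|L2.1| <= #|A|)%N.
    apply: (subsets_of_sorted (S := I) (N := N) (u1 := v1) (u2 := v2 ++ A :: u2)).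
      by rewrite eu ev -catA.
    by rewrite mem_cat inE eqxx orbT.
  have -> : A = [set i] by rewrite -L1i -eA.
  by rewrite cards1 => /card_le1_eqP; apply.
- apply: le_trans hb; rewrite ler_wpM2r ?dens_ge0 //; exact: theta_mono.
- by apply: leq_trans (step_iter_mono_g _ _ sLA) _.
have rtm : (r' <= tm)%N.
  by apply: leq_trans (step_iter_mono_g a0 t sLA); apply: leq_trans r'le; rewrite leq_addr.
exists r' => //; apply: leq_trans rtm _; rewrite /tm.
case: (t) => [|t']; first by rewrite step_iter0.
exact: B2.
Qed.

(** * Forms without a tower *)

Section Subs.
Variable kk : nat.
Implicit Types (s : seq 'I_kk) (I : {set 'I_kk}).

Fixpoint subs s : seq {set 'I_kk} :=
  if s is i :: s' then subs s' ++ map (fun I => i |: I) (subs s') else [:: set0].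

Lemma size_subs s : size (subs s) = (2 ^ size s)%N.
Proof. by elim: s => //= i s IH; rewrite size_cat size_map IH expnS mul2n addnn. Qed.

Lemma subs_sub s I : I \in subs s -> I \subset [set i in s].
Proof.
elim: s I => [|i s IH] I /=; first by rewrite inE => /eqP ->; exact: sub0set.
rewrite mem_cat => /orP[/IH h|/mapP[I' /IH h ->]].
  by apply: subset_trans h _; apply/subsetP => j; rewrite !inE => ->; rewrite orbT.
apply/subsetP => j; rewrite !inE => /orP[->//|/(subsetP h)]; by rewrite inE => ->; rewrite orbT.
Qed.

End Subs.

(** * Bias as a function of some of the coordinates *)

Section BiasFunction.
Variables (R : realFieldType) (F : finFieldType) (n m kk : nat).
Local Notation X := {ffun 'I_kk -> 'rV[F]_n}.
Local Notation Y := {ffun 'I_kk -> 'rV[F]_m}.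
Variables (J D : {set 'I_kk}) (Q : X -> Y -> F).
Hypothesis Qlin : forall i, i \in J -> forall x y, lin1 (fun v => Q (upd x i v) y).
Hypothesis Qform : forall x, form D (Q x).
Hypothesis D0 : D != set0.
Hypothesis Qmix : forall x u y, Q (mix J x u) y = Q x y.

Definition fbias (x : X) : R := avg (fun y => psi R (Q x y)).

Lemma psiN (a : F) : psi R (- a) = psi R a.
Proof. by rewrite /psi oppr_eq0. Qed.

Lemma form_lin (I : {set 'I_kk}) g i : i \in I -> form I g -> lin_at i (g : Y -> F).
Proof. by move=> iI [h _] x; apply: h. Qed.

Lemma bias_le1 (x : X) : fbias x <= 1.
Proof. by apply: avg_le1 => y; exact: psi_le1. Qed.

Lemma bias_ge0 (x : X) : 0 <= fbias x.
Proof.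
have /set0Pn[i iD] := D0; apply: le_trans (pd_psi_ge0 (f := fun=> 1) (g := Q x) _ (form_lin iD (Qform x))) _.
  by move=> y; exact: cone_const ler01.
by rewrite le_eqVlt (eq_avg (g := fun y => psi R (Q x y))) ?eqxx // => y; rewrite mul1r.
Qed.

Lemma bias_eq (x x' : X) : (forall i, i \in J -> x i = x' i) -> fbias x = fbias x'.
Proof.
move=> e; have -> : fbias x = fbias (mix J x x') by apply: eq_avg => y; rewrite Qmix.
congr fbias; apply/ffunP => i; rewrite ffunE; by case: ifP => // /e.
Qed.

(** Correlate the form at v with the negative of the form at w, which has the same bias because
    [psi] is even. *)
Lemma bias_sub (x : X) i v w : i \in J -> fbias (upd x i v) * fbias (upd x i w) <= fbias (upd x i (v - w)).
Proof.
move=> iJ; have /set0Pn[i0 i0D] := D0.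
have e (y : X) : fbias y = avg (fun z => 1 * psi R (Q y z)).
  by apply: eq_avg => z; rewrite mul1r.
have e' : fbias (upd x i w) = avg (fun z => 1 * psi R (- Q (upd x i w) z)).
  by apply: eq_avg => z; rewrite mul1r psiN.
have hN := formN (Qform (upd x i w)).
rewrite (e (upd x i v)) e'; apply: le_trans (correlation (i0 := i0) _ _ _) _.
- by move=> y; exact: cone_const ler01.
- exact: form_lin (Qform _).
- move=> j; case: (boolP (j \in D)) => jD; [left|right].
    by split; [move=> y; exact: cone_const ler01|move=> y; exact: cone_const ler01|exact: form_lin (Qform _)|
      exact: form_lin hN].
  by split=> //; [exact: (Qform _).2|exact: hN.2].
rewrite le_eqVlt; apply/orP; left; apply/eqP/eq_avg => y; rewrite !mul1r; congr psi.
by have l := Qlin iJ x y; rewrite (lin1D v (- w) l) (lin1N w l).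
Qed.

Lemma bias_zero (x : X) i : i \in J -> fbias (upd x i 0) = 1.
Proof.
move=> iJ; rewrite -[RHS](avg_const (0 : Y)); apply: eq_avg => y.
by rewrite (lin10 (Qlin iJ x y)) psi0.
Qed.

Lemma bias_add (x : X) i v w : i \in J -> fbias (upd x i v) * fbias (upd x i w) <= fbias (upd x i (v + w)).
Proof.
move=> iJ; have := bias_sub x 0 w iJ; rewrite bias_zero // mul1r sub0r => h.
rewrite -[w in leRHS]opprK; apply: le_trans (bias_sub x v (- w) iJ).
by apply: ler_wpM2l => //; exact: bias_ge0.
Qed.

Lemma avg_psi_lin (l : 'rV[F]_m -> F) : lin1 l ->
  avg (fun v => psi R (l v)) = [forall v, l v == 0]%:R.
Proof.
move=> hl; have sp : subsp (xpredT : pred 'rV[F]_m) by [].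
have := sum_psi_subsp R 0 sp hl; rewrite /avg.
rewrite (eq_bigr (fun v => psi R (l v))); last by move=> v _; rewrite addr0.
move=> ->; rewrite psi0 mulr1 (eq_forallb (P2 := fun v => l v == 0)) //.
case: [forall v, l v == 0]; last by rewrite mulr0.
rewrite (eq_card (B := {: 'rV[F]_m})) // mulVf // pnatr_eq0 -lt0n; apply/card_gt0P; by exists 0.
Qed.

(** Averaging over one coordinate of y turns [psi] into the indicator that Q vanishes identically in
    it, and this is a linear condition on the i-th coordinate of x. *)
Lemma bias_pd i : i \in J -> pd_at i fbias.
Proof.
move=> iJ x; have /set0Pn[j jD] := D0.
have e v : avg (fun y => [forall w, Q (upd x i v) (upd y j w) == 0]%:R) = fbias (upd x i v).
  rewrite /fbias [RHS](avg_upd j); apply: eq_avg => y; apply/esym.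
  exact: (avg_psi_lin (form_lin jD (Qform _) y)).
apply: (cone_eq e); apply: cone_avg => y; apply: cone_subsp => a u v /forallP hu /forallP hv.
apply/forallP => w; have -> := Qlin iJ x (upd y j w) a u v.
by rewrite (eqP (hu w)) (eqP (hv w)) mulr0 addr0.
Qed.

(** Applied to one coordinate of J after another, the hypothesis splits each factor in two. *)
Lemma bias_split (al be ga : X) :
  (forall i (x : X), i \in J -> fbias (upd x i (al i)) * fbias (upd x i (be i)) <= fbias (upd x i (ga i))) ->
  \prod_(I <- subs (enum J)) fbias (mix I al be) <= fbias ga.
Proof.
move=> h; have key (s : seq 'I_kk) x : uniq s -> {subset s <= J} ->
    \prod_(I <- subs s) fbias (mix [set i in s] (mix I al be) x) <= fbias (mix [set i in s] ga x).
  elim: s x => [|i s IH] x /=.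
    move=> _ _; rewrite big_seq1 le_eqVlt; apply/orP; left; apply/eqP; congr fbias.
    by apply/ffunP => j; rewrite !ffunE !inE.
  case/andP=> nis us sJ; have iJ : i \in J by apply: sJ; rewrite inE eqxx.
  have sJ' : {subset s <= J} by move=> j js; apply: sJ; rewrite inE js orbT.
  have mixc y : mix [set j in i :: s] y x = mix [set j in s] y (upd x i (y i)).
    apply/ffunP => j; rewrite !ffunE !inE; case: (j =P i) => [->|//]; by rewrite if_same.
  have nis' : i \notin [set j in s] by rewrite inE.
  rewrite mixc mix_upd_out //; apply: le_trans (h _ _ iJ).
  rewrite big_cat big_map /= mulrC; apply: ler_pM.
  - by apply: prodr_ge0 => I _; exact: bias_ge0.
  - by apply: prodr_ge0 => I _; exact: bias_ge0.
  - rewrite -mix_upd_out //; apply: le_trans (IH (upd x i (al i)) us sJ').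
    rewrite le_eqVlt; apply/orP; left; apply/eqP/eq_big_seq => I Is; congr fbias.
    rewrite mixc; apply/ffunP => j; rewrite !ffunE !inE eqxx; case: (j =P i) => // ->.
    by rewrite (negbTE nis).
  - rewrite -mix_upd_out //; apply: le_trans (IH (upd x i (be i)) us sJ').
    rewrite le_eqVlt; apply/orP; left; apply/eqP/eq_big_seq => I Is; congr fbias.
    rewrite mixc; apply/ffunP => j; rewrite !ffunE !inE; case: (j =P i) => // ->.
    rewrite (negbTE nis); case: ifP => // iI.
    by have := subsetP (subs_sub Is) i iI; rewrite inE (negbTE nis).
have e y : fbias (mix [set i in enum J] y ga) = fbias y.
  by apply: bias_eq => i iJ; rewrite ffunE inE mem_enum iJ.
have sub : {subset enum J <= J} by move=> i; rewrite mem_enum.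
have := key (enum J) ga (enum_uniq _) sub; rewrite (e ga); apply: le_trans.
by rewrite le_eqVlt; apply/orP; left; apply/eqP/eq_bigr => I _; rewrite e.
Qed.

Definition corner (W : {set 'I_kk}) (u z : X) : X := mix W (z + u) z.

Lemma bias_ge_corners u z : \prod_(W <- subs (enum J)) fbias (corner W u z) <= fbias u.
Proof.
apply: (bias_split (al := z + u) (be := z)) => i x iJ; apply: le_trans (bias_sub _ _ _ iJ) _.
by rewrite ffunE addrC addKr.
Qed.

(** The coordinates are split into z and u inside W, and into z and 0 outside. A factor containing
    one of these zeros has bias 1; each other one is the factor with z on I and u on the rest of
    J. *)
Lemma corner_bias_ge (W : {set 'I_kk}) u z : W \subset J ->
  \prod_(I <- subs (enum J)) fbias (mix I z u) <= fbias (corner W u z).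
Proof.
move=> WJ; apply: le_trans (bias_split (al := z) (be := mix W u 0) (ga := corner W u z) _); last first.
  move=> i x iJ; apply: le_trans (bias_add _ _ _ iJ) _.
  by rewrite !ffunE; case: ifP; rewrite ?ffunE // addr0.
apply: ler_prod => I _; rewrite bias_ge0 /=.
case: (pickP [pred i | (i \in J) && (i \notin I) && (i \notin W)]) => [i /andP[/andP[iJ iI] iW]|no].
  apply: le_trans (bias_le1 _) _; rewrite -(bias_zero (mix I z (mix W u 0)) iJ) le_eqVlt.
  apply/orP; left; apply/eqP; congr fbias; apply/ffunP => j; rewrite !ffunE.
  by case: eqP => // ->; rewrite (negbTE iI) (negbTE iW) ?ffunE.
rewrite le_eqVlt; apply/orP; left; apply/eqP/bias_eq => i iJ; rewrite !ffunE; case: ifP => // iI.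
by have := no i; rewrite /= iJ iI /= => /negbFE ->.
Qed.

End BiasFunction.

(** * Restriction to random subspaces *)

Section Slices.
Variables (F : finFieldType) (n kk tau : nat).
Local Notation X := {ffun 'I_kk -> 'rV[F]_n}.
Local Notation C := {ffun 'I_kk -> 'rV[F]_tau}.
Implicit Types (phi : {ffun 'I_kk -> 'M[F]_(tau, n)}) (S : {set 'I_kk}) (P : X -> F).

Lemma form_slice S P j v : form S P -> form (S :\ j) (fun x => P (upd x j v)).
Proof.
move=> [h1 h2]; split=> i; rewrite in_setD1.
  move=> /andP[ij iS] x a u w; rewrite !(updC x _ _ ij); exact: h1.
rewrite negb_and negbK => /orP[/eqP ->|iS] x w; first by rewrite updK.
by case: (eqVneq i j) => [->|ij]; [rewrite updK|rewrite updC // h2].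
Qed.

Definition pt phi (c : C) : X := cmap (fun j v => v *m phi j) c.

Lemma pt_linear phi j : linear (fun v : 'rV[F]_tau => v *m phi j).
Proof. by move=> a u v; rewrite mulmxDl scalemxAl. Qed.

(** All ways of putting rows of phi in the coordinates of s. By multilinearity they determine P when
    these coordinates range over the row spaces. *)
Fixpoint slc phi (s : seq 'I_kk) P : seq (X -> F) :=
  if s is j :: s' then
    flatten [seq slc phi s' (fun x => P (upd x j (row l (phi j)))) | l <- enum 'I_tau]
  else [:: P].

Lemma size_slc phi s P : size (slc phi s P) = (tau ^ size s)%N.
Proof.
elim: s P => //= j s IH P; rewrite size_flatten /shape -map_comp sumnE big_map.
rewrite (eq_bigr (fun=> (tau ^ size s)%N)) => [|l _]; last exact: IH.
by rewrite big_enum sum_nat_const /= card_ord expnS.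
Qed.

Lemma slc_form phi s S P Q : form S P -> Q \in slc phi s P -> form (S :\: [set i in s]) Q.
Proof.
elim: s S P => [|j s IH] S P hP /=.
  rewrite inE => /eqP ->; rewrite (_ : S :\: _ = S) //.
  by apply/setP => i; rewrite !inE.
case/flatten_mapP => l _ /(IH (S :\ j) _ (form_slice j _ hP)).
rewrite (_ : (S :\ j) :\: _ = S :\: [set i in j :: s]) //.
by apply/setP => i; rewrite !inE negb_or; case: (i == j); rewrite ?andbF.
Qed.

Lemma lin1_sum (T : Type) (s : seq T) (l : 'rV[F]_n -> F) (a : T -> F) (v : T -> 'rV[F]_n) :
  lin1 l -> l (\sum_(t <- s) a t *: v t) = \sum_(t <- s) a t * l (v t).
Proof.
move=> hl; elim: s => [|t s IH]; first by rewrite !big_nil (lin10 hl).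
by rewrite !big_cons hl IH.
Qed.

Lemma slc_zero phi s S P x c : form S P -> uniq s -> {subset s <= S} ->
  (forall Q, Q \in slc phi s P -> Q x = 0) -> P (mix [set i in s] (pt phi c) x) = 0.
Proof.
elim: s S P => [|j s IH] S P hP /=.
  move=> _ _ /(_ P); rewrite inE eqxx => /(_ isT) e; rewrite -[RHS]e; congr P.
  by apply/ffunP => i; rewrite !ffunE inE.
case/andP=> js us sS h; have jS : j \in S by apply: sS; rewrite inE eqxx.
set y := mix [set i in s] (pt phi c) x.
have -> : mix [set i in j :: s] (pt phi c) x = upd y j (pt phi c j).
  by apply/ffunP => i; rewrite !ffunE !inE; case: (i =P j) => // ->.
rewrite ffunE mulmx_sum_row (lin1_sum _ _ _ (hP.1 j jS y)) big1 // => l _.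
rewrite (IH (S :\ j) (fun x => P (upd x j (row l (phi j))))) ?mulr0 //.
- exact: form_slice.
- move=> i is_; rewrite !inE sS ?inE ?is_ ?orbT // andbT; apply/eqP => e; by rewrite -e is_ in js.
- by move=> Q hQ; apply: h; apply/flatten_mapP; exists l; rewrite ?mem_enum.
Qed.

End Slices.

Section Random.
Variables (R : realFieldType) (F : finFieldType) (n kk tau : nat).
Local Notation X := {ffun 'I_kk -> 'rV[F]_n}.
Local Notation C := {ffun 'I_kk -> 'rV[F]_tau.+1}.
Local Notation M := {ffun 'I_kk -> 'M[F]_(tau.+1, n)}.
Local Notation q := (#|F|%:R : R).
Implicit Types (phi : M) (S D : {set 'I_kk}) (g : X -> F).

(** The bias over a translate of the subspaces is largest for the subspaces themselves, and its
    average over all translates is the bias over the whole space. *)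
Lemma avg_pt_ge phi D g : form D g ->
  avg (fun w => psi R (g w)) <= avg (fun c : C => psi R (g (pt phi c))).
Proof.
move=> hg; pose Phi w := avg (fun c : C => psi R (g (w + pt phi c))).
have -> : avg (fun w => psi R (g w)) = avg Phi.
  rewrite /Phi avg_exch -[LHS](avg_const (0 : C)); apply: eq_avg => c.
  by rewrite (avg_shift _ (fun w => psi R (g w))).
have -> : avg (fun c : C => psi R (g (pt phi c))) = Phi 0.
  by apply: eq_avg => c; rewrite add0r.
rewrite -[leRHS](avg_const (0 : X)); apply: ler_avg; apply: chain_le => w j.
case: (boolP (j \in D)) => jD; last first.
  rewrite le_eqVlt; apply/orP; left; apply/eqP/eq_avg => c; congr psi.
  apply: (form_dep hg) => i iD; rewrite !ffunE; case: eqP => // e.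
  by rewrite e (negbTE jD) in iD.
rewrite /Phi (avg_upd j) [leRHS](avg_upd j); apply: ler_avg => c.
set y := w + pt phi c; pose l v := g (upd y j (v *m phi j)).
have hl : lin1 l by move=> a u v; rewrite /l pt_linear; exact: hg.1.
have e1 v : g (w + pt phi (upd c j v)) = l v + g (upd y j (w j)).
  have hl' := hg.1 j jD y; rewrite /l -(lin1D _ _ hl'); congr g.
  by apply/ffunP => i; rewrite !ffunE; case: eqP => // ->; rewrite addrC.
have e2 v : g (upd w j 0 + pt phi (upd c j v)) = l v.
  by congr g; apply/ffunP => i; rewrite !ffunE; case: eqP => // ->; rewrite add0r.
rewrite (eq_avg (g := fun v => 1 * psi R (l v + g (upd y j (w j))))); last by move=> v; rewrite e1 mul1r.
rewrite [leRHS](eq_avg (g := fun v => 1 * psi R (l v))); last by move=> v; rewrite e2 mul1r.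
have c1 : cone (fun _ : 'rV[F]_tau.+1 => 1 : R) by exact: cone_const ler01.
rewrite (cone_psi_shift _ c1 hl) ler_piMl ?psi_le1 //.
exact: (cone_psi_ge0 c1 hl).
Qed.

(** If no coordinate of c in D vanishes, the point of random subspaces with parameters c is uniform
    on D. The other c have density at most #|D| q^-(tau+1). *)
Lemma avg_pt_le D g : form D g ->
  avg (fun phi => avg (fun c : C => psi R (g (pt phi c)))) <=
    avg (fun w => psi R (g w)) + #|D|%:R * q ^- tau.+1.
Proof.
move=> hg; rewrite avg_exch.
have -> : #|D|%:R * q ^- tau.+1 = avg (fun c : C => \sum_(j in D) (c j == 0)%:R).
  rewrite (eq_avg (g := fun c : C => \sum_j ((j \in D)%:R * (c j == 0)%:R))); last first.
    by move=> c; rewrite big_mkcond; apply: eq_bigr => j _; case: (j \in D); rewrite ?mul1r ?mul0r.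
  rewrite avg_sum -sumr_const mulr_suml [LHS]big_mkcond; apply: eq_bigr => j _.
  rewrite avgZ; case: (j \in D); last by rewrite !mul0r.
  rewrite !mul1r (avg_upd j) -[LHS](avg_const (0 : C)); apply: eq_avg => c.
  rewrite (eq_avg (g := fun v : 'rV[F]_tau.+1 => (v == 0)%:R)); last by move=> v; rewrite ffunE eqxx.
  rewrite /avg (bigD1 0) //= eqxx big1 => [|v /negbTE -> //].
  by rewrite addr0 mulr1 card_mx mul1n natrX.
rewrite -[X in _ <= X + _](avg_const (0 : C)) -avgD; apply: ler_avg => c.
case: (boolP [exists j in D, c j == 0]) => [/existsP[j /andP[jD cj]]|no].
  apply: (@le_trans _ _ 1); first by apply: avg_le1 => phi; exact: psi_le1.
  rewrite (bigD1 j) //= cj addrCA lerDl addr_ge0 ?sumr_ge0 //.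
  case: (set_0Vmem D) jD => [->|[i iD] _]; first by rewrite inE.
  apply: le_trans (pd_psi_ge0 (f := fun=> 1) (g := g) _ (form_lin iD hg)) _.
    by move=> y; exact: cone_const ler01.
  by rewrite le_eqVlt (eq_avg (g := fun y => psi R (g y))) ?eqxx // => y; rewrite mul1r.
rewrite big1 ?addr0 => [|j jD]; last first.
  by case: eqP => // cj; case/negP: no; apply/existsP; exists j; rewrite jD cj eqxx.
pose c' : C := [ffun j => if j \in D then c j else const_mx 1].
have c'0 j : c' j != 0.
  rewrite ffunE; case: ifP => jD.
    by apply: contra no => cj; apply/existsP; exists j; rewrite jD.
  by apply/eqP => /matrixP/(_ 0 0)/eqP; rewrite !mxE oner_eq0.
(* A translation of phi by B w moves the point with parameters c' by w, which gives uniformity.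
   Outside D, c' is filled with a nonzero vector, as g ignores these coordinates. *)
pose B (w : X) : M := [ffun j => pinvmx (c' j) *m w j].
have ptB phi w : pt (phi + B w) c' = w + pt phi c'.
  apply/ffunP => j; rewrite !ffunE mulmxDr mulmxA mulmxVp ?mul1mx 1?addrC //.
  by rewrite /row_free rank_rV; have := c'0 j; rewrite ffunE => ->.
rewrite (eq_avg (g := fun phi => psi R (g (pt phi c')))); last first.
  move=> phi; congr psi; apply: (form_dep hg) => j jD; by rewrite !ffunE jD.
have -> : avg (fun phi => psi R (g (pt phi c'))) =
    avg (fun phi => avg (fun w => psi R (g (pt (phi + B w) c')))).
  rewrite avg_exch -[LHS](avg_const (0 : X)); apply: eq_avg => w; apply/esym.
  apply: (@avg_bij R M M (fun phi => phi + B w) (fun phi => psi R (g (pt phi c')))).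
  by exists (fun phi => phi - B w) => phi; rewrite ?addrK ?subrK.
rewrite -[leRHS](avg_const (0 : M)); apply: ler_avg => phi.
rewrite le_eqVlt; apply/orP; left; apply/eqP.
rewrite -(avg_shift (pt phi c') (fun w => psi R (g w))); by apply: eq_avg => w; rewrite ptB.
Qed.

End Random.

Section Products.
Variables (R : realFieldType) (F : finFieldType) (n kk : nat).
Local Notation X := {ffun 'I_kk -> 'rV[F]_n}.

Lemma avg_sum_seq (T : finType) (U : Type) (s : seq U) (b : U -> T -> R) :
  avg (fun x => \sum_(t <- s) b t x) = \sum_(t <- s) avg (b t).
Proof.
elim: s => [|t s IH].
  by rewrite big_nil /avg big1 ?mulr0 // => x _; rewrite big_nil.
by rewrite big_cons -IH -avgD; apply: eq_avg => x; rewrite big_cons.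
Qed.

Lemma avg_prod_ge (J : {set 'I_kk}) (i0 : 'I_kk) (U : Type) (s : seq U) (b : U -> X -> R) : i0 \in J ->
  (forall t i, i \in J -> pd_at i (b t)) -> (forall t i, i \notin J -> cst_at i (b t)) ->
  \prod_(t <- s) avg (b t) <= avg (fun x => \prod_(t <- s) b t x).
Proof.
move=> i0J h1 h2; elim: s => [|t s IH].
  by rewrite big_nil le_eqVlt -[X in X == _](avg_const (0 : X)) (eq_avg (g := fun x => \prod_(t <- [::]) b t x)) ?eqxx // => x; rewrite big_nil.
have b0 x : 0 <= b t x by have := cone_ge0 (x i0) (h1 t i0 i0J x); rewrite upd_same.
have hp i : i \in J -> pd_at i (fun x => \prod_(t <- s) b t x).
  move=> iJ; elim: s {IH} => [|t' s IHs] x.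
    have c1 : cone (fun _ : 'rV[F]_n => 1 : R) by exact: cone_const ler01.
    by apply: (cone_eq _ c1) => v; rewrite big_nil.
  by apply: (cone_eq _ (coneM (h1 t' i iJ x) (IHs x))) => v; rewrite big_cons.
have hc i : i \notin J -> cst_at i (fun x => \prod_(t <- s) b t x).
  by move=> iJ x v; apply: eq_bigr => t' _; exact: h2.
rewrite big_cons; apply: le_trans (ler_wpM2l _ IH) _; first exact: avg_ge0.
have := correlation (f := b t) (f' := fun x => \prod_(t <- s) b t x) (g := fun=> 0) (g' := fun=> 0) (h1 t i0 i0J).
have e (f : X -> R) : avg (fun x => f x * psi R (0 : F)) = avg f by apply: eq_avg => x; rewrite psi0 mulr1.
rewrite !e => h; apply: le_trans (h _ _) _.
- by move=> x a u v; rewrite mulr0 addr0.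
- move=> i; case: (boolP (i \in J)) => iJ; [left|right]; split=> //; try exact: h1; try exact: h2; try exact: hp; try exact: hc;
    by move=> x a u v; rewrite mulr0 addr0.
rewrite le_eqVlt; apply/orP; left; apply/eqP/eq_avg => x.
by rewrite addr0 psi0 mulr1 big_cons.
Qed.

End Products.

(** * Bias with some coordinates fixed *)

Section Partial.
Variables (R : realFieldType) (F : finFieldType) (n kk : nat).
Local Notation X := {ffun 'I_kk -> 'rV[F]_n}.
Local Notation q := (#|F|%:R : R).
Variables (S : {set 'I_kk}) (P : X -> F).
Hypothesis hP : form S P.
Implicit Types (J I W : {set 'I_kk}).

Definition partial_bias J : X -> R := fbias R (fun x w => P (mix J x w)).

Lemma mix_mix J (x u w : X) : mix J (mix J x u) w = mix J x w.
Proof. by apply/ffunP => i; rewrite !ffunE; case: (i \in J). Qed.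

Lemma mix_lin J i (x y : X) : J \subset S -> i \in J -> lin1 (fun v => P (mix J (upd x i v) y)).
Proof. by move=> /subsetP JS iJ a u v; rewrite !mix_upd_in //; apply: hP.1; exact: JS. Qed.

Lemma proper_setD0 J : J \proper S -> S :\: J != set0.
Proof.
case/properP=> _ [i iS iJ]; apply/set0Pn; exists i; by rewrite inE iS iJ.
Qed.

Lemma avg_partial J I u : I \subset J ->
  avg (fun z => partial_bias J (mix I z u)) = partial_bias (J :\: I) u.
Proof.
move=> IJ; rewrite /partial_bias /fbias [RHS](avg_mix I); apply: eq_avg => z; apply: eq_avg => w.
congr psi; congr P; apply/ffunP => i; rewrite !ffunE inE.
by case: (boolP (i \in I)) => [/(subsetP IJ) ->|].
Qed.

(* Think of phi as random: f' averages over a subspace only, is at least f, and is close to f on average. *)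
Lemma cube_bound tau (phi : {ffun 'I_kk -> 'M[F]_(tau.+1, n)}) J (u : X) (delta ep eta : R) :
  J \proper S -> J != set0 ->
  let f' := fbias R (fun x c => P (mix J x (pt phi c))) in
  avg (fun x => f' x - partial_bias J x) <= ep -> f' u = 1 ->
  0 <= delta -> delta <= 1 -> 0 <= eta -> 0 <= ep ->
  (forall I, I \in subs (enum J) -> I != set0 -> delta <= partial_bias (J :\: I) u) ->
  eta <= delta ^+ (2 ^ #|J|) - (2 ^ #|J|)%:R * ep ->
  eta ^+ (2 ^ #|J|) <= partial_bias J u.
Proof.
move=> JS J0 f' hep fu d0 d1 eta0 ep0 hd heta; set f := partial_bias J.
have JsS := proper_sub JS; have D0 := proper_setD0 JS.
have lf i : i \in J -> forall x w, lin1 (fun v => P (mix J (upd x i v) w)) by move=> iJ x w; exact: mix_lin.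
have ff x : form (S :\: J) (fun w => P (mix J x w)) by exact: form_fibre.
have mf x v w : P (mix J (mix J x v) w) = P (mix J x w) by rewrite mix_mix.
pose Q' := (fun x (c : {ffun 'I_kk -> 'rV[F]_tau.+1}) => P (mix J x (pt phi c))).
have lf' i : i \in J -> forall x c, lin1 (fun v => Q' (upd x i v) c) by move=> iJ x c; exact: mix_lin.
have ff' x : form (S :\: J) (Q' x).
  by apply: (form_cmap (f := fun w => P (mix J x w))) (ff x) => i; exact: pt_linear.
have mf' x v c : Q' (mix J x v) c = Q' x c by rewrite /Q' mix_mix.
have f0 x : 0 <= f x by exact: (bias_ge0 _ ff D0).
have f'0 x : 0 <= f' x by exact: (bias_ge0 _ ff' D0).
have f'1 x : f' x <= 1 by exact: bias_le1.
have g0 x : 0 <= f' x - f x by rewrite subr_ge0; apply: avg_pt_ge; exact: ff.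
pose s := subs (enum J); have szs : size s = (2 ^ #|J|)%N by rewrite size_subs -cardE.
have sJ I : I \in s -> I \subset J.
  by move/subs_sub; rewrite (_ : [set i in enum J] = J) //; apply/setP => i; rewrite inE mem_enum.
pose s' := [seq I <- s | I != set0].
(* A z is chosen with [Fz z - Gz z] at least eta. At each corner f' is at least [Fz z]: f' dominates
   f, and the missing factor I = set0 is f' u = 1. The difference of f' and f at a corner is at most
   [Gz z], so f is at least eta at every corner, and [bias_ge_corners] brings this back to u. *)
pose Fz z := \prod_(I <- s') f (mix I z u).
pose Gz z := \sum_(W <- s) (f' (corner W u z) - f (corner W u z)).
have avgF : delta ^+ (2 ^ #|J|) <= avg Fz.
  have /set0Pn[i0 i0J] := J0.
  apply: le_trans (avg_prod_ge (b := fun I z => f (mix I z u)) s' i0J _ _); last first.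
  - move=> I i iJ x v; apply: (bias_eq _ mf) => j jJ; rewrite !ffunE; case: ifP => // _.
    by case: eqP => // e; rewrite -e jJ in iJ.
  - move=> I i iJ x; case: (boolP (i \in I)) => iI.
      apply: (cone_eq _ (bias_pd R lf ff D0 iJ (mix I x u))) => v; by rewrite mix_upd_in.
    have c1 : cone (fun _ : 'rV[F]_n => f (mix I x u)) by exact: cone_const (f0 _).
    by apply: (cone_eq _ c1) => v; rewrite mix_upd_notin.
  have ss : (size s' <= 2 ^ #|J|)%N by rewrite -szs size_filter count_size.
  apply: le_trans (ler_wiXn2l d0 d1 ss) _.
  have : forall I, I \in s' -> delta <= avg (fun z => f (mix I z u)).
    move=> I; rewrite mem_filter => /andP[I0 Is]; rewrite avg_partial ?sJ //; exact: hd.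
  elim: (s') => [|I r IH] h; first by rewrite big_nil expr0.
  rewrite big_cons exprS; apply: ler_pM => //; first exact: exprn_ge0.
    by apply: h; rewrite inE eqxx.
  by apply: IH => I' hI'; apply: h; rewrite inE hI' orbT.
have avgG : avg Gz <= (2 ^ #|J|)%:R * ep.
  rewrite avg_sum_seq -szs -sum1_size natr_sum mulr_suml; apply: ler_sum => W _; rewrite mul1r.
  apply: le_trans hep; rewrite le_eqVlt; apply/orP; left; apply/eqP.
  rewrite -[RHS](avg_shift (mix W u 0)); apply: eq_avg => z.
  have -> : corner W u z = z + mix W u 0.
    by apply/ffunP => i; rewrite !ffunE; case: ifP; rewrite ?addr0.
  by [].
have [z hz] := avg_exists_ge (0 : X) (fun z => Fz z - Gz z).
have {hz} hz : eta <= Fz z - Gz z.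
  by apply: le_trans hz; rewrite avgB; apply: le_trans heta _; apply: lerB.
have corn W : W \in s -> eta <= f (corner W u z).
  move=> Ws; have h1 : Fz z <= f' (corner W u z).
    apply: le_trans (corner_bias_ge R lf' ff' D0 mf' u z (sJ W Ws)).
    rewrite /Fz big_filter [leRHS](bigID (fun I => I != set0)) /= -/s.
    rewrite -[leLHS]mulr1; apply: ler_pM => //.
    - by apply: prodr_ge0 => I _.
    - apply: ler_prod => I _; rewrite f0 /=; have := g0 (mix I z u); by rewrite subr_ge0.
    - rewrite big1 // => I; rewrite negbK => /eqP ->; rewrite -fu; congr fbias.
      by apply/ffunP => i; rewrite !ffunE inE.
  have h2 : f' (corner W u z) - f (corner W u z) <= Gz z.
    rewrite /Gz (big_rem W) //= lerDl; apply: sumr_ge0 => W' _; exact: g0.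
  by move: hz h1 h2; set a := Fz z; set b := Gz z; lra.
apply: le_trans (bias_ge_corners R lf ff D0 mf u z); rewrite -szs -/s.
elim: (s) corn => [|W r IH] corn; first by rewrite big_nil expr0.
rewrite big_cons exprS; apply: ler_pM => //; first exact: exprn_ge0.
  by apply: corn; rewrite inE eqxx.
by apply: IH => I' hI'; apply: corn; rewrite inE hI' orbT.
Qed.

End Partial.

(** Exponents in [cube_bound]: if delta is q^-l, its power 2^k is q^-(2^k l); eta is smaller by one
    factor q and is raised to the power 2^k again. *)
Fixpoint abs_level (k t j : nat) : nat :=
  if j is j'.+1 then (2 ^ k * (2 ^ k * abs_level k t j' + 1))%N else t.
(** The 2k further dimensions pay for the factor 2^k k in front of the sampling error. *)
Definition abs_dim k t j := (2 ^ k * abs_level k t j + 2 * k)%N.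
Fixpoint abs_size (k t j : nat) : nat :=
  if j is j'.+1 then (2 ^ k * abs_size k t j' + (abs_dim k t j').+1 ^ k)%N else 0%N.

Lemma abs_level_leS k t j : (abs_level k t j <= abs_level k t j.+1)%N.
Proof.
rewrite /=; have : (0 < 2 ^ k)%N by rewrite expn_gt0.
move: (2 ^ k)%N (abs_level k t j) => a b a0; apply: leq_trans (leq_pmull _ a0).
by apply: leq_trans (leq_addr _ _); rewrite leq_pmull.
Qed.

Lemma abs_size_leS k t j : (abs_size k t j <= abs_size k t j.+1)%N.
Proof. by rewrite /=; apply: leq_trans (leq_addr _ _); rewrite leq_pmull // expn_gt0. Qed.

Section Claim.
Variables (R : realFieldType) (F : finFieldType) (n kk : nat).
Local Notation X := {ffun 'I_kk -> 'rV[F]_n}.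
Local Notation q := (#|F|%:R : R).
Variables (S : {set 'I_kk}) (P : X -> F) (k t : nat).
Hypothesis hP : form S P.
Hypothesis Sk : #|S| = k.
Implicit Types (J I W : {set 'I_kk}).

Lemma qV_mono e e' : (e <= e')%N -> q ^- e' <= q ^- e.
Proof. by move=> h; rewrite lef_pV2 ?posrE ?exprn_gt0 ?q_gt0 // ler_weXn2l // ltW // q_gt1. Qed.

Lemma exists_random tau J : J \proper S -> exists phi : {ffun 'I_kk -> 'M[F]_(tau.+1, n)},
  avg (fun x => fbias R (fun x c => P (mix J x (pt phi c))) x - partial_bias R P J x) <= k%:R * q ^- tau.+1.
Proof.
move=> JS; have D0 := proper_setD0 JS.
have [phi hphi] := avg_exists_le (0 : {ffun 'I_kk -> 'M[F]_(tau.+1, n)})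
  (fun phi => avg (fun x => fbias R (fun x c => P (mix J x (pt phi c))) x - partial_bias R P J x)).
exists phi; apply: le_trans hphi _; rewrite avg_exch -[leRHS](avg_const (0 : X)); apply: ler_avg => x.
rewrite avgB (avg_const (0 : {ffun 'I_kk -> 'M[F]_(tau.+1, n)})) lerBlDl.
apply: le_trans (avg_pt_le R tau (form_fibre J x hP)) _.
rewrite lerD2l; apply: ler_wpM2r; first exact/ltW/qV_gt0.
by rewrite ler_nat -Sk; apply: subset_leq_card; exact: subsetDl.
Qed.

(** The system for J consists of those for J minus I, I non-empty, and of the slices of P along a
    good phi. Where the former vanish, the biases with fewer fixed coordinates are large; where the
    latter vanish, the bias over the random subspaces is 1. These are the assumptions of
    [cube_bound]. *)
Lemma abs_claim : q ^- t <= avg (fun x => psi R (P x)) ->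
  forall j J, (#|J| <= j)%N -> J \proper S -> exists G : seq ({set 'I_kk} * (X -> F)),
  [/\ forall p, p \in G -> [/\ p.1 \subset J, p.1 != set0 & form p.1 p.2],
      (size G <= abs_size k t j)%N &
      forall x, zg G x -> q ^- abs_level k t j <= partial_bias R P J x].
Proof.
move=> hb; elim=> [|j IH] J Jj JS.
  exists [::]; split=> // x _; apply: le_trans hb _; rewrite le_eqVlt; apply/orP; left; apply/eqP.
  apply: eq_avg => w; congr psi; congr P; apply/ffunP => i; rewrite ffunE.
  by move: Jj; rewrite leqn0 cards_eq0 => /eqP ->; rewrite inE.
case: (leqP #|J| j) => hJ.
  have [G [h1 h2 h3]] := IH J hJ JS; exists G; split=> //.
    exact: leq_trans h2 (abs_size_leS _ _ _).
  move=> x /h3; apply: le_trans; apply: qV_mono; exact: abs_level_leS.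
have {hJ Jj} Jj : #|J| = j.+1 by apply/eqP; rewrite eqn_leq Jj hJ.
have J0 : J != set0 by rewrite -card_gt0 Jj.
pose good I (G : seq ({set 'I_kk} * (X -> F))) := I != set0 -> I \subset J ->
  [/\ forall p, p \in G -> [/\ p.1 \subset J :\: I, p.1 != set0 & form p.1 p.2],
      (size G <= abs_size k t j)%N &
      forall x, zg G x -> q ^- abs_level k t j <= partial_bias R P (J :\: I) x].
have /choice[G hG] : forall I, exists G, good I G.
  move=> I; case: (eqVneq I set0) => [I0|I0]; first by exists [::]; rewrite /good I0 eqxx.
  case: (boolP (I \subset J)) => IJ; last by exists [::] => _ h; rewrite h in IJ.
  have [||G hG] := IH (J :\: I); last by exists G.
    rewrite -ltnS -Jj; apply: proper_card; rewrite properEneq subsetDl andbT.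
    have /set0Pn[i iI] := I0; apply/eqP => /setP/(_ i); by rewrite !inE iI (subsetP IJ).
  exact: sub_proper_trans (subsetDl _ _) JS.
pose A := (2 ^ k * abs_level k t j)%N; pose tau := abs_dim k t j.
have [phi hphi] := exists_random tau JS.
pose s' := [seq I <- subs (enum J) | I != set0].
have s'P I : I \in s' -> [/\ I \in subs (enum J), I != set0 & I \subset J].
  rewrite mem_filter => /andP[I0 Is]; split=> //; have := subs_sub Is.
  by rewrite (_ : [set i in enum J] = J) //; apply/setP => i; rewrite inE mem_enum.
have Jk : (#|J| <= k)%N by rewrite -Sk; apply: subset_leq_card; exact: proper_sub.
have N2 : (2 ^ #|J| <= 2 ^ k)%N by rewrite leq_pexp2l.
have ss : (size s' <= 2 ^ k)%N.
  by apply: leq_trans N2; rewrite cardE -size_subs size_filter count_size.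
have eD : S :\: [set i in enum (S :\: J)] = J.
  apply/setP => i; rewrite !inE mem_enum inE negb_and negbK andb_orl andNb orbF.
  by apply: andb_idr => iJ; apply: (subsetP (proper_sub JS)).
exists (flatten (map G s') ++ lay J (slc phi (enum (S :\: J)) P)); split.
- move=> p; rewrite mem_cat => /orP[/flatten_mapP[I /s'P[_ I0 IJ] pG]|/mapP[g gs ->]] /=.
    have [h1 _ _] := hG I I0 IJ; have [h2 h3 h4] := h1 p pG; split=> //.
    exact: subset_trans h2 (subsetDl _ _).
  by split=> //; rewrite -eD; exact: slc_form gs.
- rewrite size_cat; apply: leq_add.
    apply: (@leq_trans (size s' * abs_size k t j)); last by rewrite leq_mul2r ss orbT.
    rewrite size_flatten /shape -map_comp sumnE big_map -sum1_size big_distrl /=.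
    rewrite big_seq [X in (_ <= X)%N]big_seq; apply: leq_sum => I /s'P[_ I0 IJ].
    by rewrite mul1n; have [_ h _] := hG I I0 IJ.
  by rewrite size_map size_slc leq_pexp2l // -cardE -Sk subset_leq_card // subsetDl.
- move=> u; rewrite /zg all_cat => /andP[z1 z2].
  have hz I : I \in s' -> zg (G I) u.
    move=> Is; apply/allP => p pG; apply: (allP z1); apply/flatten_mapP; by exists I.
  have fu : fbias R (fun x c => P (mix J x (pt phi c))) u = 1.
    rewrite -[RHS](avg_const (0 : {ffun 'I_kk -> 'rV[F]_tau.+1})); apply: eq_avg => c.
    have -> : P (mix J u (pt phi c)) = P (mix [set i in enum (S :\: J)] (pt phi c) u).
      apply: (form_dep hP) => i iS; rewrite !ffunE !inE mem_enum inE iS andbT.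
      by case: (i \in J).
    rewrite (slc_zero c hP (enum_uniq _)) ?psi0 //.
      by move=> i; rewrite mem_enum inE => /andP[].
    by move=> Q hQ; apply/eqP; apply: (allP z2 (J, Q)); apply: map_f.
  have ep0 : 0 <= k%:R * q ^- tau.+1 by rewrite mulr_ge0 ?ler0n // ltW // qV_gt0.
  have q2 : 2%:R <= q by rewrite ler_nat card_F_gt1.
  have := cube_bound hP (eta := q ^- A.+1) (delta := q ^- abs_level k t j) JS J0 hphi fu
    (ltW (qV_gt0 _ _ _)) (qV_le1 _ _ _) (ltW (qV_gt0 _ _ _)) ep0.
  move=> h; apply: le_trans (h _ _).
  + rewrite exprVn -exprM; apply: qV_mono; rewrite /= -/A addn1 mulnC.
    by rewrite leq_mul2r N2 orbT.
  + move=> I Is I0; have Is' : I \in s' by rewrite mem_filter I0.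
    have [_ _ IJ] := s'P I Is'; have [_ _ h'] := hG I I0 IJ; exact: h' (hz _ Is').
  have h1 : q ^- A <= (q ^- abs_level k t j) ^+ (2 ^ #|J|).
    by rewrite exprVn -exprM; apply: qV_mono; rewrite /A mulnC leq_mul2r N2 orbT.
  have h2 : (2 ^ #|J|)%:R * (k%:R * q ^- tau.+1) <= q ^- A.+1.
    have -> : tau.+1 = (A.+1 + 2 * k)%N by rewrite /tau /abs_dim -/A.
    rewrite qVD mulrA mulrCA -[leRHS]mulr1; apply: ler_wpM2l; first exact/ltW/qV_gt0.
    rewrite ler_pdivrMr ?exprn_gt0 ?q_gt0 // mul1r -natrM -natrX ler_nat.
    apply: (@leq_trans (2 ^ (2 * k))); last by apply: leq_expl; exact: card_F_gt1.
    rewrite mul2n -addnn expnD; apply: leq_mul => //; exact/ltnW/ltn_expl.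
  have h3 : q ^- A.+1 + q ^- A.+1 <= q ^- A.
    rewrite exprS invfM -mulrDl -[leRHS]mul1r; apply: ler_wpM2r; first exact/ltW/qV_gt0.
    by have : q^-1 <= 2%:R^-1; [rewrite lef_pV2 ?posrE ?q_gt0|lra].
  by rewrite lerBrDr; apply: le_trans h1; apply: le_trans h3; rewrite lerD2l.
Qed.

End Claim.

(** * Rank of biased forms without a tower *)

Section AbsoluteTools.
Variables (R : realFieldType) (F : finFieldType) (n kk : nat).
Local Notation X := {ffun 'I_kk -> 'rV[F]_n}.
Local Notation q := (#|F|%:R : R).
Implicit Types (S I A : {set 'I_kk}) (P : X -> F).

(** Translating x along coordinate i adds a slice of P to P x. Where the slice is nonzero, P is
    nonzero at x or at its translate, so each coordinate costs a factor 2. *)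
Lemma prob_nonzero I P y : form I P -> P y != 0 -> 2%:R ^- #|I| <= avg (fun x => (P x != 0)%:R : R).
Proof.
move e: #|I| => m; elim: m I P y e => [|m IH] I P y.
  move/eqP; rewrite cards_eq0 => /eqP -> hP Py.
  rewrite expr0 invr1 -[leLHS](avg_const (0 : X)); apply: ler_avg => x.
  by rewrite (_ : P x = P y) ?Py //; apply: (form_dep hP) => i; rewrite inE.
move=> e hP Py; have /set0Pn[i iI] : I != set0 by rewrite -card_gt0 e.
have ci : #|I :\ i| = m by move: e; rewrite (cardsD1 i) iI add1n => -[].
have := IH (I :\ i) (fun x => P (upd x i (y i))) y ci (form_slice i _ hP).
rewrite upd_same => /(_ Py) h.
pose z : X := upd 0 i (y i).
have h2 : avg (fun x => (P (upd x i (y i)) != 0)%:R : R) <=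
    avg (fun x => (P x != 0)%:R : R) + avg (fun x => (P x != 0)%:R : R).
  rewrite -[X in _ <= _ + X](avg_shift z) -avgD; apply: ler_avg => x.
  have -> : P (x + z) = P (upd x i (y i)) + P x.
    have -> : P x = P (upd x i (x i)) by rewrite upd_same.
    rewrite -(lin1D _ _ (hP.1 i iI x)); congr P.
    by apply/ffunP => j; rewrite !ffunE; case: eqP => [->|_]; rewrite ?addr0 // addrC.
  case: (P x =P 0) => [->|_]; first by rewrite addr0 add0r.
  case: (_ != 0); case: (_ != 0); rewrite /=; lra.
rewrite exprS invfM; lra.
Qed.

Lemma bias_near_one a S P : form S P -> (#|S| < a)%N -> 1 - 2%:R ^- a <= avg (fun x => psi R (P x)) ->
  forall x, P x = 0.
Proof.
move=> hP Sa hb y; apply/eqP; apply: contraT => Py.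
have h1 := prob_nonzero hP Py.
have h2 : avg (fun x => psi R (P x)) <= 1 - avg (fun x => (P x != 0)%:R : R).
  rewrite -[X in _ <= X - _](avg_const (0 : X)) -avgB; apply: ler_avg => x.
  rewrite /psi; case: eqP => _ /=; first by rewrite subr0.
  by rewrite subrr oppr_le0 invr_ge0 ler0n.
have h3 : 2%:R ^- a < 2%:R ^- #|S| :> R.
  by rewrite ltf_pV2 ?posrE ?exprn_gt0 // ltr_eXn2l // ltr1n.
move: h1 h2 hb h3; set u := avg _; set v := avg _; set w := 2%:R ^- a; lra.
Qed.

(** With a single free coordinate left, P is linear and its bias is 0 or 1. *)
Lemma partial_bias_gt0 S P i x : form S P -> i \in S -> 0 < partial_bias R P (S :\ i) x ->
  forall v, P (upd x i v) = 0.
Proof.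
move=> hP iS; have hl := hP.1 i iS x.
have -> : partial_bias R P (S :\ i) x = [forall v, P (upd x i v) == 0]%:R.
  rewrite -(avg_psi_lin R hl) /partial_bias /fbias (avg_upd i) -[RHS](avg_const (0 : X)).
  apply: eq_avg => w; apply: eq_avg => v; congr psi; apply: (form_dep hP) => j jS.
  by rewrite !ffunE !inE jS andbT; case: eqP.
case: (boolP [forall v, _]) => [/forallP h _ v|]; [exact/eqP|by rewrite ltxx].
Qed.

Lemma form_coord i l : form [set i] (fun x : X => x i 0 l).
Proof. by apply: (form_eq _ (@form_monom F n kk [set i] [ffun=> l])) => x; rewrite /monom big_set1 ffunE. Qed.

Lemma Dec_sumM (U : Type) (s : seq U) (p : pred U) S (A : U -> {set 'I_kk}) (f g : U -> X -> F) :
  (forall t, p t -> [/\ A t != set0, A t \subset S, S :\: A t != set0, form (A t) (f t) & form (S :\: A t) (g t)]) ->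
  exists2 r, (r <= size s)%N & Dec [::] S r (fun x => \sum_(t <- s | p t) f t x * g t x).
Proof.
move=> h; elim: s => [|t s [r rle hr]]; first by exists 0%N => //; apply: DecZ => x; rewrite big_nil.
case: (boolP (p t)) => pt.
  have [h1 h2 h3 h4 h5] := h t pt; exists r.+1 => //; apply: (DecM hr h1 h2 h3 h4 h5) => x.
  by rewrite big_cons pt addrC.
exists r; first exact: leqW.
by apply: Dec_eq hr _ => x; rewrite big_cons (negbTE pt).
Qed.

End AbsoluteTools.

Lemma abs_level_polyb k j : polyb (fun t => abs_level k t j).
Proof.
elim: j => [|j IH] /=; first exact: polyb_id.
apply: polybM; first exact: polyb_cst.
apply: polybD; last exact: polyb_cst.
by apply: polybM => //; exact: polyb_cst.
Qed.

Lemma abs_size_polyb k j : polyb (fun t => abs_size k t j).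
Proof.
elim: j => [|j IH] /=; first exact: polyb_cst.
apply: polybD; first by apply: polybM => //; exact: polyb_cst.
apply: polybX; have [b hb] : polyb (fun t => 1 + abs_dim k t j)%N.
  apply: polybD; first exact: polyb_cst.
  apply: polybD; last exact: polyb_cst.
  by apply: polybM; [exact: polyb_cst|exact: abs_level_polyb].
by exists b.
Qed.

(** For t = 0 a bias this close to 1 forces P = 0. For t > 0, [abs_claim] makes P vanish wherever a
    bounded system on the coordinates other than i0 does. Once that system is regularized, level 0
    on fewer coordinates puts each slice of P at a basis vector of coordinate i0 in its ideal.
    Summing over the basis gives at most one product for each generator. *)
Lemma absolute (R : realFieldType) k :
  (forall k' c h, (k' < k)%N -> exists a, RBR R k' c h a) ->
  exists a, forall (F : finFieldType) n kk (I : {set 'I_kk}), #|I| = k -> I != set0 ->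
    @Rloc R F n kk a [::] I.
Proof.
move=> H; have [a1 H1] := RBR_lt H k (2 ^ k)%N; have [b hb] := regularize a1 k.
have pb : polyb (fun t => b * (abs_size k t k + 1) ^ b)%N.
  apply: polybM; first exact: polyb_cst.
  by apply: polybX; apply: polybD; [exact: abs_size_polyb|exact: polyb_cst].
have [a [ka ha]] := polyb_le k.+1 pb.
exists a => F n kk S Sk S0 t P hP _.
have wf0 : wfg ([::] : seq ({set 'I_kk} * ({ffun 'I_kk -> 'rV[F]_n} -> F))) by [].
rewrite /= (_ : gens [::] = [::]) // dens_nil mulr1.
have -> : beta R [::] P = avg (fun x => psi R (P x)) by apply: eq_avg => x; rewrite mul1r.
case: (posnP t) => [->|t0].
  rewrite /theta eqxx => h; exists 0%N => //; apply: DecZ.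
  by apply: bias_near_one hP _ h; rewrite Sk.
rewrite /theta -[t == 0%N]negbK -lt0n t0 /= => h.
have /set0Pn[i0 i0S] := S0; pose J := S :\ i0.
have JS : J \proper S by rewrite properD1.
have Jk : #|J|.+1 = k by rewrite -Sk (cardsD1 i0 S) i0S.
have [|G [G1 G2 G3]] := abs_claim hP Sk h _ JS (j := k).
  by rewrite -Jk leqnSn.
have van x v : zg G x -> P (upd x i0 v) = 0.
  move=> /G3 h3; apply: (partial_bias_gt0 (R := R) hP i0S); apply: lt_le_trans h3; exact: qV_gt0.
case: (eqVneq J set0) => [J0|J0].
  exists 0%N => //; apply: DecZ => x; rewrite -(upd_same x i0); apply: van.
  case: (G) G1 => // p G' /(_ p); rewrite inE eqxx => /(_ isT)[].
  by rewrite -/J J0 subset0 => ->.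
have subP p : p \in G -> p.1 \in subsets_of S J /\ form p.1 p.2.
  move/G1 => [pJ p0 pf]; split=> //; rewrite mem_subsets_of (sub_proper_trans pJ JS) /=.
  by rewrite (setIidPl pJ).
have [|G' [G'1 G'2 G'3 G'4]] := hb F n kk S J [::] 0%N G Sk subP.
  by case=> [|? ?] ? ? //.
rewrite cat0s in G'3 G'4; set LA := layers_of _ _ in G'3 G'4.
have wfLA : wft LA by exact: layers_of_wft G'1.
pose LA' := subt LA J.
have wfLA' : wft LA' by exact: wft_subt.
have LA'J L : L \in LA' -> L.1 \subset J by rewrite mem_filter => /andP[].
have zG x : zg (gens LA') x -> zg G x.
  rewrite /LA' gens_subt => zx; apply/allP => p pG; apply/eqP.
  have [pJ _ _] := G1 p pG.
  apply: (Dec0_zero ((Dec_subg _ _ _ _).1 (G'4 p pG))).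
  apply/allP => p'; rewrite mem_filter => /andP[p'p p'G]; apply: (allP zx).
  by rewrite mem_filter p'G (subset_trans p'p pJ).
have loc : Rloc R a1 LA' J.
  apply: (H1 #|J|) => //; first by rewrite -Jk.
    by rewrite -Jk; apply: leqW; apply: subset_leq_card; exact: bigcup_seq_sub.
  apply: leq_trans (_ : size LA <= _)%N; first by rewrite size_filter count_size.
  by rewrite size_map -Sk size_subsets_of.
have sl v : Dec (gens LA') J 0 (fun x => P (upd x i0 v)).
  have [|||r rle hr] := loc 0%N (fun x => P (upd x i0 v)).
  - exact: form_slice.
  - exact: regular_subt.
  - rewrite (beta_eq R (P' := fun=> 0)) ?beta0 => [|x /zG zx]; last exact: van.
    rewrite ler_piMl ?dens_ge0 // /theta /= lerBlDr lerDl invr_ge0 exprn_ge0 //.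
  have r0 : r = 0%N by apply/eqP; rewrite -leqn0; move: rle; case: (a1) => [|a']; rewrite ?mul0n ?exp0n ?muln0.
  by rewrite r0 in hr.
have {sl} sl (l : 'I_n) := Dec0_coef (sl (delta_mx 0 l)).
have /choice[Tl hTl] := sl.
pose A j := (nth (set0, fun=> 0) (gens LA') j).1.
pose f j := (nth (set0, fun=> 0) (gens LA') j).2.
pose B (j : 'I_(size (gens LA'))) (x : {ffun 'I_kk -> 'rV[F]_n}) := \sum_(l < n) x i0 0 l * Tl l j x.
have [|r rle hr] := Dec_sumM (index_enum 'I_(size (gens LA'))) (p := fun j => A j \subset J) (S := S) (A := fun j => A j)
   (f := fun j => f j) (g := B).
  move=> j AJ; have [A0 hf] : A j != set0 /\ form (A j) (f j).
    by apply: (wfg_gens wfLA'); rewrite mem_nth.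
  have AS := subset_trans AJ (proper_sub JS).
  have i0A : i0 \notin A j by apply/negP => /(subsetP AJ); rewrite !inE eqxx.
  split=> //; first by apply/set0Pn; exists i0; rewrite inE i0A.
  have -> : S :\: A j = [set i0] :|: (J :\: A j).
    by apply/setP => i; rewrite !inE; case: eqP => // ->; rewrite i0S i0A.
  apply: form_sum => l; have h1 := @form_coord F n kk i0 l; apply: (formM h1 ((hTl l).1 j)).
  by rewrite disjoints1 !inE eqxx andbF.
exists r; last first.
  apply: Dec_eq hr _ => x; rewrite -{3}(upd_same x i0) [x i0]row_sum_delta.
  rewrite (lin1_sum _ _ _ (hP.1 i0 i0S x)).
  transitivity (\sum_(l < n) \sum_(j < size (gens LA') | A j \subset J) f j x * (x i0 0 l * Tl l j x)).
    by rewrite exchange_big; apply: eq_bigr => j _; rewrite mulr_sumr.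
  apply: eq_bigr => l _; rewrite (hTl l).2 mulr_sumr; apply: eq_bigr => j _; rewrite /f; ring.
apply: leq_trans rle _; apply: leq_trans (ha t t0).
rewrite /index_enum -enumT size_enum_ord -/(msz LA'); apply: leq_trans (msz_subt _ _) _.
rewrite msz_layers_of ?uniq_subsets_of //; apply: leq_trans (count_size _ _) _.
apply: leq_trans G'2 _; rewrite leq_mul2l leq_expl ?orbT // leq_add2r.
exact: leq_trans G2 _.
Qed.

(* Lexicographic induction on (k, c, h). *)
Theorem relative_bias_rank (R : realFieldType) k c h : exists a, RBR R k c h a.
Proof.
elim/ltn_ind: k c h => k IHk.
have base : exists a, forall (F : finFieldType) n kk (I : {set 'I_kk}), #|I| = k -> I != set0 ->
    @Rloc R F n kk a [::] I by apply: absolute => k' c h hk; exact: IHk.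
have [a0 ha0] := base.
elim=> [|c IHc].
  move=> h; exists a0 => F n kk I T Ik I0 wf TI; rewrite leqn0 cards_eq0 => /eqP U0 _.
  have -> : T = [::].
    case: T wf TI U0 => // L T wf _; rewrite big_cons => U0.
    have [/set0Pn[i iL] _] := wf L (mem_head _ _).
    by move/setP/(_ i): U0; rewrite !inE iL.
  exact: ha0.
elim=> [|h IHh].
  exists a0 => F n kk I T Ik I0 wf TI _; rewrite leqn0 size_eq0 => /eqP ->; exact: ha0.
apply: RBR_step => //; by move=> k' c' h' hk; exact: IHk.
Qed.

(** * Towers of polynomial functions *)

From mathcomp Require Import complex.

Local Open Scope complex_scope.
Section ComplexAverage.
Variable R : rcfType.
Local Notation C := R[i].
Local Notation nc := (@Normc.normc R).

Lemma normc_ge0 (z : C) : 0 <= nc z.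
Proof. by case: z => a b; exact: sqrtr_ge0. Qed.

Lemma le_normcD (x y : C) : nc (x + y) <= nc x + nc y.
Proof. by rewrite -lecR rmorphD; exact: (ler_normD x y). Qed.

Lemma normc_avg (T : finType) (f : T -> C) : nc (avg f) <= avg (fun x => nc (f x)).
Proof. by rewrite -lecR /avg rmorphM fmorphV rmorph_nat rmorph_sum; exact: (ler_norm_avg f). Qed.

Lemma normc_real (a : R) : 0 <= a -> nc a%:C = a.
Proof. by move=> a0; rewrite /Normc.normc /= expr0n addr0 sqrtr_sqr ger0_norm. Qed.

Lemma avg_complex (T : finType) (f : T -> R) : (avg f)%:C = avg (fun x => (f x)%:C).
Proof. by rewrite /avg rmorphM fmorphV rmorph_nat rmorph_sum. Qed.

Lemma normc_sqr (z : C) : ((nc z) ^+ 2)%:C = z * conjc z.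
Proof. by rewrite -sqr_normc rmorphXn. Qed.

Lemma avg_conj (T : finType) (f : T -> C) : conjc (avg f) = avg (fun x => conjc (f x)).
Proof. by rewrite /avg rmorphM fmorphV rmorph_nat rmorph_sum. Qed.

Lemma normc_avg_sqr (T : finType) (f : T -> C) :
  ((nc (avg f)) ^+ 2)%:C = avg (fun x => avg (fun y => f y * conjc (f x))).
Proof.
rewrite normc_sqr avg_conj -avgZ; apply: eq_avg => x; by rewrite avgZr.
Qed.

End ComplexAverage.

Section CauchySchwarz.
Variable R : realFieldType.

Lemma cauchy_schwarz (T : finType) (w b : T -> R) :
  (avg (fun x => w x * b x)) ^+ 2 <= avg (fun x => w x ^+ 2) * avg (fun x => b x ^+ 2).
Proof.
have : 0 <= avg (fun x => avg (fun y => (w x * b y - w y * b x) ^+ 2)).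
  by apply: avg_ge0 => x; apply: avg_ge0 => y; exact: sqr_ge0.
have -> : avg (fun x => avg (fun y => (w x * b y - w y * b x) ^+ 2)) =
   2%:R * (avg (fun x => w x ^+ 2) * avg (fun x => b x ^+ 2)) - 2%:R * (avg (fun x => w x * b x)) ^+ 2.
  rewrite (eq_avg (g := fun x => avg (fun y => w x ^+ 2 * b y ^+ 2 + w y ^+ 2 * b x ^+ 2 -
     2%:R * (w x * b x) * (w y * b y)))); last by move=> x; apply: eq_avg => y; ring.
  rewrite (eq_avg (g := fun x => w x ^+ 2 * avg (fun y => b y ^+ 2) + avg (fun y => w y ^+ 2) * b x ^+ 2 -
     2%:R * (w x * b x) * avg (fun y => w y * b y))); last first.
    by move=> x; rewrite avgB avgD; congr (_ + _ - _); [exact: avgZ|exact: avgZr|exact: avgZ].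
  set u := avg (fun x => w x ^+ 2); set v := avg (fun x => b x ^+ 2); set z := avg (fun x => w x * b x).
  rewrite avgB avgD; have -> : avg (fun x => w x ^+ 2 * v) = u * v by exact: avgZr.
  have -> : avg (fun x => u * b x ^+ 2) = u * v by exact: avgZ.
  have -> : avg (fun x => 2%:R * (w x * b x) * z) = 2%:R * z * z by rewrite avgZr avgZ.
  ring.
lra.
Qed.

End CauchySchwarz.

(** * Cubes, iterated differences and polar forms *)

Section Cubes.
Variables (F : finFieldType) (n K : nat).
Local Notation V := 'rV[F]_n.
Local Notation X := {ffun 'I_K -> V}.
Implicit Types (s : seq 'I_K) (f : V -> F) (h : X) (Z : V -> bool).

Fixpoint der s f h (x : V) : F :=
  if s is i :: s' then der s' f h (x + h i) - der s' f h x else f x.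

Fixpoint cube s Z h (x : V) : bool :=
  if s is i :: s' then cube s' Z h (x + h i) && cube s' Z h x else Z x.

Definition polar (I : {set 'I_K}) f h := der (enum I) f h 0.

(** The only property of a polynomial of degree d that the counting of cubes uses. *)
Definition pfun d f := forall I : {set 'I_K}, #|I| = d ->
  (forall h x, der (enum I) f h x = polar I f h) /\ form I (polar I f).

Lemma der_eq s f h h' x : (forall i, i \in s -> h i = h' i) -> der s f h x = der s f h' x.
Proof.
elim: s x => //= i s IH x e; rewrite e ?inE ?eqxx // !IH // => j js; apply: e; by rewrite inE js orbT.
Qed.

Lemma cube_eq s Z h h' x : (forall i, i \in s -> h i = h' i) -> cube s Z h x = cube s Z h' x.
Proof.
elim: s x => //= i s IH x e; rewrite e ?inE ?eqxx // !IH // => j js; apply: e; by rewrite inE js orbT.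
Qed.

Lemma cube_subseq s s' Z h x : subseq s' s -> cube s Z h x -> cube s' Z h x.
Proof.
elim: s s' x => [|i s IH] [|j s'] x //=.
  by move=> _ /andP[_ h2]; apply: (IH [::]) => //; exact: sub0seq.
case: eqP => [->|_] ss /andP[h1 h2]; first by rewrite (IH _ _ ss h1) (IH _ _ ss h2).
exact: (IH (j :: s')).
Qed.

Lemma der_cube s f Z h x : (forall y, Z y -> f y = 0) -> cube s Z h x -> der s f h x = 0.
Proof.
by move=> e; elim: s x => [|i s IH] x /=; [exact: e|case/andP=> /IH -> /IH ->; rewrite subrr].
Qed.

Lemma subseq_enum s : subseq s (enum 'I_K) -> enum [set i in s] = s.
Proof.
move=> ss; have us : uniq (enum 'I_K) by exact: enum_uniq.
rewrite [RHS](elimT (subseq_uniqP us) ss) [enum 'I_K]enumT {1}/enum_mem.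
by apply: eq_filter => i; rewrite /= inE.
Qed.

Lemma enum_subseq s (I : {set 'I_K}) : subseq s (enum 'I_K) -> I \subset [set i in s] -> subseq (enum I) s.
Proof.
move=> ss Is; rewrite -[X in subseq _ X](subseq_enum ss) [X in subseq _ X]/enum_mem subseq_filter; apply/andP; split.
  by apply/allP => i; rewrite mem_enum; exact: subsetP.
by rewrite {1}/enum_mem; exact: filter_subseq.
Qed.

End Cubes.

(** * Cauchy-Schwarz along the directions of a cube *)

Section Chain.
Variables (R : rcfType) (F : finFieldType) (n K : nat) (chi : F -> R[i]).
Local Notation V := 'rV[F]_n.
Local Notation X := {ffun 'I_K -> V}.
Local Notation q := (#|F|%:R : R).
Local Notation nc := (@Normc.normc R).
Hypothesis chi0 : chi 0 = 1.
Hypothesis chiD : forall a b, chi (a + b) = chi a * chi b.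
Hypothesis chiJ : forall a, conjc (chi a) = chi (- a).
Implicit Types (s : seq 'I_K) (h : X).

Lemma normc_chi a : nc (chi a) = 1.
Proof.
have : ((nc (chi a)) ^+ 2)%:C = 1 :> R[i] by rewrite normc_sqr chiJ -chiD subrr chi0.
move=> [/eqP]; rewrite -subr_eq0 -[X in _ - X](expr1n R 2) subr_sqr mulf_eq0 subr_eq0 => /orP[/eqP //|].
by rewrite gt_eqF // ltr_wpDl // normc_ge0.
Qed.

Section Fixed.
Variables (Z : V -> bool) (f : V -> F).

Definition corr s h : R[i] := avg (fun x => (cube s Z h x)%:R * chi (der s f h x)).

(** The squared modulus is a double average over x and y; the difference of y and x becomes the new
    direction. *)
Lemma corr_upd i s h : i \notin s ->
  avg (fun v => corr (i :: s) (upd h i v)) = ((nc (corr s h)) ^+ 2)%:C.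
Proof.
move=> si; rewrite normc_avg_sqr [LHS]avg_exch; apply: eq_avg => x.
pose a y := (cube s Z h y)%:R * chi (der s f h y).
have es j v : j \in s -> upd h i v j = h j by move=> js; rewrite ffunE; case: eqP => // e; rewrite -e js in si.
rewrite (eq_avg (g := fun v => a (v + x) * conjc (a x))) => [|v].
  apply: (@avg_bij _ _ _ (fun v => v + x) (fun y => a y * conjc (a x))).
  by exists (fun v => v - x) => v; rewrite ?addrK ?subrK.
rewrite /= !(cube_eq _ _ (fun j js => es j v js)) !(der_eq _ _ (fun j js => es j v js)) updE addrC.
have -> : conjc (a x) = (cube s Z h x)%:R * chi (- der s f h x).
  by rewrite /a; have := chiJ (der s f h x) => <-; rewrite rmorphM rmorph_nat.
by rewrite /a -mulnb natrM chiD; ring.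
Qed.

Lemma avg_corr i s : i \notin s -> avg (corr (i :: s)) = (avg (fun h => (nc (corr s h)) ^+ 2))%:C.
Proof.
by move=> si; rewrite (avg_upd i) avg_complex; apply: eq_avg => h; exact: corr_upd.
Qed.

Lemma avg_corr_sqr_le s (w : X -> bool) : (forall h x, cube s Z h x -> w h) ->
  (avg (fun h => nc (corr s h))) ^+ 2 <= avg (fun h => (w h)%:R) * avg (fun h => (nc (corr s h)) ^+ 2).
Proof.
move=> hw; have e h : (w h)%:R * nc (corr s h) = nc (corr s h).
  case: (boolP (w h)) => wh; rewrite ?mul1r // mul0r.
  rewrite /corr /avg big1 ?mulr0 ?Normc.normc0 // => x _.
  case: (boolP (cube s Z h x)) => [/hw|]; first by rewrite (negbTE wh).
  by rewrite mul0r.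
rewrite -(eq_avg e); apply: le_trans (cauchy_schwarz _ _) _; rewrite le_eqVlt; apply/orP; left; apply/eqP.
by congr (_ * _); apply: eq_avg => h; case: (w h); rewrite ?expr1n ?expr0n.
Qed.

Lemma avg_sqr_corr_le i s : i \notin s ->
  avg (fun h => (nc (corr s h)) ^+ 2) <= avg (fun h => nc (corr (i :: s) h)).
Proof.
move=> si; apply: le_trans (normc_avg (corr (i :: s))); rewrite (avg_corr si) normc_real //.
by apply: avg_ge0 => h; exact: sqr_ge0.
Qed.

End Fixed.

Definition cube_count Z s h : R := avg (fun x => (cube s Z h x)%:R).

Lemma corr_zero Z s h : corr Z (fun=> 0) s h = (cube_count Z s h)%:C.
Proof.
rewrite /cube_count avg_complex; apply: eq_avg => x.
have -> : der s (fun=> 0 : F) h x = 0 by elim: s x => //= i s IH x; rewrite !IH subrr.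
by rewrite chi0 mulr1 rmorph_nat.
Qed.

Lemma cube_count_ge0 Z s h : 0 <= cube_count Z s h.
Proof. by apply: avg_ge0 => x; rewrite ler0n. Qed.

Lemma normc_corr_zero Z s h : nc (corr Z (fun=> 0) s h) = cube_count Z s h.
Proof. by rewrite corr_zero normc_real // cube_count_ge0. Qed.

(** One use of Cauchy-Schwarz: x is an average over cubes, y one with a further direction, D the
    density of the admissible directions. *)
Lemma chain_ineq (x y D p P P' a b delta : R) : 0 <= a -> 0 < p -> 0 <= P -> 0 <= y -> 0 <= P' -> 0 <= delta ->
  a * P <= x -> x ^+ 2 <= D * y -> D <= (1 + delta) * p -> b * (1 + delta) <= a ^+ 2 ->
  P ^+ 2 = p * P' -> b * P' <= y.
Proof.
move=> a0 p0 P0 y0 P'0 d0 h1 h2 h3 h4 e.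
have d1 : 0 < 1 + delta by rewrite ltr_wpDr.
rewrite -(ler_pM2l p0) -(ler_pM2l d1).
have h5 : (a * P) ^+ 2 <= x ^+ 2 by rewrite lerXn2r ?nnegrE ?mulr_ge0 // (le_trans _ h1) ?mulr_ge0.
have h6 : D * y <= (1 + delta) * p * y by rewrite ler_wpM2r.
have h7 : b * (1 + delta) * (p * P') <= a ^+ 2 * (p * P') by rewrite ler_wpM2r // mulr_ge0 // ltW.
rewrite exprMn e in h5; have h8 := le_trans h7 (le_trans h5 (le_trans h2 h6)).
have -> : (1 + delta) * (p * (b * P')) = b * (1 + delta) * (p * P') by ring.
by rewrite [leRHS]mulrA.
Qed.

(** Cauchy-Schwarz doubles the exponent, and the extra unit absorbs 1 + delta, which is at most
    q. *)
Fixpoint chain_level (t j : nat) : nat := if j is j'.+1 then (2 * chain_level t j').+1 else t.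

(** [w s] is a condition on the directions that every cube forces; [mu j] counts such conditions,
    [nu j] those on whole j-dimensional cubes. [hnu] reflects that a cube of dimension j + 1 is a
    pair of j-dimensional cubes with the same directions. *)
Variables (Z : V -> bool) (w : seq 'I_K -> X -> bool) (mu nu : nat -> nat) (delta : R).
Hypothesis hw : forall s h x, subseq s (enum 'I_K) -> cube s Z h x -> w s h.
Hypothesis hnu : forall j, (nu j.+1 + mu j = 2 * nu j)%N.
Hypothesis hD : forall s, subseq s (enum 'I_K) -> avg (fun h => (w s h)%:R) <= (1 + delta) * q ^- mu (size s).
Hypothesis delta0 : 0 <= delta.
Hypothesis delta1 : delta <= 1.

Lemma nu_qV j : (q ^- nu j) ^+ 2 = q ^- mu j * q ^- nu j.+1.
Proof. by rewrite expr2 -!qVD addnC hnu mul2n -addnn. Qed.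

Lemma subseq_cons i s : subseq (i :: s) (enum 'I_K) -> subseq s (enum 'I_K) /\ i \notin s.
Proof.
move=> ss; split; first by apply: subseq_trans ss; exact: subseq_cons.
by have := subseq_uniq ss (enum_uniq _) => /= /andP[].
Qed.

Lemma avg_count_ge s : subseq s (enum 'I_K) -> 3%:R ^+ size s * delta <= 1 ->
  (1 - delta) * q ^- nu 0 <= avg (fun x => (Z x)%:R) ->
  (1 - 3%:R ^+ size s * delta) * q ^- nu (size s) <= avg (cube_count Z s).
Proof.
move=> + + h0; elim: s => [|i s IH] ss.
  by move=> _; rewrite mul1r; apply: le_trans h0 _; rewrite -[X in X <= _](avg_const (0 : X)).
have [ss' si] := subseq_cons ss; move=> hd.
have p3 : 1 <= 3%:R ^+ size s :> R by rewrite exprn_ege1 // ler1n.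
have hd' : 3%:R ^+ size s * delta <= 1.
  by apply: le_trans hd; rewrite ler_wpM2r //= exprS ler_peMl ?exprn_ge0 // ler1n.
apply: (chain_ineq (x := avg (cube_count Z s)) (D := avg (fun h => (w s h)%:R)) (a := 1 - 3%:R ^+ size s * delta)
  (p := q ^- mu (size s)) (P := q ^- nu (size s)) (delta := delta)) => //.
- by rewrite subr_ge0.
- exact: qV_gt0.
- exact/ltW/qV_gt0.
- by apply: avg_ge0 => h; exact: cube_count_ge0.
- exact/ltW/qV_gt0.
- exact: IH.
- have := @avg_corr_sqr_le Z (fun=> 0) s (w s) (fun h x => @hw s h x ss').
  rewrite !(eq_avg (fun h => normc_corr_zero Z s h)) => h; apply: le_trans h _.
  apply: ler_wpM2l; first by apply: avg_ge0 => h; rewrite ler0n.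
  apply: le_trans (avg_sqr_corr_le Z (fun=> 0) si) _.
  by rewrite le_eqVlt; apply/orP; left; apply/eqP/eq_avg => h; exact: normc_corr_zero.
- exact: hD.
- rewrite /= exprS; set u := 3%:R ^+ size s in p3 hd' *.
  have : 0 <= (u - 1) * delta by rewrite mulr_ge0 // subr_ge0.
  have : 0 <= u * delta * delta by rewrite !mulr_ge0 // (le_trans _ p3).
  have := sqr_ge0 (u * delta); rewrite !expr2; nra.
- exact: nu_qV.
Qed.

Lemma avg_corr_ge f t s : subseq s (enum 'I_K) ->
  q ^- t * q ^- nu 0 <= nc (avg (fun x => (Z x)%:R * chi (f x))) ->
  q ^- chain_level t (size s) * q ^- nu (size s) <= avg (fun h => nc (corr Z f s h)).
Proof.
move=> + h0; elim: s => [|i s IH] ss.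
  by apply: le_trans h0 _; rewrite -[X in X <= _](avg_const (0 : X)).
have [ss' si] := subseq_cons ss.
apply: (chain_ineq (x := avg (fun h => nc (corr Z f s h))) (D := avg (fun h => (w s h)%:R))
  (a := q ^- chain_level t (size s))
  (p := q ^- mu (size s)) (P := q ^- nu (size s)) (delta := delta)) => //.
- exact/ltW/qV_gt0.
- exact: qV_gt0.
- exact/ltW/qV_gt0.
- by apply: avg_ge0 => h; exact: normc_ge0.
- exact/ltW/qV_gt0.
- exact: IH.
- have := @avg_corr_sqr_le Z f s (w s) (fun h x => @hw s h x ss').
  move=> h; apply: le_trans h _; apply: ler_wpM2l; first by apply: avg_ge0 => h; rewrite ler0n.
  exact: avg_sqr_corr_le.
- exact: hD.
- rewrite /= -addn1 mul2n -addnn !qVD expr2; set y := q ^- chain_level _ _.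
  have y0 : 0 < y by exact: qV_gt0.
  have q1 : q ^- 1 * (1 + delta) <= 1.
    rewrite expr1 mulrC ler_pdivrMr ?q_gt0 // mul1r; apply: (@le_trans _ _ 2%:R); first by move: delta1; lra.
    by rewrite ler_nat card_F_gt1.
  by rewrite -[leLHS]mulrA -[leRHS]mulr1; apply: ler_wpM2l => //; rewrite mulr_ge0 // ltW.
- exact: nu_qV.
Qed.

(* Cauchy-Schwarz against the second moment of [cube_count], which is known from the number of cubes of one dimension more. *)
Lemma bias_polar f p t i j s : subseq (i :: j :: s) (enum 'I_K) ->
  (forall h x, der (j :: s) f h x = p h) ->
  3%:R ^+ (size s).+1 * delta <= 1 ->
  (1 + delta) * (2%:R + 2%:R * 3%:R ^+ (size s).+1) * delta <= (q ^- (chain_level t (size s).+1).+1) ^+ 2 ->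
  (1 - delta) * q ^- nu 0 <= avg (fun x => (Z x)%:R) ->
  avg (cube_count Z (i :: j :: s)) <= (1 + delta) * q ^- nu (size s).+2 ->
  q ^- t * q ^- nu 0 <= nc (avg (fun x => (Z x)%:R * chi (f x))) ->
  q ^- (chain_level t (size s).+1).+1 * q ^- mu (size s).+1 <=
    nc (avg (fun h => (w (j :: s) h)%:R * chi (p h))).
Proof.
move=> ss hp hd hd2 h0 hc hb; set L := chain_level t _; set m := mu _; set v := nu (size s).+1.
have [ss1 si1] := subseq_cons ss; have [ss2 si2] := subseq_cons ss1.
pose N h := cube_count Z (j :: s) h; pose W h : R := (w (j :: s) h)%:R.
(* The expected number of cubes for directions satisfying w. *)
pose c : R := q ^- v * q ^+ m.
have qm : 0 < q ^+ m by rewrite exprn_gt0 // q_gt0.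
have c0 : 0 < c by rewrite mulr_gt0 // qV_gt0.
have ec : c * q ^- m = q ^- v by rewrite /c -mulrA divff ?mulr1 // gt_eqF.
have main : q ^- L * q ^- v <= nc (avg (corr Z f (j :: s))).
  rewrite (avg_corr Z f si2) normc_real; last by apply: avg_ge0 => h; exact: sqr_ge0.
  have := avg_corr_ge ss2 hb; set x := avg _ => hx.
  have := @avg_corr_sqr_le Z f s (w s) (fun h x => @hw s h x ss2); rewrite -/x => hx2.
  apply: (chain_ineq (x := x) (D := avg (fun h => (w s h)%:R)) (a := q ^- chain_level t (size s))
     (p := q ^- mu (size s)) (P := q ^- nu (size s)) (delta := delta)) => //.
  - exact/ltW/qV_gt0.
  - exact: qV_gt0.
  - exact/ltW/qV_gt0.
  - by apply: avg_ge0 => h; exact: sqr_ge0.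
  - exact/ltW/qV_gt0.
  - exact: hD.
  - rewrite /L /= -addn1 mul2n -addnn !qVD expr2; set y := q ^- chain_level _ _.
    have y0 : 0 < y by exact: qV_gt0.
    have q1 : q ^- 1 * (1 + delta) <= 1.
      rewrite expr1 mulrC ler_pdivrMr ?q_gt0 // mul1r; apply: (@le_trans _ _ 2%:R); first by move: delta1; lra.
      by rewrite ler_nat card_F_gt1.
    by rewrite -[leLHS]mulrA -[leRHS]mulr1; apply: ler_wpM2l => //; rewrite mulr_ge0 // ltW.
  - exact: nu_qV.
have WN h : W h * N h = N h.
  rewrite /W; case: (boolP (w _ _)) => wh; rewrite ?mul1r // mul0r /N /cube_count /avg big1 ?mulr0 // => x _.
  by case: (boolP (cube _ _ _ _)) => [/(hw ss1)|//]; rewrite (negbTE wh).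
have W2 h : W h ^+ 2 = W h by rewrite /W; case: (w _ _); rewrite ?expr1n ?expr0n.
pose Dl := avg (fun h => W h * `|N h - c|).
(* The second moment of N is the density of cubes with the further direction i, and [avg_count_ge]
   bounds its mean from below; so N is close to c in mean square where w holds. *)
have Dl2 : Dl ^+ 2 <= (1 + delta) * (2%:R + 2%:R * 3%:R ^+ (size s).+1) * delta * (q ^- v) ^+ 2.
  have e2 : avg (fun h => (W h * (N h - c)) ^+ 2) <= (2%:R + 2%:R * 3%:R ^+ (size s).+1) * delta * (c ^+ 2 * q ^- m).
    have -> : avg (fun h => (W h * (N h - c)) ^+ 2) = avg (fun h => N h ^+ 2) - 2%:R * c * avg N + c ^+ 2 * avg W.
      rewrite -!avgZ -avgB -avgD; apply: eq_avg => h; rewrite exprMn W2.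
      by rewrite -[in RHS](WN h) exprMn W2; ring.
    have eN : avg (fun h => N h ^+ 2) <= (1 + delta) * (c ^+ 2 * q ^- m).
      have -> : c ^+ 2 * q ^- m = q ^- nu (size s).+2.
        have := nu_qV (size s).+1; rewrite -/v -/m => e.
        rewrite expr2 -mulrA ec /c mulrC mulrA -expr2 e mulrAC mulVf ?mul1r //; exact: lt0r_neq0.
      apply: le_trans hc; have := avg_corr Z (fun=> 0) si1.
      rewrite (eq_avg (fun h => corr_zero Z (i :: j :: s) h)) -avg_complex => -[->].
      by rewrite le_eqVlt; apply/orP; left; apply/eqP/eq_avg => h; rewrite normc_corr_zero.
    have hN : (1 - 3%:R ^+ (size s).+1 * delta) * (c * q ^- m) <= avg N by rewrite ec; exact: avg_count_ge ss1 hd h0.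
    have hW : avg W <= (1 + delta) * q ^- m by exact: hD ss1.
    have hN' : c * ((1 - 3%:R ^+ (size s).+1 * delta) * (c * q ^- m)) <= c * avg N by rewrite ler_pM2l.
    have hW' : c ^+ 2 * avg W <= c ^+ 2 * ((1 + delta) * q ^- m) by rewrite ler_pM2l ?exprn_gt0.
    move: eN hN' hW'; set a1 := avg _; set a2 := avg N; set a3 := avg W; set u := 3%:R ^+ _; set z := q ^- m.
    rewrite !expr2 => *; lra.
  have -> : Dl = avg (fun h => W h * (W h * `|N h - c|)).
    by apply: eq_avg => h; rewrite mulrA -expr2 W2.
  apply: le_trans (cauchy_schwarz _ _) _.
  rewrite (eq_avg W2) [X in _ * X <= _](eq_avg (g := fun h => (W h * (N h - c)) ^+ 2)); last first.
    by move=> h; rewrite /= !exprMn real_normK // num_real.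
  have W0 : 0 <= avg W by apply: avg_ge0 => h; rewrite ler0n.
  apply: le_trans (ler_pM W0 _ (hD ss1) e2) _; first by apply: avg_ge0 => h; exact: sqr_ge0.
  rewrite -ec le_eqVlt; apply/orP; left; apply/eqP; rewrite -/m; ring.
have Dl0 : 0 <= Dl by apply: avg_ge0 => h; rewrite mulr_ge0 ?ler0n.
have {Dl2} Dl1 : Dl <= q ^- L.+1 * q ^- v.
  have r0 : 0 <= q ^- L.+1 * q ^- v by apply: mulr_ge0; exact/ltW/qV_gt0.
  rewrite -(ler_pXn2r (n := 2)) ?nnegrE //.
  apply: le_trans Dl2 _; rewrite [in leRHS]exprMn; apply: ler_wpM2r => //; exact: sqr_ge0.
pose B := avg (fun h => (w (j :: s) h)%:R * chi (p h)).
have eB : avg (corr Z f (j :: s)) = c%:C * B + avg (fun h => (W h * (N h - c))%:C * chi (p h)).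
  rewrite -avgZ -avgD; apply: eq_avg => h; have -> : corr Z f (j :: s) h = (N h)%:C * chi (p h).
    by rewrite /N /cube_count avg_complex -avgZr; apply: eq_avg => x; rewrite hp rmorph_nat.
  have eW : (W h * c)%:C = (w (j :: s) h)%:R * c%:C by rewrite -(rmorph_nat (real_complex R)) -rmorphM.
  by rewrite mulrBr WN rmorphB /= eW; ring.
have h3 : nc (avg (fun h => (W h * (N h - c))%:C * chi (p h))) <= Dl.
  apply: le_trans (normc_avg _) _; apply: ler_avg => h.
  rewrite Normc.normcM normc_chi mulr1 /Normc.normc /= expr0n addr0 sqrtr_sqr normrM ger0_norm ?ler0n //.
have h4 : q ^- L * q ^- v <= c * nc B + Dl.
  apply: le_trans main _; rewrite eB; apply: le_trans (le_normcD _ _) _.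
  by rewrite Normc.normcM normc_real ?(ltW c0) // lerD2l.
have h5 : q ^- L.+1 + q ^- L.+1 <= q ^- L.
  rewrite exprS invfM -mulrDl -[leRHS]mul1r; apply: ler_wpM2r; first exact/ltW/qV_gt0.
  have : q^-1 <= 2%:R^-1 by rewrite lef_pV2 ?posrE ?q_gt0 // ler_nat card_F_gt1.
  lra.
rewrite -(ler_pM2l c0) mulrCA ec.
have h6 : (q ^- L.+1 + q ^- L.+1) * q ^- v <= q ^- L * q ^- v by rewrite ler_wpM2r // ltW // qV_gt0.
by move: h6 h4 Dl1; rewrite mulrDl -/B; set a1 := q ^- L.+1 * _; set a2 := c * _; lra.
Qed.

End Chain.

Lemma sum_bin_pascal d j :
  (\sum_(l < d.+1) 'C(j.+1, l) + 'C(j, d) = 2 * \sum_(l < d.+1) 'C(j, l))%N.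
Proof.
elim: d => [|d IH]; first by rewrite !big_ord_recr !big_ord0 /= !bin0.
have e j' : (\sum_(l < d.+2) 'C(j', l) = \sum_(l < d.+1) 'C(j', l) + 'C(j', d.+1))%N by rewrite big_ord_recr.
rewrite !e mulnDr -IH binS; move: (\sum_(l < d.+1) _)%N => a; lia.
Qed.

Lemma card_subsets_le (T : finType) (B : {set T}) d :
  #|[set A : {set T} | A \subset B & (#|A| <= d)%N]| = (\sum_(l < d.+1) 'C(#|B|, l))%N.
Proof.
elim: d => [|d IH].
  rewrite big_ord_recr big_ord0 /= add0n -cards_draws; apply: eq_card => A.
  by rewrite !inE leqn0.
rewrite big_ord_recr /= -IH -cards_draws.
rewrite (_ : [set A : {set T} | A \subset B & (#|A| <= d.+1)%N] =
   [set A : {set T} | A \subset B & (#|A| <= d)%N] :|: [set A : {set T} | A \subset B & #|A| == d.+1]).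
  rewrite cardsU (_ : _ :&: _ = set0) ?cards0 ?subn0 //.
  by apply/setP => A; rewrite !inE; case: eqP => [->|]; rewrite ?ltnn ?andbF.
by apply/setP => A; rewrite !inE -andb_orr leq_eqVlt ltnS orbC.
Qed.

(** * Polar towers and numbers of conditions *)

Section FunctionTowers.
Variables (F : finFieldType) (K : nat).

Section OneSpace.
Variable n : nat.
Local Notation V := 'rV[F]_n.
Local Notation X := {ffun 'I_K -> V}.
Local Notation ftower := (seq (nat * seq (V -> F))).
Local Notation tower := (seq ({set 'I_K} * seq (X -> F))).
Implicit Types (Tw : ftower) (L : nat * seq (V -> F)).

Definition zf Tw x := all (fun L => all (fun f => f x == 0) L.2) Tw.
Definition fsz Tw := \sum_(L <- Tw) size L.2.
Definition slots (e : nat) : seq {set 'I_K} := enum [set I : {set 'I_K} | #|I| == e].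
Definition idx Tw : seq ((nat * seq (V -> F)) * {set 'I_K}) :=
  flatten [seq [seq (L, J) | J <- slots L.1] | L <- Tw].
Definition polar_layer (p : (nat * seq (V -> F)) * {set 'I_K}) : {set 'I_K} * seq (X -> F) :=
  (p.2, [seq polar p.2 f | f <- p.1.2]).
Definition ptw Tw : tower := [seq polar_layer p | p <- idx Tw].
Definition goodtw Tw := forall L, L \in Tw ->
  [/\ (0 < L.1)%N, (L.1 < K)%N & forall f, f \in L.2 -> pfun K L.1 f].
Definition mu_of Tw (j : nat) := (\sum_(L <- Tw) size L.2 * 'C(j, L.1))%N.
(** On a j-dimensional cube, a function of degree d is determined by its values at the vertices with
    at most d directions. *)
Definition nu_of Tw (j : nat) := (\sum_(L <- Tw) size L.2 * \sum_(l < L.1.+1) 'C(j, l))%N.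

Lemma mem_slots e I : (I \in slots e) = (#|I| == e).
Proof. by rewrite mem_enum inE. Qed.

Lemma idx_cat Tw Tw' : idx (Tw ++ Tw') = idx Tw ++ idx Tw'.
Proof. by rewrite /idx map_cat flatten_cat. Qed.

Lemma ptw_cat Tw Tw' : ptw (Tw ++ Tw') = ptw Tw ++ ptw Tw'.
Proof. by rewrite /ptw idx_cat map_cat. Qed.

Lemma mem_idx Tw p : p \in idx Tw -> p.1 \in Tw /\ #|p.2| = p.1.1.
Proof. by case/flatten_mapP => L LT /mapP[I]; rewrite mem_slots => /eqP e ->. Qed.

Lemma nu_mu Tw j : (nu_of Tw j.+1 + mu_of Tw j = 2 * nu_of Tw j)%N.
Proof.
rewrite /nu_of /mu_of -big_split /= big_distrr /=; apply: eq_bigr => L _.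
by rewrite -mulnDr sum_bin_pascal mulnCA.
Qed.

Lemma nu_of0 Tw : nu_of Tw 0 = fsz Tw.
Proof.
apply: eq_bigr => L _; rewrite big_ord_recl /= bin0 big1 ?addn0 ?muln1 // => l _; by rewrite bin0n.
Qed.

Lemma msz_subt_ptw Tw (J : {set 'I_K}) : msz (subt (ptw Tw) J) = mu_of Tw #|J|.
Proof.
rewrite /mu_of; elim: Tw => [|L Tw IH]; first by rewrite big_nil.
rewrite -cat1s ptw_cat /subt filter_cat msz_cat big_cons -IH; congr addn.
rewrite /ptw /idx /= cats0 -map_comp filter_map.
have key (us : seq {set 'I_K}) : msz (map (polar_layer \o pair L) (filter (fun I : {set 'I_K} => I \subset J) us)) =
    (size L.2 * count (fun I : {set 'I_K} => I \subset J) us)%N.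
  elim: us => [|I us IHu]; first by rewrite muln0.
  by rewrite /=; case: ifP => _; rewrite /= ?msz_cons ?size_map IHu mulnDr ?muln1 // muln0.
rewrite [filter _ _](eq_filter (a2 := fun I : {set 'I_K} => I \subset J)) // key; congr muln.
rewrite -size_filter -cards_draws cardE /slots /enum_mem -filter_predI; congr size.
by apply: eq_filter => I; rewrite /= !inE andbC.
Qed.

Lemma wft_ptw Tw : goodtw Tw -> wft (ptw Tw).
Proof.
move=> g L' /mapP[[L I] /mem_idx /= [LT cI] ->]; have [L0 LK pf] := g L LT; split=> /=.
  by rewrite -card_gt0 cI.
by move=> f' /mapP[f fL ->]; have [] := pf f fL I cI.
Qed.

Lemma size_ptw Tw : (size (ptw Tw) <= size Tw * 2 ^ K)%N.
Proof.
rewrite size_map; elim: Tw => [|L Tw IH] //; rewrite -cat1s idx_cat !size_cat mulnDl; apply: leq_add => //.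
rewrite /= addn0 mul1n size_map /slots -cardE -[K in (2 ^ K)%N]card_ord -cardsT -card_powerset.
by apply: subset_leq_card; apply/subsetP => A _; rewrite powersetE subsetT.
Qed.

Lemma cube_polar Tw (s : seq 'I_K) h x : goodtw Tw -> subseq s (enum 'I_K) ->
  cube s (zf Tw) h x -> zg (gens (subt (ptw Tw) [set i in s])) h.
Proof.
move=> g ss hc; apply/allP => p /mem_gens[L']; rewrite mem_filter => /andP[LJ /mapP[[L I] /mem_idx /= [LT cI] eL]].
rewrite eL /= in LJ *; case/mapP => f' /mapP[f fL ->] -> /=.
have [_ _ pf] := g L LT; have [hc' _] := pf f fL I cI.
rewrite -(hc' h x) (@der_cube F n K (enum I) f (zf Tw)) //.
  by move=> y /allP/(_ L LT)/allP/(_ f fL)/eqP.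
by apply: cube_subseq hc; exact: enum_subseq.
Qed.

Lemma cube_vertex (s : seq 'I_K) (Z : V -> bool) (h : X) x (w : {set 'I_K}) : uniq s -> w \subset [set i in s] ->
  cube s Z h x -> Z (x + \sum_(i in w) h i).
Proof.
elim: s w x => [|i s IH] w x /=.
  move=> _ ws; rewrite big1 ?addr0 // => i /(subsetP ws); by rewrite inE.
case/andP=> si us ws /andP[h1 h2]; case: (boolP (i \in w)) => iw.
  rewrite (big_setD1 i) //= addrA; apply: IH => //.
  apply/subsetP => j; rewrite !inE => /andP[ji /(subsetP ws)]; by rewrite !inE (negbTE ji).
apply: IH => //; apply/subsetP => j jw; have := subsetP ws j jw; rewrite !inE.
by case: eqP => // e; rewrite -e jw in iw.
Qed.

Lemma der_sum (T : Type) (r : seq T) (c : T -> F) (f : T -> V -> F) s h x :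
  der s (fun x => \sum_(t <- r) c t * f t x) h x = \sum_(t <- r) c t * @der F n K s (f t) h x.
Proof.
elim: s x => //= i s IH x; rewrite !IH -sumrB; apply: eq_bigr => t _; by rewrite mulrBr.
Qed.

Lemma pfun_sum (T : Type) (r : seq T) (c : T -> F) (f : T -> V -> F) d :
  (forall t, pfun K d (f t)) -> pfun K d (fun x => \sum_(t <- r) c t * f t x).
Proof.
move=> h I cI; split=> [y x|].
  by rewrite /polar !der_sum; apply: eq_bigr => t _; have [-> _] := h t I cI.
apply: (form_eq (f := fun y => \sum_(t <- r) c t * polar I (f t) y)).
  by move=> y; rewrite /polar der_sum.
by apply: form_sum => t; apply: formZ; have [] := h t I cI.
Qed.

End OneSpace.

Lemma der_lin n1 n2 (L : 'rV[F]_n1 -> 'rV[F]_n2) s f h x : linear L ->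
  der s (fun w => f (L w)) h x = @der F n2 K s f (cmap (fun=> L) h) (L x).
Proof.
move=> hL; have hD u v : L (u + v) = L u + L v by have := hL 1 u v; rewrite !scale1r.
by elim: s x => //= i s IH x; rewrite !IH hD ffunE.
Qed.

Lemma polar_lin n1 n2 (L : 'rV[F]_n1 -> 'rV[F]_n2) I f h : linear L ->
  polar I (fun w => f (L w)) h = @polar F n2 K I f (cmap (fun=> L) h).
Proof.
move=> hL; rewrite /polar der_lin //; congr (der _ _ _ _).
by have := hL (-1) 0 0; rewrite scaler0 addr0 scaleN1r addNr.
Qed.

Lemma pfun_lin n1 n2 (L : 'rV[F]_n1 -> 'rV[F]_n2) d f : linear L -> pfun K d f ->
  pfun K d (fun w => f (L w)).
Proof.
move=> hL pf I cI; have [h1 h2] := pf I cI; split=> [h x|].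
  by rewrite der_lin // polar_lin // h1.
apply: (form_eq (f := fun h => polar I f (cmap (fun=> L) h))); first by move=> h; apply/esym/polar_lin.
exact: form_cmap.
Qed.

End FunctionTowers.

(** * The tower of values at the vertices of a cube *)

Section CubeTower.
Variables (R : realFieldType) (F : finFieldType) (K n : nat).
Local Notation V := 'rV[F]_n.
Local Notation W := 'rV[F]_(K.+1 * n).
Local Notation X := {ffun 'I_K -> V}.
Local Notation ftower := (seq (nat * seq (V -> F))).
Implicit Types (Tw : ftower) (L : nat * seq (V -> F)) (om I J : {set 'I_K}) (s : seq 'I_K).

(** A vector w packs a base point, in row 0, and K directions, so that cubes become points of a
    single space. *)
Definition vtx om (w : W) : V :=
  row ord0 (vec_mx w) + \sum_(i in om) row (lift ord0 i) (vec_mx w).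

Lemma vtx_linear om : linear (vtx om).
Proof.
move=> a u v; rewrite /vtx !linearP /= scalerDr scaler_sumr addrACA -big_split /=; congr (_ + _).
by apply: eq_bigr => i _; rewrite linearP.
Qed.

(** Cubes satisfy the conditions at these vertices, which is enough for an upper bound on their
    number; the restriction to at most d directions keeps the conditions independent, see
    [regular_ctw]. *)
Definition vertices s (d : nat) : seq {set 'I_K} :=
  enum [set om : {set 'I_K} | om \subset [set i in s] & (#|om| <= d)%N].
Definition vertex_index s L := [seq (i, om) | i <- iota 0 (size L.2), om <- vertices s L.1].
Definition vertex_layer s L : nat * seq (W -> F) :=
  (L.1, [seq (fun w => nth (fun=> 0) L.2 p.1 (vtx p.2 w)) | p <- vertex_index s L]).
Definition ctw s Tw := map (vertex_layer s) Tw.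

Lemma size_vertices s d : uniq s -> size (vertices s d) = (\sum_(l < d.+1) 'C(size s, l))%N.
Proof. by move=> us; rewrite -cardE card_subsets_le cardsE (card_uniqP us). Qed.

Lemma size_vertices_le s d : (size (vertices s d) <= 2 ^ K)%N.
Proof.
rewrite /vertices -cardE -[K in (2 ^ K)%N]card_ord -cardsT -card_powerset.
by apply: subset_leq_card; apply/subsetP => A _; rewrite powersetE subsetT.
Qed.

Lemma size_vertex_layer s L : size (vertex_layer s L).2 = (size L.2 * size (vertices s L.1))%N.
Proof. by rewrite size_map size_allpairs size_iota. Qed.

Lemma fsz_ctw s Tw : uniq s -> fsz (ctw s Tw) = nu_of Tw (size s).
Proof.
move=> us; rewrite /fsz big_map; apply: eq_bigr => L _.
by rewrite size_vertex_layer size_vertices.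
Qed.

Lemma goodtw_ctw s Tw : goodtw K Tw -> goodtw K (ctw s Tw).
Proof.
move=> g L' /mapP[L LT ->]; have [h1 h2 h3] := g L LT; split=> // f /mapP[[i om]].
case/allpairsP => [[i' om']] /= [hi ho [-> ->]] ->.
apply: (pfun_lin (f := nth (fun=> 0) L.2 i') (vtx_linear om')); apply: h3.
by rewrite mem_nth //; move: hi; rewrite mem_iota.
Qed.

Definition unpack (w : W) : X * V := ([ffun i => row (lift ord0 i) (vec_mx w)], row ord0 (vec_mx w)).

Lemma unpack_bij : bijective unpack.
Proof.
pose e (p : X * V) : W := mxvec (\matrix_(a < K.+1) (if unlift ord0 a is Some i then p.1 i else p.2)).
exists e => [w|[h x]].
  rewrite /e -[RHS]vec_mxK; congr mxvec; apply/row_matrixP => a; rewrite rowK /=.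
  by case: unliftP => [j ->|->]; rewrite ?ffunE.
rewrite /unpack /e mxvecK rowK unlift_none; congr pair.
by apply/ffunP => i; rewrite ffunE rowK liftK.
Qed.

Lemma cube_count_le s Tw : uniq s ->
  avg (fun h => avg (fun x => (cube s (zf Tw) h x)%:R : R)) <= avg (fun w => (zf (ctw s Tw) w)%:R).
Proof.
move=> us; rewrite -(avg_pair (fun h x => (cube s (zf Tw) h x)%:R)).
rewrite -(avg_bij (fun p : X * V => (cube s (zf Tw) p.1 p.2)%:R) unpack_bij); apply: ler_avg => w.
rewrite ler_nat; case: (boolP (cube _ _ _ _)) => // hc; rewrite lt0b; apply/allP => L' /mapP[L LT ->].
apply/allP => f /mapP[[i om]]; case/allpairsP => [[i' om']] /= [hi ho [-> ->]] ->.
move: ho; rewrite mem_enum inE => /andP[os _].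
have := cube_vertex us os hc; rewrite /= => /allP/(_ L LT)/allP/(_ (nth (fun=> 0) L.2 i')).
rewrite mem_nth; last by move: hi; rewrite mem_iota.
move=> /(_ isT); congr (nth _ _ _ _ == 0); rewrite /vtx; congr (_ + _).
by apply: eq_bigr => j _; rewrite ffunE.
Qed.

Section Slots.
Variable rho : 'I_K -> option 'I_K.

(** The i-th argument is placed in the direction [rho i], or in the base point if there is none;
    [slot_in] tells whether the vertex om sees it. *)
Definition slot_inj (i : 'I_K) (v : V) : W :=
  mxvec (delta_mx (oapp (lift ord0) ord0 (rho i)) 0 *m v).

Definition slot_in om i := if rho i is Some j then j \in om else true.

Lemma slot_linear i : linear (slot_inj i).
Proof. by move=> a u v; rewrite /slot_inj !linearP. Qed.

Lemma vtx_slot om i v : vtx om (slot_inj i v) = (slot_in om i)%:R *: v.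
Proof.
have rw (a b : 'I_K.+1) : row a (delta_mx b (0 : 'I_1) *m v) = (a == b)%:R *: v.
  rewrite row_mul; have -> : row a (delta_mx b 0) = (a == b)%:R%:M :> 'M[F]_1.
    by apply/matrixP => x y; rewrite !mxE !ord1 eqxx andbT mulr1n.
  by rewrite mul_scalar_mx.
rewrite /vtx /slot_inj mxvecK rw /slot_in; case: (rho i) => [j|] /=; last first.
  by rewrite ?eqxx big1 ?addr0 // => j _; rewrite rw eq_sym (negbTE (neq_lift _ _)) scale0r.
rewrite ?(negbTE (neq_lift _ _)) scale0r add0r; case: (boolP (j \in om)) => jo.
  rewrite (bigD1 j) //= rw eqxx big1 ?addr0 // => j' /andP[_ jj]; rewrite rw (inj_eq lift_inj) (negbTE jj) scale0r //.
rewrite big1 ?scale0r // => j' jo'; rewrite rw (inj_eq lift_inj); case: eqP => [e|_]; last by rewrite scale0r.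
by rewrite -e jo' in jo.
Qed.

Lemma polar_slot om I f z : form I (polar I f) ->
  polar I (fun w => f (vtx om w)) (cmap slot_inj z) =
  [forall i in I, slot_in om i]%:R * polar I f z.
Proof.
move=> hf; rewrite (polar_lin _ _ _ (vtx_linear om)).
case: (boolP [forall i in I, _]) => [/forall_inP h|].
  rewrite mul1r; apply: (form_dep hf) => i iI; by rewrite !ffunE vtx_slot h // scale1r.
move=> /forall_inPn[i iI /negbTE h].
rewrite mul0r -(lin10 (hf.1 i iI (cmap (fun=> vtx om) (cmap slot_inj z)))); congr polar.
by apply/ffunP => j; rewrite !ffunE; case: eqP => // ->; rewrite vtx_slot h scale0r.
Qed.

End Slots.

(** The elements of om0 are assigned to distinct elements of I, hence the bound on #|om0|. The
    remaining arguments go to the base point, which every vertex sees. *)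
Lemma exists_slots om0 I : (#|om0| <= #|I|)%N -> exists rho : 'I_K -> option 'I_K,
  forall om, [forall i in I, slot_in rho om i] = (om0 \subset om).
Proof.
move=> le; pose rho i := if (index i (enum I) < size (enum om0))%N then
   Some (nth i (enum om0) (index i (enum I))) else None.
exists rho => om; apply/idP/idP => [/forall_inP h|sub].
  apply/subsetP => j jo; have ja : (index j (enum om0) < #|om0|)%N by rewrite cardE index_mem mem_enum.
  have ia : (index j (enum om0) < size (enum I))%N by rewrite -cardE; apply: leq_trans ja le.
  have := h (nth j (enum I) (index j (enum om0))); rewrite -mem_enum mem_nth // => /(_ isT).
  rewrite /slot_in /rho index_uniq ?enum_uniq // -cardE ja.
  by rewrite (set_nth_default j) -?cardE // nth_index // mem_enum.
apply/forall_inP => i iI; rewrite /slot_in /rho; case: ifP => // lt.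
by apply: (subsetP sub); rewrite -mem_enum mem_nth.
Qed.

Lemma idx_ctw s Tw : idx K (ctw s Tw) = [seq (vertex_layer s p.1, p.2) | p <- idx K Tw].
Proof.
rewrite /idx /ctw map_flatten -!map_comp; congr flatten; apply: eq_map => L /=.
by rewrite -map_comp.
Qed.

(** Among the vertices with a nonzero coefficient, take a maximal om0, and slots for which only the
    vertices containing om0 contribute. The combination then becomes one of the polar forms in the
    original layer, with the coefficients at om0 and no larger rank. *)
Lemma regular_ctw s Tw a a' t : goodtw K Tw ->
  (forall M, (a' * (2 ^ K * M) ^ a' <= a * M ^ a)%N) ->
  regular a t (ptw K Tw) -> regular a' t (ptw K (ctw s Tw)).
Proof.
move=> g haa reg U1 Lw U2; rewrite {1}/ptw idx_ctw -map_comp => e c c0 r rle hDec.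
have [u1 [[L I] [u2 [eu e1 eL e2]]]] := map_split e.
have Lidx : (L, I) \in idx K Tw by rewrite eu mem_cat inE eqxx orbT.
have [] := mem_idx Lidx; rewrite [(L, I).1]/= [(L, I).2]/= => LT cI.
have [Lp LK pf] := g L LT.
have pfn i : form I (polar I (nth (fun=> 0) L.2 i)).
  case: (ltnP i (size L.2)) => iL; first by have [] := pf _ (mem_nth (fun=> 0) iL) I cI.
  rewrite nth_default //; apply: (form_eq _ (@form0 _ _ _ I)) => y; rewrite /polar.
  by elim: (enum I) (0 : V) => //= j s' IH x; rewrite -!IH subrr.
move: Lw eL c c0 rle hDec {e} => Lw <- /=; set fs := map _ _ => c c0 rle hDec.
set ix := vertex_index s L.
pose gp (p : nat * {set 'I_K}) : {ffun 'I_K -> W} -> F := polar I (fun w => nth (fun=> 0) L.2 p.1 (vtx p.2 w)).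
have efs : fs = [seq gp p | p <- ix] by rewrite /fs -map_comp.
have szfs : size fs = size ix by rewrite efs size_map.
have uix : uniq ix.
  by apply: allpairs_uniq; [exact: iota_uniq|exact: enum_uniq|move=> [? ?] [? ?] _ _].
pose cp (p : nat * {set 'I_K}) : F := if insub (index p ix) is Some j then c 0 j else 0.
have ecomb y : comb c y = \sum_(p <- ix) cp p * gp p y.
  rewrite (big_nth (0%N, set0)) big_mkord /comb -szfs; apply: eq_bigr => j _.
  have jx : (j < size ix)%N by rewrite -szfs.
  rewrite /cp index_uniq // (insubT (fun m => m < size fs)%N (ltn_ord j)); congr (c 0 _ * _).
    exact: val_inj.
  by rewrite {1}efs (nth_map (0%N, set0)).
have [p0 p0ix cp0] : exists2 p, p \in ix & cp p != 0.
  have [j cj] : exists j, c 0 j != 0.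
    apply: contrapT => no; case/eqP: c0; apply/rowP => j; rewrite mxE; apply/eqP.
    by apply: contraT => cj; case: no; exists j.
  have jx : (j < size ix)%N by rewrite -szfs.
  exists (nth (0%N, set0) ix j); first exact: mem_nth.
  rewrite /cp index_uniq // (insubT (fun m => m < size fs)%N (ltn_ord j)) //.
  by rewrite (_ : Sub _ _ = j) //; apply: val_inj.
have [om0 [i0 h0 hmax]] : exists om0, exists2 i0, (i0, om0) \in ix /\ cp (i0, om0) != 0 &
   forall i om, (i, om) \in ix -> cp (i, om) != 0 -> om0 \subset om -> om = om0.
  pose Q om := [exists i : 'I_(size L.2), ((i : nat, om) \in ix) && (cp (i : nat, om) != 0)].
  have iL i om : (i, om) \in ix -> (i < size L.2)%N.
    by case/allpairsP => [[i' om']] /= [hi _ [-> _]]; move: hi; rewrite mem_iota.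
  have Q0 : Q p0.2.
    case: p0 p0ix cp0 => i om /= h1 h2; apply/existsP; exists (Ordinal (iL _ _ h1)).
    by rewrite h1.
  case: (arg_maxnP (fun om : {set 'I_K} => #|om|) Q0) => om0 /existsP[i /andP[h1 h2]] hm.
  exists om0; exists (i : nat) => // i' om h3 h4 sub; apply/esym/eqP.
  rewrite eqEcard sub; apply: hm; apply/existsP; exists (Ordinal (iL _ _ h3)); by rewrite h3.
have om0v : om0 \in vertices s L.1 by case: h0 => /allpairsP[[i' om']] /= [_ ho [_ ->]].
have [|rho hrho] := @exists_slots om0 I.
  by rewrite cI; move: om0v; rewrite mem_enum inE => /andP[].
pose sg (z : X) := cmap (slot_inj rho) z.
have eS z : comb c (sg z) = \sum_(j < size L.2) cp (j : nat, om0) * polar I (nth (fun=> 0) L.2 j) z.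
  rewrite ecomb /ix /vertex_index big_allpairs -[in iota _ _](subn0 (size L.2)) -/(index_iota _ _) big_mkord.
  apply: eq_bigr => j _; rewrite (bigD1_seq om0) ?enum_uniq //=.
  rewrite /gp polar_slot // hrho subxx mul1r big_seq_cond big1 ?addr0 // => om /andP[ov oo].
  rewrite polar_slot // hrho; case: (boolP (om0 \subset om)) => sub; last by rewrite mul0r mulr0.
  have inix : (j : nat, om) \in ix by apply/allpairsP; exists (j : nat, om); rewrite mem_iota /= ltn_ord.
  have -> : cp (j : nat, om) = 0; last by rewrite mul0r.
  by apply/eqP; apply: contraT => hc; rewrite (hmax _ _ inix hc sub) eqxx in oo.
pose V1 := map (polar_layer (n := n)) u1; pose V2 := map (polar_layer (n := n)) u2.
have eT : ptw K Tw = V1 ++ polar_layer (L, I) :: V2 by rewrite /ptw eu map_cat.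
have szV : size (polar_layer (L, I)).2 = size L.2 by rewrite size_map.
pose c1 : 'rV[F]_(size (polar_layer (L, I)).2) := \row_j cp (j : nat, om0).
have c10 : c1 != 0.
  have i0L : (i0 < size (polar_layer (L, I)).2)%N.
    rewrite szV; case: h0 => /allpairsP[[i' om']] /= [hi _ [-> _]]; by move: hi; rewrite mem_iota.
  apply/eqP => /rowP/(_ (Ordinal i0L)); rewrite !mxE /= => e; case: h0 => _; by rewrite e eqxx.
apply: (reg _ _ _ eT c1 c10 r).
  apply: leq_trans rle (leq_trans _ (haa _)); rewrite leq_mul2l; apply/orP; right; apply: leq_expl.
  rewrite !mulnDr; apply: leq_add; last by rewrite leq_pmull // expn_gt0.
  apply: leq_add.
    by rewrite szV /fs size_map size_vertex_layer mulnC leq_mul2r size_vertices_le orbT.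
  rewrite -e2 /V2; elim: (u2) => [|[L' J] u IHu]; first by rewrite muln0.
  rewrite /= !msz_cons mulnDr; apply: leq_add => //.
  by rewrite /= !size_map size_allpairs size_iota mulnC leq_mul2r size_vertices_le orbT.
have -> : comb c1 = (fun z => comb c (sg z)).
  apply/funext => z; rewrite eS /comb; rewrite -(big_mkord xpredT (fun j => cp (j, om0) * polar I (nth (fun=> 0) L.2 j) z)) -szV big_mkord.
  by apply: eq_bigr => j _; rewrite mxE (nth_map (fun=> 0)) // -szV.
apply: (Dec_cmap (L := slot_inj rho)) hDec; first exact: slot_linear.
move=> p /mem_gens[L1]; rewrite -e1 => /mapP[[L2 J] Ju1 ->] /= /mapP[f' /mapP[f hf ->] ->] /= JI.
case/mapP: hf => [[i om]] /allpairsP[[i' om']] /= [hi ho [-> ->]] ->.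
have L2idx : (L2, J) \in idx K Tw by rewrite eu mem_cat Ju1.
have [] := mem_idx L2idx; rewrite [(L2, J).1]/= [(L2, J).2]/= => L2T cJ.
have [_ _ pf2] := g L2 L2T; have iL2 : (i' < size L2.2)%N by move: hi; rewrite mem_iota.
have [_ fJ] := pf2 _ (mem_nth (fun=> 0) iL2) J cJ.
have inV1 : (J, polar J (nth (fun=> 0) L2.2 i')) \in gens V1.
  apply/mem_gens; exists (polar_layer (L2, J)); first exact: map_f.
  by apply: map_f; apply: map_f; exact: mem_nth.
apply: Dec_eq (DecS ([forall i in J, slot_in rho om' i]%:R) (Dec_gen1 inV1)) _ => z.
by rewrite polar_slot.
Qed.

End CubeTower.

Definition good_char (R : rcfType) (F : finFieldType) (chi : F -> R[i]) :=
  [/\ chi 0 = 1, forall a b, chi (a + b) = chi a * chi b,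
      forall a, conjc (chi a) = chi (- a) & exists a, chi a != 1].

(** * From characters to the kernel *)

Section Characters.
Variables (R : rcfType) (F : finFieldType) (chi : F -> R[i]).
Local Notation q := (#|F|%:R : R).
Local Notation nc := (@Normc.normc R).
Hypothesis hchi : good_char chi.

Lemma avg_chi_vec m (v : 'I_m -> F) :
  avg (fun c : 'rV[F]_m => chi (\sum_j c 0 j * v j)) = [forall j, v j == 0]%:R.
Proof.
have [chi0 chiD _ [a0 a01]] := hchi.
case: (boolP [forall j, v j == 0]) => [/forallP h|].
  rewrite -[RHS](avg_const (0 : 'rV[F]_m)); apply: eq_avg => c.
  by rewrite big1 // => j _; rewrite (eqP (h j)) mulr0.
rewrite negb_forall => /existsP[j vj]; set S := avg _.
have : S = chi a0 * S.
  rewrite /S -avgZ -(@avg_bij _ _ _ (fun c => c + (a0 / v j) *: delta_mx 0 j)); last first.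
    by exists (fun c => c - (a0 / v j) *: delta_mx 0 j) => c; rewrite ?addrK ?subrK.
  have ea : \sum_i ((a0 / v j) *: delta_mx 0 j : 'rV[F]_m) 0 i * v i = a0.
    rewrite (bigD1 j) //= !mxE !eqxx mulr1 divfK // big1 ?addr0 // => i ij.
    by rewrite !mxE (negbTE ij) andbF mulr0 mul0r.
  apply: eq_avg => c; rewrite -chiD; congr chi; rewrite -[X in _ = X + _]ea addrC -big_split.
  by apply: eq_bigr => i _; rewrite !mxE mulrDl.
move=> e; apply/eqP; have /eqP := e; rewrite -subr_eq0 -[X in X - _]mul1r -mulrBl mulf_eq0.
by rewrite subr_eq0 eq_sym (negbTE a01).
Qed.

Lemma sum_chi_psi (b : F) : \sum_(a | a != 0) chi (a * b) = (#|F|.-1%:R * psi R b)%:C.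
Proof.
have [chi0 _ _ _] := hchi.
have c0 : 0 < #|F|%:R :> R[i] by rewrite ltr0n; apply/card_gt0P; exists 0.
have p0 : #|F|.-1%:R != 0 :> R by rewrite pnatr_eq0; have := card_F_gt1 F; lia.
have e : \sum_a chi (a * b) = (b == 0)%:R * #|F|%:R.
  have := avg_chi_vec (fun _ : 'I_1 => b); rewrite /avg card_mx mul1n expn1.
  have -> : [forall j : 'I_1, b == 0] = (b == 0) by apply/forallP/idP => [/(_ 0)|].
  move=> h; rewrite -h mulrC mulrA divff ?mul1r ?lt0r_neq0 //.
  rewrite (reindex (fun c : 'rV[F]_1 => c 0 0)) /=; last first.
    by exists (fun a => const_mx a) => [c _|a _]; [apply/rowP => j; rewrite mxE ord1|rewrite mxE].
  by apply: eq_bigr => c _; rewrite big_ord1.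
move: e; rewrite (bigD1 0) //= mul0r chi0 => /(canRL (addKr _)) ->.
rewrite /psi; case: eqP => _; rewrite ?mul1r ?mul0r ?mulr1 ?addr0; last first.
  by rewrite mulrN divff // rmorphN rmorph1.
rewrite rmorph_nat -[in LHS](prednK (ltnW (card_F_gt1 F))) -natr1; ring.
Qed.

(** Scaling coordinate i by a nonzero a preserves the zeros of G and multiplies p by a; summing over
    all such a turns [chi] into [psi]. *)
Lemma avg_chi_form n k (G : seq ({set 'I_k} * ({ffun 'I_k -> 'rV[F]_n} -> F))) I (p : {ffun 'I_k -> 'rV[F]_n} -> F) :
  wfg G -> I != set0 -> form I p ->
  avg (fun h => (zg G h)%:R * chi (p h)) = (beta R G p)%:C.
Proof.
move=> wf /set0Pn[i iI] hp.
have sc (a : F) h : a != 0 -> zg G (upd h i (a *: h i)) = zg G h.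
  have key b u : zg G (upd h i u) -> zg G (upd h i (b *: u)).
    move=> zu; have := @zg_subsp F n k G i h wf (b - 1) u u zu zu.
    by rewrite scalerBl scale1r subrK.
  move=> a0; apply/idP/idP => [/(key a^-1)|zh]; first by rewrite scalerA mulVf // scale1r upd_same.
  by apply: key; rewrite upd_same.
have p0 : (#|F|.-1%:R : R) != 0 by rewrite pnatr_eq0; have := card_F_gt1 F; lia.
have p0' : (#|F|.-1%:R : R)%:C != 0 by rewrite -(rmorph0 (real_complex R)) (inj_eq (@complexI R)).
apply: (mulfI p0').
have -> : (#|F|.-1%:R : R)%:C * (beta R G p)%:C = avg (fun h => (zg G h)%:R * \sum_(a | a != 0) chi (a * p h)).
  transitivity ((#|F|.-1%:R * beta R G p)%:C); first exact: esym (rmorphM (real_complex R) _ _).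
  rewrite /beta -avgZ avg_complex; apply: eq_avg => h.
  by rewrite sum_chi_psi -[in RHS](rmorph_nat (real_complex R)) -rmorphM mulrCA.
have -> : avg (fun h => (zg G h)%:R * \sum_(a | a != 0) chi (a * p h)) =
    \sum_(a | a != 0) avg (fun h => (zg G h)%:R * chi (a * p h)).
  rewrite /avg -mulr_sumr exchange_big /=; congr (_ * _); apply: eq_bigr => h _; by rewrite mulr_sumr.
rewrite (eq_bigr (fun=> avg (fun h => (zg G h)%:R * chi (p h)))) => [|a a0].
  rewrite sumr_const -[RHS]mulr_natl (rmorph_nat (real_complex R)); congr (_%:R * _).
  by rewrite -(cardC1 (0 : F)); apply: eq_card => a; rewrite !inE.
pose sa (c : F) (h : {ffun 'I_k -> 'rV[F]_n}) := upd h i (c *: h i).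
rewrite -[RHS](avg_bij (h := sa a)); last first.
  exists (sa a^-1) => h; by rewrite /sa updE updK scalerA ?mulVf ?divff // scale1r upd_same.
apply: eq_avg => h; rewrite /sa sc //; congr (_ * chi _).
by rewrite (lin1Z _ _ (hp.1 i iI h)) upd_same.
Qed.
End Characters.

Definition EQP (R : rcfType) (K h C a : nat) :=
  forall (F : finFieldType) (chi : F -> R[i]) n (Tw : seq (nat * seq ('rV[F]_n -> F))) t,
  good_char chi -> goodtw K Tw -> (size Tw <= h)%N -> regular a t (ptw K Tw) ->
  (1 - #|F|%:R ^- (C * t.+1)) * #|F|%:R ^- fsz Tw <= avg (fun x => (zf Tw x)%:R : R) /\
  avg (fun x => (zf Tw x)%:R : R) <= (1 + #|F|%:R ^- (C * t.+1)) * #|F|%:R ^- fsz Tw.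

(** A single I is enough: a layer has a polar layer for each I, and any of these can be confronted
    with regularity. *)
Definition BRP (R : rcfType) (K h a : nat) :=
  forall (F : finFieldType) (chi : F -> R[i]) n (Tw : seq (nat * seq ('rV[F]_n -> F))) t e f,
  good_char chi -> goodtw K Tw -> (size Tw <= h)%N -> (0 < e)%N -> (e < K)%N -> pfun K e f ->
  regular a t (ptw K Tw) ->
  #|F|%:R ^- t * #|F|%:R ^- fsz Tw <= Normc.normc (avg (fun x => (zf Tw x)%:R * chi (f x))) ->
  exists (I : {set 'I_K}) r,
    [/\ #|I| = e, (r <= a * t.+1 ^ a)%N & Dec (gens (ptw K Tw)) I r (polar I f)].

Lemma chain_levelE t j : (chain_level t j).+1 = (2 ^ j * t.+1)%N.
Proof. by elim: j => [|j IH] /=; rewrite ?expn0 ?mul1n // expnS -mulnA -IH; lia. Qed.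

(** * Simultaneous induction on the height of towers of functions *)

Section BiasRank.
Variables (R : rcfType) (K h : nat).

(** The upper bound on the number of cubes is the equidistribution of [ctw], whose height is that of
    the tower itself. With it [bias_polar] gives a bias of a polar form over the polar tower, and
    [relative_bias_rank] applies. *)
Lemma BRP_of_EQP : (forall C, exists a, EQP R K h C a) -> exists a, BRP R K h a.
Proof.
move=> HE; pose hh := (h * 2 ^ K)%N.
have [aR HR] := @RBR_lt R K.+1 (fun k' c h' _ => relative_bias_rank R k' c h') K hh.
(* With this C, delta times the factor in [bias_polar] stays below the square of q^-(L+1), where L +
   1 is at most 2^K (t + 1). *)
pose C := (2 * 2 ^ K + 2 * K + 6)%N.
have [aE {}HE] := HE C; pose aq := eqexp aR hh C.
pose c1 := (2 ^ K.+2)%N.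
have [a [_ ha]] : exists a, (0 <= a)%N /\ forall M, (0 < M)%N ->
    (aE * (2 ^ K * M) ^ aE + (aq * M ^ aq + aR * (c1 * M) ^ aR) <= a * M ^ a)%N.
  apply: polyb_le; have pe (x y : nat) : polyb (fun M => x * (y * M) ^ x)%N.
    apply: polybM; first exact: polyb_cst.
    by apply: polybX; apply: polybM; [exact: polyb_cst|exact: polyb_id].
  apply: polybD => //; apply: polybD => //.
  by apply: polybM; [exact: polyb_cst|apply: polybX; exact: polyb_id].
exists a => F chi n Tw t e f hchi g szT e0 eK pf reg hb.
have [chi0 chiD chiJ _] := hchi.
have q2 : 2%:R <= #|F|%:R :> R by rewrite ler_nat card_F_gt1.
have K2 : (0 < 2 ^ K)%N by rewrite expn_gt0.
have regE : regular aE t (ptw K Tw).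
  apply: regular_weaken reg => s; apply: leq_trans (ha (s + t.+1)%N _); last by rewrite addnS.
  apply: leq_trans (leq_addr _ _); rewrite leq_mul2l leq_expl ?orbT // leq_pmull //.
have regq : regular aq t (ptw K Tw).
  apply: regular_weaken reg => s; apply: leq_trans (ha (s + t.+1)%N _); last by rewrite addnS.
  by apply: leq_trans (leq_addl _ _); exact: leq_addr.
have wf := wft_ptw g.
have loc T1 L T2 : ptw K Tw = T1 ++ L :: T2 -> Rloc R aR (subt T1 L.1) L.1.
  move=> eT; have LT : L \in ptw K Tw by rewrite eT mem_cat inE eqxx orbT.
  have [L0 _] := wf _ LT; have cL : (#|L.1| <= K)%N by rewrite -[leqRHS]card_ord max_card.
  have sub1 L' : L' \in subt T1 L.1 -> L'.1 \subset L.1 by rewrite mem_filter => /andP[].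
  apply: (HR #|L.1|) => //.
  - by apply: wft_subt; move: wf; rewrite eT => /wft_cat[].
  - by apply: leq_trans cL; apply: subset_leq_card; exact: bigcup_seq_sub.
  - apply: leq_trans (_ : size T1 <= _)%N; first by rewrite size_filter count_size.
    apply: leq_trans (_ : size (ptw K Tw) <= _)%N; first by rewrite eT size_cat leq_addr.
    by apply: leq_trans (size_ptw _ _) _; rewrite leq_mul2r szT orbT.
have szP : (size (ptw K Tw) <= hh)%N.
  by apply: leq_trans (size_ptw _ _) _; rewrite leq_mul2r szT orbT.
pose delta : R := #|F|%:R ^- (C * t.+1).
have d0 : 0 <= delta by exact/ltW/qV_gt0.
have d1 : delta <= 1 by exact: qV_le1.
have dT : dens R (gens (ptw K Tw)) <= (1 + delta) * #|F|%:R ^- msz (ptw K Tw).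
  exact: (equidistribution wf szP loc regq).
pose w (s : seq 'I_K) y := zg (gens (subt (ptw K Tw) [set i in s])) y.
have hD s : subseq s (enum 'I_K) -> avg (fun y => (w s y)%:R) <= (1 + delta) * #|F|%:R ^- mu_of Tw (size s).
  move=> ss; have us := subseq_uniq ss (enum_uniq _).
  have := dens_subg_le [set i in s] (wfg_gens wf) dT.
  by rewrite -gens_subt -/(msz _) msz_subt_ptw cardsE (card_uniqP us).
have hw s y x : subseq s (enum 'I_K) -> cube s (zf Tw) y x -> w s y by exact: cube_polar.
(* There are e directions for the polar form and one for the second moment. *)
pose s1 := drop (K - e.+1) (enum 'I_K).
have ss1 : subseq s1 (enum 'I_K) by rewrite -[X in subseq _ X](cat_take_drop (K - e.+1)) suffix_subseq.
have sz1 : size s1 = e.+1 by rewrite size_drop size_enum_ord subKn.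
case es1: s1 sz1 => [|i s2] // [sz2].
case: s2 es1 sz2 => [|j s] es1 /= sz1; first by rewrite -sz1 in e0.
rewrite es1 in ss1.
have us1 := subseq_uniq ss1 (enum_uniq _).
have [ss2 _] := subseq_cons ss1.
pose I := [set i in j :: s].
have eI : enum I = j :: s by exact: subseq_enum.
have cI : #|I| = e by rewrite cardE eI.
have [pf1 pf2] := pf I cI.
have [E1 _] := HE F chi n Tw t hchi g szT regE.
have regW : regular aE t (ptw K (ctw (i :: j :: s) Tw)).
  apply: regular_ctw g _ reg => M; case: (posnP M) => [->|M0].
    by rewrite muln0; case: (aE) => [|aE']; rewrite ?mul0n // exp0n ?muln0.
  by apply: leq_trans (ha M M0); exact: leq_addr.
have szW : (size (ctw (i :: j :: s) Tw) <= h)%N by rewrite size_map.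
have [_ E2] := HE F chi _ (ctw (i :: j :: s) Tw) t hchi (goodtw_ctw g) szW regW; rewrite (fsz_ctw Tw us1) in E2.
have E3 := le_trans (cube_count_le R Tw us1) E2.
have eK' : (e <= K)%N by exact: ltnW.
set L := chain_level t e.
have eL : L.+1 = (2 ^ e * t.+1)%N by exact: chain_levelE.
have Lle : (L.+1 <= 2 ^ K * t.+1)%N by rewrite eL leq_mul2r leq_pexp2l ?orbT.
have q3 m : 3%:R ^+ m <= #|F|%:R ^+ (2 * m) :> R.
  rewrite exprM lerXn2r ?nnegrE ?exprn_ge0 ?ler0n //; apply: (@le_trans _ _ (2%:R ^+ 2)).
    by rewrite -natrX ler_nat.
  by rewrite lerXn2r ?nnegrE ?ler0n.
have mono := @qV_mono R F.
have qe m m' : (m <= m')%N -> #|F|%:R ^+ m * #|F|%:R ^- m' = #|F|%:R ^- (m' - m) :> R.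
  move=> mm; rewrite -{1}(subnK mm) addnC qVD mulrA divff ?mul1r // gt_eqF // exprn_gt0 //; exact: q_gt0.
have dsm m : (m + 2 * L.+1 <= C * t.+1)%N -> #|F|%:R ^+ m * delta <= (#|F|%:R ^- L.+1) ^+ 2.
  move=> mm; rewrite /delta qe; last by apply: leq_trans mm; exact: leq_addr.
  rewrite expr2 -qVD; apply: mono; rewrite addnn -mul2n.
  by move: (C * t.+1)%N (2 * L.+1)%N mm => z1 z2; clear; lia.
have CK : (2 * K + 4 + 2 * L.+1 <= C * t.+1)%N by rewrite /C; move: L.+1 (2 ^ K)%N Lle => z1 z2; clear; nia.
rewrite -/delta in E1 E3; clearbody delta.
have := @bias_polar R F n K chi chi0 chiD chiJ (zf Tw) w (mu_of Tw) (nu_of Tw) delta hw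
  (nu_mu Tw) hD d0 d1 f (polar I f) t i j s ss1.
rewrite sz1 -/L (nu_of0 Tw) => B0.
have B : #|F|%:R ^- L.+1 * #|F|%:R ^- mu_of Tw e <=
   Normc.normc (avg (fun y => (w (j :: s) y)%:R * chi (polar I f y))).
  apply: B0 => //.
  - by move=> y x; rewrite -eI pf1.
  - apply: le_trans (ler_wpM2r d0 (q3 e)) _; apply: le_trans (dsm _ _) _.
      by move: (C * t.+1)%N (2 * L.+1)%N CK => z1 z2; clear -eK'; lia.
    by rewrite expr2 -qVD; exact: qV_le1.
  - apply: le_trans (dsm _ CK); rewrite ler_wpM2r //.
    have -> : (2 * K + 4 = 2 * K + 1 + 2 + 1)%N by clear; lia.
    have Q1 : 1 <= #|F|%:R ^+ (2 * K) :> R by rewrite exprn_ege1 // (le_trans _ q2) // ler1n.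
    have Q2 : 3%:R ^+ e <= #|F|%:R ^+ (2 * K) :> R.
      apply: le_trans (q3 e) _; rewrite ler_weXn2l ?(le_trans _ q2) ?ler1n // leq_mul2l eK' orbT //.
    have e1 : 1 + delta <= #|F|%:R by apply: le_trans q2; clear -d1; lra.
    have e2 : 2%:R + 2%:R * 3%:R ^+ e <= #|F|%:R ^+ (2 * K + 1 + 2) :> R.
      rewrite -addnA exprD; apply: (@le_trans _ _ (#|F|%:R ^+ (2 * K) * 4%:R)).
        by move: Q1 Q2; set u := _ ^+ e; set v := _ ^+ (2 * K); move: u v; clear => u v; lra.
      apply: ler_wpM2l; first by rewrite exprn_ge0 // ler0n.
      apply: (@le_trans _ _ (2%:R ^+ 2)); first by rewrite -natrX ler_nat.
      apply: (@le_trans _ _ (#|F|%:R ^+ 2)); first by rewrite lerXn2r ?nnegrE ?ler0n.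
      by rewrite ler_weXn2l // (le_trans _ q2) // ler1n.
    rewrite [leRHS]exprD expr1 [leRHS]mulrC; apply: ler_pM => //; first by clear -d0; lra.
    by rewrite addr_ge0 ?mulr_ge0 ?exprn_ge0 ?ler0n.
  - by move: E3; rewrite /= sz1.
have I0 : I != set0 by rewrite -card_gt0 cI.
set TI := subt (ptw K Tw) I.
have wfI : wft TI by exact: wft_subt.
have bB := avg_chi_form hchi (wfg_gens wfI) I0 pf2.
have wE : (fun y => (w (j :: s) y)%:R * chi (polar I f y)) =1 (fun y => (zg (gens TI) y)%:R * chi (polar I f y)) by [].
have beta0 : 0 <= beta R (gens TI) (polar I f) by apply: beta_ge0 pf2 I0; exact: wfg_gens.
move: B; rewrite (eq_avg wE) bB normc_real // => B.
have DI : dens R (gens TI) <= 2%:R * #|F|%:R ^- mu_of Tw e.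
  have := hD (j :: s) ss2; rewrite /= sz1 => h1; apply: le_trans h1 _.
  by rewrite ler_pM2r ?qV_gt0 //; clear -d1; lra.
have subI L' : L' \in TI -> L'.1 \subset I by rewrite mem_filter => /andP[].
have RI : Rloc R aR TI I.
  apply: (HR #|I|) => //; first by rewrite cI ltnS.
    by apply: leq_trans (_ : #|I| <= _)%N; [apply: subset_leq_card; exact: bigcup_seq_sub|rewrite cI].
  by apply: leq_trans szP; rewrite size_filter count_size.
(* The second unit added to L pays for the factor 2 in [DI]. *)
have [||r rle hr] := RI L.+2 (polar I f) pf2.
- apply: regular_subt; apply: regular_weaken reg => s'; apply: leq_trans (ha (s' + t.+1)%N _); last by rewrite addnS.
  apply: leq_trans (leq_addl _ _); apply: leq_trans (leq_addl _ _); rewrite leq_mul2l leq_expl ?orbT //.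
  by rewrite /c1 !expnS; move: L.+1 (2 ^ K)%N K2 Lle => z1 z2; clear; nia.
- rewrite /theta /=; apply: le_trans B; apply: le_trans (ler_wpM2l _ DI) _; first exact/ltW/qV_gt0.
  rewrite -addn1 qVD -mulrA; apply: ler_wpM2l; first exact/ltW/qV_gt0.
  have h2 : #|F|%:R ^- 1 * 2%:R <= 1 :> R by rewrite expr1 mulrC ler_pdivrMr ?q_gt0 // mul1r.
  by rewrite mulrA; apply: ler_piMl h2; exact/ltW/qV_gt0.
exists I, r; split=> //.
  apply: leq_trans rle _; apply: leq_trans (ha t.+1 _); last by [].
  apply: leq_trans (leq_addl _ _); apply: leq_trans (leq_addl _ _); rewrite leq_mul2l leq_expl ?orbT //.
  by rewrite /c1 !expnS; move: L.+1 (2 ^ K)%N K2 Lle => z1 z2; clear; nia.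
by apply: Dec_incl hr => p; rewrite gens_subt mem_filter => /andP[].
Qed.

End BiasRank.

Section Induction.
Variables (R : rcfType) (K : nat).
Local Notation nc := (@Normc.normc R).

Lemma EQP0 C : EQP R K 0 C 0.
Proof.
move=> F chi n Tw t _ _; rewrite leqn0 size_eq0 => /eqP -> _.
rewrite /fsz big_nil expr0 invr1 !mulr1 (eq_avg (g := fun=> 1)) // (avg_const (0 : 'rV[F]_n)).
by rewrite lerBlDr !lerDl; split; exact/ltW/qV_gt0.
Qed.

(** As for forms, the indicator of the last layer L is expanded, now in characters of its
    combinations. If a nonzero combination is biased over the lower layers, [BRP] gives it a polar
    form of small rank for some I, against the regularity of the polar layer of L and I. *)
Lemma EQPS h : (forall C, exists a, EQP R K h C a) -> (exists a, BRP R K h a) ->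
  forall C, exists a, EQP R K h.+1 C a.
Proof.
move=> HE [a2 HB] C; have [a1 {}HE] := HE C.+1.
have [a [_ ha]] : exists a, (0 <= a)%N /\ forall M, (0 < M)%N ->
    (a1 * M ^ a1 + a2 * (C.+2 * M) ^ a2 <= a * M ^ a)%N.
  apply: polyb_le; apply: polybD.
    by apply: polybM; [exact: polyb_cst|apply: polybX; exact: polyb_id].
  apply: polybM; first exact: polyb_cst.
  by apply: polybX; apply: polybM; [exact: polyb_cst|exact: polyb_id].
exists a => F chi n Tw t hchi; case/lastP: Tw => [|Tw L] g szT reg.
  by apply: (@EQP0 C F chi n [::] t hchi g (leqnn _)); case=> [|? ?].
move: g szT reg; rewrite size_rcons ltnS -cats1 => g szT reg.
have g' : goodtw K Tw by move=> L' LT; apply: g; rewrite mem_cat LT.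
have [L0 LK Lpf] : [/\ (0 < L.1)%N, (L.1 < K)%N & forall f, f \in L.2 -> pfun K L.1 f].
  by apply: g; rewrite mem_cat inE eqxx orbT.
set m := size L.2; rewrite ptw_cat in reg.
have regT := regular_prefix reg.
have mle : (m <= msz (ptw K [:: L]))%N.
  have := msz_subt_ptw [:: L] [set: 'I_K]; rewrite subt_id => [->|L' _]; last exact: subsetT.
  by rewrite cardsT card_ord /mu_of big_seq1 leq_pmulr // bin_gt0 ltnW.
have reg1 : regular a1 t (ptw K Tw).
  apply: regular_weaken regT => s; apply: leq_trans (ha (s + (t + msz (ptw K [:: L])).+1)%N _); last by rewrite addnS.
  by apply: leq_trans (leq_addr _ _); rewrite leq_mul2l leq_expl ?orbT // leq_add2l ltnS leq_addr.
have [E1 E2] := HE F chi n Tw t hchi g' szT reg1.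
(* The expected density has a further factor q^-m, against which q^-t1 must still be small. One unit
   of C pays for adding two errors. *)
pose t1 := (C.+1 * (t + m).+1)%N.
have reg2 : regular a2 t1 (ptw K Tw).
  apply: regular_weaken regT => s; apply: leq_trans (ha (s + (t + msz (ptw K [:: L])).+1)%N _); last by rewrite addnS.
  apply: leq_trans (leq_addl _ _); rewrite leq_mul2l leq_expl ?orbT //.
  by rewrite /t1; move: mle; clear; move: (msz _) => z; nia.
pose fc (c : 'rV[F]_m) x := \sum_(j < m) c 0 j * nth (fun=> 0) L.2 j x.
have small c : c != 0 -> nc (avg (fun x => (zf Tw x)%:R * chi (fc c x))) <= #|F|%:R ^- t1 * #|F|%:R ^- fsz Tw.
  move=> c0; rewrite leNgt; apply/negP => /ltW hb.
  have pfc : pfun K L.1 (fc c).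
    apply: (@pfun_sum F K n 'I_m _ (fun j => c 0 j) (fun j => nth (fun=> 0) L.2 j)) => j.
    by apply: Lpf; rewrite mem_nth.
  have [I [r [cI rle hr]]] := HB F chi n Tw t1 L.1 (fc c) hchi g' szT L0 LK pfc reg2 hb.
  have : (L, I) \in idx K [:: L] by apply/flatten_mapP; exists L; rewrite ?inE //; apply/mapP; exists I; rewrite ?mem_slots ?cI.
  move=> LI; have [u1 [u2 eu]] : exists u1 u2, idx K [:: L] = u1 ++ (L, I) :: u2.
    by case/splitPr: LI => u1 u2; exists u1, u2.
  have eT : ptw K Tw ++ ptw K [:: L] =
      (ptw K Tw ++ map (polar_layer (n := n)) u1) ++ polar_layer (L, I) :: map (polar_layer (n := n)) u2.
    by rewrite -catA {2}/ptw eu map_cat.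
  have sz : size (polar_layer (L, I)).2 = m by rewrite size_map.
  pose c' : 'rV[F]_(size (polar_layer (L, I)).2) := \row_j c 0 (cast_ord sz j).
  have c'0 : c' != 0.
    apply: contraNneq c0 => e; apply/eqP/rowP => j; have := congr1 (fun M : 'rV_ _ => M 0 (cast_ord (esym sz) j)) e.
    by rewrite !mxE => <-; congr (c _ _); exact: val_inj.
  apply: (reg _ _ _ eT c' c'0 r).
    have h1 : (a2 * t1.+1 ^ a2 <= a2 * (C.+2 * (m + t.+1)) ^ a2)%N.
      by rewrite leq_mul2l leq_expl ?orbT // /t1; clear; nia.
    have h2 : (a * (m + t.+1) ^ a <= a * (m + msz (map (polar_layer (n := n)) u2) + t.+1) ^ a)%N.
      by rewrite leq_mul2l leq_expl ?orbT // leq_add2r leq_addr.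
    rewrite sz; apply: leq_trans rle (leq_trans h1 (leq_trans _ h2)).
    by apply: leq_trans (leq_addl _ _) (ha _ _); rewrite addnS.
  have -> : comb c' = polar I (fc c).
    apply/funext => y; rewrite /polar /fc der_sum /comb (reindex (cast_ord (esym sz))) /=; last first.
      by exists (cast_ord sz) => j _; rewrite ?cast_ordK ?cast_ordKV.
    apply: eq_bigr => j _; rewrite mxE (nth_map (fun=> 0)) //; congr (c _ _ * _); exact: val_inj.
  by apply: Dec_incl hr => p; rewrite gens_cat mem_cat => ->.
pose Ac (c : 'rV[F]_m) := avg (fun x => (zf Tw x)%:R * chi (fc c x)).
set A := avg (fun x => (zf (Tw ++ [:: L]) x)%:R : R).
set D := avg (fun x => (zf Tw x)%:R : R) in E1 E2.
have eA : A%:C = avg Ac.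
  rewrite /A avg_complex /Ac avg_exch; apply: eq_avg => x.
  rewrite avgZ (avg_chi_vec hchi (fun j : 'I_m => nth (fun=> 0) L.2 j x)) -natrM mulnb (rmorph_nat (real_complex R)).
  congr (nat_of_bool _)%:R; rewrite /zf all_cat /= andbT; congr (_ && _).
  by apply/allP/forallP => [h' j|h' f /(nthP (fun=> 0))[j jm <-]]; [apply: h'; exact: mem_nth|exact: (h' (Ordinal jm))].
have A0 : Ac 0 = D%:C.
  rewrite /Ac /D avg_complex; apply: eq_avg => x; rewrite (rmorph_nat (real_complex R)).
  have -> : fc 0 x = 0 by rewrite /fc big1 // => j _; rewrite mxE mul0r.
  by have [-> _ _ _] := hchi; rewrite mulr1.
have qm0 : 0 < #|F|%:R ^+ m :> R by rewrite exprn_gt0 // q_gt0.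
have near : `|A - #|F|%:R ^- m * D| <= #|F|%:R ^- t1 * #|F|%:R ^- fsz Tw.
  have e1 : (A - #|F|%:R ^- m * D)%:C = (#|F|%:R ^- m)%:C * \sum_(c | c != 0) Ac c.
    have e2 : (#|F|%:R ^- m)%:C = (#|{: 'rV[F]_m}|%:R)^-1 :> R[i].
      by rewrite fmorphV rmorphXn rmorph_nat card_mx mul1n natrX.
    have -> : (A - #|F|%:R ^- m * D)%:C = A%:C - (#|F|%:R ^- m)%:C * D%:C.
      by rewrite -(rmorphM (real_complex R)) -(rmorphB (real_complex R)).
    rewrite eA e2 {1}/avg (bigD1 0) //= A0 mulrDr addrC addKr //.
  have e3 : `|A - #|F|%:R ^- m * D| = nc (A - #|F|%:R ^- m * D)%:C.
    by rewrite /Normc.normc /= expr0n addr0 sqrtr_sqr.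
  rewrite e3 e1 Normc.normcM normc_real; last exact/ltW/qV_gt0.
  have e4 : nc (\sum_(c | c != 0) Ac c) <= \sum_(c : 'rV[F]_m | c != 0) nc (Ac c).
    by rewrite -lecR rmorph_sum; exact: (ler_norm_sum _ Ac _).
  have e5 : \sum_(c : 'rV[F]_m | c != 0) nc (Ac c) <= #|F|%:R ^+ m * (#|F|%:R ^- t1 * #|F|%:R ^- fsz Tw).
    apply: le_trans (_ : \sum_(c : 'rV[F]_m | c != 0) #|F|%:R ^- t1 * #|F|%:R ^- fsz Tw <= _).
      by apply: ler_sum => c /small.
    rewrite sumr_const -[leLHS]mulr_natl; apply: ler_wpM2r.
      by apply: mulr_ge0; exact/ltW/qV_gt0.
    by rewrite -natrX ler_nat; have := card_mx F 1 m; rewrite mul1n => <-; exact: max_card.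
  apply: le_trans (ler_wpM2l (ltW (qV_gt0 _ _ _)) (le_trans e4 e5)) _.
  by rewrite [leLHS]mulrA mulVf ?mul1r // gt_eqF.
have eM : fsz (Tw ++ [:: L]) = (fsz Tw + m)%N by rewrite /fsz big_cat big_seq1.
rewrite eM; set M := fsz Tw in E1 E2 near *.
have et : #|F|%:R ^- t1 * #|F|%:R ^- M <= #|F|%:R ^- (C.+1 * t.+1) * #|F|%:R ^- (M + m) :> R.
  rewrite -!qVD; apply: qV_mono; rewrite /t1; clear; nia.
have ed : 2%:R * #|F|%:R ^- (C.+1 * t.+1) <= #|F|%:R ^- (C * t.+1) :> R.
  rewrite mulSn qVD mulrA; apply: ler_piMl; first exact/ltW/qV_gt0.
  apply: (@le_trans _ _ (2%:R * #|F|%:R ^- 1)); first by rewrite ler_pM2l //; apply: qV_mono.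
  by rewrite expr1 ler_pdivrMr ?q_gt0 // mul1r ler_nat card_F_gt1.
have e0 : #|F|%:R ^- (M + m) = #|F|%:R ^- m * #|F|%:R ^- M :> R by rewrite qVD mulrC.
have E1' : #|F|%:R ^- m * ((1 - #|F|%:R ^- (C.+1 * t.+1)) * #|F|%:R ^- M) <= #|F|%:R ^- m * D.
  by apply: ler_wpM2l E1; exact/ltW/qV_gt0.
have E2' : #|F|%:R ^- m * D <= #|F|%:R ^- m * ((1 + #|F|%:R ^- (C.+1 * t.+1)) * #|F|%:R ^- M).
  by apply: ler_wpM2l E2; exact/ltW/qV_gt0.
have y0 : 0 <= #|F|%:R ^- (M + m) :> R by exact/ltW/qV_gt0.
have ed' := ler_wpM2r y0 ed.
move: near; rewrite ler_norml => /andP[n1 n2].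
have f1 : #|F|%:R ^- m * ((1 - #|F|%:R ^- (C.+1 * t.+1)) * #|F|%:R ^- M) =
  #|F|%:R ^- (M + m) - #|F|%:R ^- (C.+1 * t.+1) * #|F|%:R ^- (M + m) :> R by rewrite e0; ring.
have f2 : #|F|%:R ^- m * ((1 + #|F|%:R ^- (C.+1 * t.+1)) * #|F|%:R ^- M) =
  #|F|%:R ^- (M + m) + #|F|%:R ^- (C.+1 * t.+1) * #|F|%:R ^- (M + m) :> R by rewrite e0; ring.
rewrite f1 in E1'; rewrite f2 in E2'; rewrite -[2%:R * _ * _]mulrA in ed'.
rewrite mulrBl mulrDl !mul1r.
move: E1' E2' n1 n2 et ed'.
set z1 := _ ^- t1 * _; set y := _ ^- (M + m); set z2 := _ ^- (C.+1 * _) * y; set z3 := _ ^- (C * _) * y.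
set b := _ * D; move: z1 y z2 z3 b; clear => z1 y z2 z3 b *; split; lra.
Qed.

Lemma poly_bias_rank h : (forall C, exists a, EQP R K h C a) /\ exists a, BRP R K h a.
Proof.
elim: h => [|h [IH1 IH2]].
  have h0 C : exists a, EQP R K 0 C a by exists 0%N; exact: EQP0.
  by split=> //; exact: BRP_of_EQP.
have h1 := EQPS IH1 IH2; split=> //; exact: BRP_of_EQP.
Qed.

End Induction.

(** * Polynomials and Schmidt rank *)

Require Import Defs.
From mathcomp Require Import classical_sets reals constructive_ereal ereal exp.
From mathcomp Require Import -(notations) mpoly.
From mathcomp Require Import finset.

Import Order.TTheory GRing.Theory Num.Theory.
Local Open Scope ring_scope.

(** * Differences of monomials *)

Section MonomialFunctions.
Variables (F : finFieldType) (n K : nat).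
Local Notation V := 'rV[F]_n.
Local Notation X := {ffun 'I_K -> V}.
Implicit Types (s : seq 'I_K) (h : X) (x : V) (l : seq 'I_n).

Definition mon l x : F := \prod_(a <- l) x 0 a.

(** A Leibniz rule: a coordinate function is additive, so it absorbs at most one of the
    directions. *)
Lemma der_coord s (a : 'I_n) (g : V -> F) h x : uniq s ->
  der s (fun y => y 0 a * g y) h x =
  x 0 a * der s g h x + \sum_(j <- s) h j 0 a * der (rem j s) g h (x + h j).
Proof.
elim: s x => [|i s IH] x /=; first by rewrite big_nil addr0.
case/andP=> si us; rewrite !IH // big_cons eqxx mxE.
have -> : \sum_(j <- s) h j 0 a * der (if i == j then s else i :: rem j s) g h (x + h j) =
   \sum_(j <- s) h j 0 a * der (rem j s) g h (x + h i + h j) - \sum_(j <- s) h j 0 a * der (rem j s) g h (x + h j).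
  rewrite -sumrB; apply: eq_big_seq => j js; case: eqP => [e|_]; first by rewrite e js in si.
  by rewrite /= [x + h i + h j]addrAC mulrBr.
ring.
Qed.

Lemma der_zero s (f : V -> F) h x : (forall y, f y = 0) -> der s f h x = 0.
Proof. by move=> e; elim: s x => //= i s IH x; rewrite !IH subrr. Qed.

Lemma der_ext s (f g : V -> F) h x : f =1 g -> der s f h x = der s g h x.
Proof. by move=> /funext ->. Qed.

Lemma mon_cons a l : mon (a :: l) = fun x => x 0 a * mon l x.
Proof. by apply/funext => x; rewrite /mon big_cons. Qed.

Lemma der_mon_high s l h x : uniq s -> (size l < size s)%N -> der s (mon l) h x = 0.
Proof.
elim: l s x => [|a l IH] s x us ls.
  case: s us ls => // i s _ _ /=; rewrite (der_ext s h _ (g := fun=> 1)); last by move=> y; rewrite /mon big_nil.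
  rewrite [X in _ - X](der_ext s h _ (g := fun=> 1)); last by move=> y; rewrite /mon big_nil.
  have c1 s' y z : der s' (fun=> 1 : F) h y = der s' (fun=> 1 : F) h z.
    by elim: s' y z => //= j s' IHs y z; rewrite (IHs (y + h j) (z + h j)) (IHs y z).
  by rewrite (c1 s _ x) subrr.
rewrite mon_cons der_coord // IH ?mulr0 ?add0r //; last exact: ltnW.
rewrite big_seq big1 // => j js; rewrite IH ?mulr0 ?rem_uniq // size_rem //.
by case: (size s) ls.
Qed.

Lemma der_mon_cons s a l h y : uniq s -> size s = (size l).+1 ->
  der s (mon (a :: l)) h y = \sum_(j <- s) h j 0 a * der (rem j s) (mon l) h (y + h j).
Proof. by move=> us sl; rewrite mon_cons der_coord // der_mon_high ?sl // mulr0 add0r. Qed.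

(** Taking off one variable after another assigns the variables to the directions bijectively. On
    the diagonal each of the (size l)! assignments contributes the monomial itself. *)
Lemma der_mon s l : uniq s -> size s = size l ->
  [/\ forall h y, der s (mon l) h y = der s (mon l) h 0,
      form [set i in s] (fun h => der s (mon l) h 0) &
      forall v, der s (mon l) [ffun=> v] 0 = (size l)`!%:R * mon l v].
Proof.
elim: l s => [|a l IH] s us sl.
  have -> : s = [::] by case: (s) sl.
  have e y : mon [::] y = 1 by rewrite /mon big_nil.
  split=> [h y||v]; rewrite /= ?e ?mulr1 //.
  rewrite (_ : [set i in [::]] = set0); last by apply/setP => i; rewrite !inE.
  by apply: (form_set0 (c := 1)) => h; rewrite ?e.
have rs j : j \in s -> uniq (rem j s) /\ size (rem j s) = size l.
  by move=> js; rewrite rem_uniq // size_rem // sl.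
have ex h y : der s (mon (a :: l)) h y = \sum_(j <- s) (if j \in s then h j 0 a * der (rem j s) (mon l) h 0 else 0).
  rewrite der_mon_cons //; apply: eq_big_seq => j js; rewrite js.
  by have [u1 u2] := rs j js; have [-> _ _] := IH _ u1 u2.
split=> [h y||v]; first by rewrite !ex.
  apply: (form_eq (fun h => esym (ex h 0))); apply: form_sum => j.
  case: (boolP (j \in s)) => js; last exact: form0.
  have [u1 u2] := rs j js; have [_ hf _] := IH _ u1 u2.
  have -> : [set i in s] = [set j] :|: [set i in rem j s].
    apply/setP => i; rewrite !inE (mem_rem_uniq j us) !inE; case: eqP => // ->; by rewrite js.
  apply: formM (@form_coord F n K j a) hf _; by rewrite disjoints1 inE (mem_rem_uniq j us) !inE eqxx.
rewrite ex (eq_big_seq (fun=> v 0 a * ((size l)`!%:R * mon l v))); last first.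
  move=> j js; rewrite js ffunE; have [u1 u2] := rs j js; by have [_ _ ->] := IH _ u1 u2.
rewrite big_const_seq count_predT sl iter_addr_0 mon_cons /= factS natrM -mulr_natl; ring.
Qed.

(* The polar form of x_b at basis vectors counts the matchings between b and these vectors. *)
Fixpoint matchings l : nat := if l is a :: l' then ((count_mem a l').+1 * matchings l')%N else 1%N.

Lemma der_mon_basis s l (b : 'I_K -> 'I_n) : uniq s -> size s = size l ->
  der s (mon l) [ffun j => delta_mx 0 (b j)] 0 =
  if perm_eq l (map b s) then (matchings l)%:R else 0.
Proof.
elim: l s => [|a l IH] s us sl.
  have -> : s = [::] by case: (s) sl.
  by rewrite /= /mon big_nil.
have rs j : j \in s -> uniq (rem j s) /\ size (rem j s) = size l.
  by move=> js; rewrite rem_uniq // size_rem // sl.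
rewrite der_mon_cons // (eq_big_seq (fun j => (a == b j)%:R * (if perm_eq (a :: l) (map b s) then (matchings l)%:R else 0))).
  rewrite -mulr_suml; case: ifP => [pe|_]; last by rewrite mulr0.
  rewrite -natr_sum /= mulnC natrM mulrC; congr (_ * _%:R).
  have := permP pe (pred1 a); rewrite /= eqxx add1n => ->.
  by rewrite count_map -sum1_count [RHS]big_mkcond /=; apply: eq_bigr => j _; rewrite eq_sym; case: eqP.
move=> j js; have [u1 u2] := rs j js; rewrite !ffunE !mxE eqxx /= eq_sym.
case: eqP => [ab|_]; last by rewrite !mul0r.
have [-> _ _] := der_mon u1 u2; rewrite !mul1r IH //; congr (if _ then _ else _).
rewrite -(perm_cons a) [in RHS](permPr (_ : perm_eq _ (map b (j :: rem j s)))) ?perm_map ?perm_to_rem //=.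
by rewrite ab.
Qed.

End MonomialFunctions.

(** * Polynomials as functions *)

Section Polynomials.
Variables (F : finFieldType) (n : nat).
Local Notation V := 'rV[F]_n.
Implicit Types (P Q G : {mpoly F[n]}) (m : multinom n) (v : V).

Definition ev P v : F := meval (fun i => v 0 i) P.
Definition vars m : seq 'I_n := flatten [seq nseq (m i) i | i <- enum 'I_n].

Lemma size_vars m : size (vars m) = mdeg m.
Proof.
rewrite size_flatten /shape -map_comp sumnE big_map mdegE big_enum /=.
by apply: eq_bigr => i _; rewrite size_nseq.
Qed.

Lemma count_vars m i : count_mem i (vars m) = m i.
Proof.
rewrite count_flatten -map_comp sumnE big_map big_enum /= (bigD1 i) //= count_nseq /= eqxx mul1n.
by rewrite big1 ?addn0 // => j ji; rewrite count_nseq /= (negbTE ji).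
Qed.

Lemma perm_vars m m' : perm_eq (vars m) (vars m') = (m == m').
Proof.
apply/idP/eqP => [/permP h|->]; last exact: perm_refl.
by apply/mnmP => i; have := h (pred1 i); rewrite /= !count_vars.
Qed.

Lemma ev_X m v : ev (mpolyX F m) v = mon (vars m) v.
Proof.
rewrite /ev mevalX /mon big_flatten /= big_map big_enum /=; apply: eq_bigr => i _.
by rewrite big_nseq iter_mulr_1.
Qed.

Lemma evE P v : ev P v = \sum_(m <- msupp P) mcoeff m P * mon (vars m) v.
Proof.
rewrite [in LHS](mpolyE P) /ev raddf_sum; apply: eq_bigr => m _.
by rewrite /= mevalZ -/(ev _ _) ev_X.
Qed.

Lemma evD P Q v : ev (P + Q) v = ev P v + ev Q v.
Proof. exact: mevalD. Qed.

Lemma evM P Q v : ev (P * Q) v = ev P v * ev Q v.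
Proof. exact: mevalM. Qed.

Lemma evZ c P v : ev (c *: P) v = c * ev P v.
Proof. exact: mevalZ. Qed.

Lemma ev_sum (T : Type) (r : seq T) (G : T -> {mpoly F[n]}) v :
  ev (\sum_(t <- r) G t) v = \sum_(t <- r) ev (G t) v.
Proof. exact: raddf_sum. Qed.

Lemma ev_lform P v : ev (lform P) v = \sum_(m <- msupp P | mdeg m == tdeg P) mcoeff m P * mon (vars m) v.
Proof.
rewrite /lform pihomogE /ev raddf_sum; apply: eq_bigr => m _.
by rewrite /= mevalZ -/(ev _ _) ev_X.
Qed.

Lemma mdeg_tdeg P m : m \in msupp P -> (mdeg m <= tdeg P)%N.
Proof. by move/msize_mdeg_lt => h; rewrite /tdeg -ltnS; apply: leq_trans h (leqSpred _). Qed.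

Lemma der_ev K (s : seq 'I_K) P h x : uniq s -> size s = tdeg P ->
  der s (ev P) h x = \sum_(m <- msupp P | mdeg m == tdeg P) mcoeff m P * der s (mon (vars m)) h x.
Proof.
move=> us sP; rewrite (der_ext s h x (evE P)) (der_sum _ (fun m => mcoeff m P) (fun m => mon (vars m))).
rewrite [RHS]big_mkcond; apply: eq_big_seq => m mP; case: eqP => // /eqP ne.
rewrite der_mon_high ?mulr0 // size_vars sP ltn_neqAle ne; exact: mdeg_tdeg.
Qed.

Lemma pfun_ev K P : pfun K (tdeg P) (ev P).
Proof.
move=> I cI; have us := enum_uniq I; have sz : size (enum I) = tdeg P by rewrite -cardE.
have dm m : mdeg m == tdeg P -> size (enum I) = size (vars m) by rewrite size_vars => /eqP ->.
split=> [h x|].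
  rewrite /polar !der_ev //; apply: eq_bigr => m mP; congr (_ * _).
  by have [-> _ _] := der_mon F us (dm m mP).
have -> : polar I (ev P) = fun h => \sum_(m <- msupp P) (if mdeg m == tdeg P then mcoeff m P * der (enum I) (mon (vars m)) h 0 else 0).
  by apply/funext => h; rewrite /polar der_ev // big_mkcond.
apply: form_sum => m; case: (boolP (mdeg m == tdeg P)) => mP; last exact: form0.
apply: formZ; have [_ hf _] := der_mon F us (dm m mP).
have eI : [set i in enum I] = I by apply/setP => i; rewrite inE mem_enum.
by rewrite eI in hf.
Qed.

Lemma polar_diag K (I : {set 'I_K}) P v : #|I| = tdeg P ->
  polar I (ev P) [ffun=> v] = (tdeg P)`!%:R * ev (lform P) v.
Proof.
move=> cI; have us := enum_uniq I; have sz : size (enum I) = tdeg P by rewrite -cardE.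
rewrite /polar der_ev // ev_lform mulr_sumr; apply: eq_bigr => m /eqP mP.
have sm : size (enum I) = size (vars m) by rewrite size_vars mP.
by have [_ _ ->] := der_mon F us sm; rewrite size_vars mP mulrCA.
Qed.

Lemma natr_neq0 p N : p \in [pchar F] -> (0 < N)%N -> (N < p)%N -> N%:R != 0 :> F.
Proof.
move=> hp N0 Np; rewrite -(dvdn_pcharf hp); apply/negP => /(dvdn_leq N0); lia.
Qed.

Lemma fact_neq0 p e : p \in [pchar F] -> (e < p)%N -> (e`!)%:R != 0 :> F.
Proof.
move=> hp; elim: e => [|e IH] ep; first by rewrite oner_eq0.
by rewrite factS natrM mulf_neq0 ?IH ?(natr_neq0 hp) //; exact: ltnW.
Qed.

Lemma matchings_neq0 p (l : seq 'I_n) : p \in [pchar F] -> (size l < p)%N -> (matchings l)%:R != 0 :> F.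
Proof.
move=> hp; elim: l => [|a l IH] lp /=; first by rewrite oner_eq0.
rewrite natrM mulf_neq0 ?IH ?(natr_neq0 hp) //; last exact: ltnW.
by apply: leq_ltn_trans lp; rewrite /= ltnS count_size.
Qed.

(** The polar form at the basis vectors of the variables of m0 isolates the coefficient of m0,
    multiplied by a number of matchings that is invertible since e < p. *)
Lemma homog_ev0 p e G : p \in [pchar F] -> (e < p)%N -> G \is ishomog1 e mdeg ->
  (forall v, ev G v = 0) -> G = 0.
Proof.
move=> hp ep hG h0; apply/eqP; rewrite -msupp_eq0; case eG: (msupp G) => [//|m0 r].
have m0G : m0 \in msupp G by rewrite eG inE eqxx.
have dG m : m \in msupp G -> mdeg m = e by move/(dhomog_mf hG).
pose s := enum 'I_e; have us : uniq s := enum_uniq _.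
have sz m : m \in msupp G -> size s = size (vars m) by move/dG; rewrite size_vars size_enum_ord.
have sz0 : size (vars m0) == e by rewrite size_vars dG.
pose b (j : 'I_e) : 'I_n := tnth (Tuple sz0) j.
have hb : map b s = vars m0 by exact: map_tnth_enum.
have := der_zero s [ffun j => delta_mx 0 (b j)] 0 h0.
rewrite (der_ext s _ 0 (evE G)) (der_sum _ (fun m => mcoeff m G) (fun m => mon (vars m))).
rewrite (bigD1_seq m0) ?msupp_uniq //= big_seq_cond big1 ?addr0 => [|m /andP[mG ne]]; last first.
  by rewrite der_mon_basis ?(sz m) // hb perm_vars (negbTE ne) mulr0.
rewrite der_mon_basis ?(sz m0) // hb perm_refl => /eqP.
rewrite mulf_eq0 (negbTE (matchings_neq0 hp _)) ?orbF; last by rewrite size_vars dG.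
by rewrite mcoeff_eq0 m0G.
Qed.

End Polynomials.

(** * Restriction to the diagonal *)

Section Diagonal.
Variables (F : finFieldType) (n K : nat).
Local Notation V := 'rV[F]_n.
Local Notation X := {ffun 'I_K -> V}.

Lemma form_diag (I : {set 'I_K}) (g : X -> F) : form I g ->
  exists2 G : {mpoly F[n]}, G \is ishomog1 #|I| mdeg & forall v, g [ffun=> v] = ev G v.
Proof.
move e: #|I| => d; elim: d I g e => [|d IH] I g e hg.
  exists (mpolyC n (g 0)).
    by apply/dhomogP => m; rewrite msuppC; case: ifP => // _; rewrite inE => /eqP ->; exact: mdeg0.
  move=> v; rewrite /ev mevalC; apply: (form_dep hg) => i.
  by move/eqP: e; rewrite cards_eq0 => /eqP ->; rewrite inE.
have /set0Pn[i iI] : I != set0 by rewrite -card_gt0 e.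
have ci : #|I :\ i| = d by move: e; rewrite (cardsD1 i) iI add1n => -[].
have /choice[G hG] : forall l : 'I_n, exists G : {mpoly F[n]}, G \is ishomog1 d mdeg /\
    forall v, g (upd [ffun=> v] i (delta_mx 0 l)) = ev G v.
  by move=> l; have [G h1 h2] := IH (I :\ i) _ ci (form_slice i (delta_mx 0 l) hg); exists G.
exists (\sum_(l < n) mpolyX F (mnm1 l) * G l).
  apply: rpred_sum => l _; rewrite -add1n; apply: dhomogM; last by have [] := hG l.
  by rewrite dhomogX; apply/eqP; exact: mdeg1.
move=> v; rewrite -[X in g X](upd_same _ i) ffunE {2}[v]row_sum_delta (lin1_sum _ _ _ (hg.1 i iI _)) ev_sum.
apply: eq_bigr => l _; rewrite evM; have [_ ->] := hG l; congr (_ * _).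
by rewrite /ev mevalXU.
Qed.

(* w collects the multipliers of the polynomials of Qs, the R_i of the relative rank. *)
Lemma Dec_diag (G0 : seq ({set 'I_K} * (X -> F))) (S : {set 'I_K}) r P (Qs : seq {mpoly F[n]}) : wfg G0 ->
  (forall p, p \in G0 -> p.1 \subset S -> exists (i : 'I_(size Qs)) c,
     #|p.1| = tdeg (nth 0%R Qs i) /\ forall v, p.2 [ffun=> v] = c * ev (lform (nth 0%R Qs i)) v) ->
  Dec G0 S r P ->
  exists (A B : 'I_r -> {mpoly F[n]}) (w : 'I_(size Qs) -> {mpoly F[n]}),
  [/\ forall l, exists2 a, (0 < a < #|S|)%N & A l \is ishomog1 a mdeg /\ B l \is ishomog1 (#|S| - a) mdeg,
      forall i, w i = 0 \/ (tdeg (nth 0%R Qs i) <= #|S|)%N /\ w i \is ishomog1 (#|S| - tdeg (nth 0%R Qs i)) mdeg &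
      forall v, P [ffun=> v] = ev (\sum_l A l * B l + \sum_i w i * lform (nth 0%R Qs i)) v].
Proof.
move=> wf hq; elim=> {r P} [P hP|r P Q A f g _ [A1 [B1 [w [h1 h2 h3]]]] A0 AS SA hf hg e|
   r P Q p g _ [A1 [B1 [w [h1 h2 h3]]]] pG pS hg e].
- exists (fun=> 0), (fun=> 0), (fun=> 0); split=> [[]|i|v] //; first by left.
  by rewrite hP big_ord0 add0r big1 /ev ?meval0 ?raddf0 // => i _; rewrite mul0r.
- have [GA hA eA] := form_diag hf; have [GB hB eB] := form_diag hg.
  have cS : (#|A| + #|S :\: A| = #|S|)%N by rewrite -(cardsID A S) (setIidPr AS).
  have cA : (0 < #|A|)%N by rewrite card_gt0.
  have cB : (0 < #|S :\: A|)%N by rewrite card_gt0.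
  exists (fun l => if unlift ord0 l is Some l' then A1 l' else GA),
         (fun l => if unlift ord0 l is Some l' then B1 l' else GB), w; split=> // [l|v].
    case: unliftP => [l' _|_]; first exact: h1.
    exists #|A|; first by rewrite cA -cS -[X in (X < _)%N]addn0 ltn_add2l.
    by rewrite -cS addKn.
  rewrite e h3 eA eB big_ord_recl !unlift_none !evD evM addrC addrA; congr (_ + _ + _).
  by rewrite !ev_sum; apply: eq_bigr => l _; rewrite !liftK.
- have [i [c [ci ec]]] := hq p pG pS; have [GB hB eB] := form_diag hg.
  have cS : (#|p.1| + #|S :\: p.1| = #|S|)%N by rewrite -(cardsID p.1 S) (setIidPr pS).
  exists A1, B1, (fun i' => w i' + (if i' == i then c *: GB else 0)); split=> // [i'|v].
    case: eqP => [->|_]; last by rewrite addr0; exact: h2.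
    have hGB : c *: GB \is ishomog1 (#|S| - tdeg (nth 0%R Qs i)) mdeg.
      by apply: dhomogZ; rewrite -ci -cS addKn.
    right; split; first by rewrite -ci -cS leq_addr.
    by case: (h2 i) => [->|[_ hw]]; [rewrite add0r|apply: dhomogD].
  rewrite e h3 ec eB !evD -addrA; congr (_ + _).
  rewrite [in RHS](eq_bigr (fun i' => w i' * lform (nth 0%R Qs i') + (if i' == i then c *: GB * lform (nth 0%R Qs i) else 0))); last first.
    by move=> i' _; rewrite /= mulrDl; congr (_ + _); case: eqP => [->|]; rewrite ?mul0r.
  rewrite big_split evD; congr (_ + _).
  by rewrite -big_mkcond big_pred1_eq evM evZ; ring.
Qed.

End Diagonal.

(** * From decompositions of polar forms to relative Schmidt rank *)

Section Ranks.
Variables (R : realType) (F : finFieldType) (n : nat).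
Implicit Types (P Q G : {mpoly F[n]}) (m : multinom n).

Lemma tdeg0 : tdeg (0 : {mpoly F[n]}) = 0%N.
Proof. by rewrite /tdeg mmeasure0. Qed.

Lemma tdeg_homog d G : G \is ishomog1 d mdeg -> G != 0 -> tdeg G = d.
Proof. by move=> hG G0; apply: (dhomog_uniq G0 _ hG); exact: dhomog_msize hG. Qed.

Lemma tdeg_homog_le d G : G \is ishomog1 d mdeg -> (tdeg G <= d)%N.
Proof. by move=> hG; case: (eqVneq G 0) => [->|/(tdeg_homog hG) ->]; rewrite ?tdeg0. Qed.

Lemma lform_homog P : lform P \is ishomog1 (tdeg P) mdeg.
Proof. exact: pihomogP. Qed.

Lemma lform_id d G : G \is ishomog1 d mdeg -> lform G = G.
Proof.
move=> hG; case: (eqVneq G 0) => [->|G0]; first by rewrite /lform pihomog0.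
by rewrite /lform (tdeg_homog hG G0) pihomog_dE.
Qed.

Lemma lform_neq0 P : P != 0 -> lform P != 0.
Proof.
move=> P0; have [m mP mt] : exists2 m, m \in msupp P & mdeg m = tdeg P.
  apply: contrapT => no; have : (mmeasure mdeg P <= tdeg P)%N.
    rewrite mmeasureE; apply/bigmax_leqP_seq => m mP _; rewrite ltn_neqAle mdeg_tdeg // andbT.
    by apply/eqP => e; apply: no; exists m.
  have : (0 < mmeasure mdeg P)%N by rewrite lt0n mmeasure_poly_eq0.
  by rewrite /tdeg; case: (mmeasure _ _) => // k _; rewrite ltnn.
apply: contraTneq mP => e; rewrite -mcoeff_eq0; apply/eqP.
rewrite [P in mcoeff m P](pihomog_partitionE (mf := mdeg) (leqnn _)) raddf_sum /= big1 // => k _.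
case: (eqVneq (k : nat) (tdeg P)) => [ek|ne]; first by have := e; rewrite /lform -ek => ->; rewrite mcoeff0.
apply: (dhomog_nemf_coeff (pihomogP _ _ _)); apply/negP => /eqP h.
by move/eqP: ne; apply; rewrite -h; exact: mt.
Qed.

Lemma tdeg_lform P : tdeg (lform P) = tdeg P.
Proof.
case: (eqVneq P 0) => [->|P0]; first by rewrite /lform pihomog0.
exact: (tdeg_homog (lform_homog P) (lform_neq0 P0)).
Qed.

Lemma rel_rk_tdeg0 (Qs : seq {mpoly F[n]}) P : tdeg P = 0%N -> (rel_rk R Qs P <= 0)%E.
Proof.
move=> P0; rewrite /rel_rk /rel_rk_homog; apply: ge_ereal_inf.
exists (rk R (lform P)).
  exists (fun=> 0); first by move=> i; left.
  by rewrite big1 ?addr0 // => i _; rewrite mul0r.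
by rewrite /rk /rk_homog !tdeg_lform P0.
Qed.

(** On the diagonal the decomposition is only an identity of functions; both sides being homogeneous
    of degree e < p, [homog_ev0] makes it one of polynomials. The terms in the ideal are moved to
    the left and become the multipliers. *)
Lemma rel_rk_le K p (G0 : seq ({set 'I_K} * ({ffun 'I_K -> 'rV[F]_n} -> F))) (I : {set 'I_K}) r g
    (Qs : seq {mpoly F[n]}) P :
  p \in [pchar F] -> (tdeg P < p)%N -> (0 < tdeg P)%N -> #|I| = tdeg P -> wfg G0 ->
  (forall p, p \in G0 -> p.1 \subset I -> exists2 q, q \in Qs & #|p.1| = tdeg q /\ p.2 = polar p.1 (ev q)) ->
  Dec G0 I r g -> (forall v, g [ffun=> v] = (tdeg P)`!%:R * ev (lform P) v) ->
  (rel_rk R Qs P <= (r%:R)%:E)%E.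
Proof.
move=> hp Pp P0 cI wf hq hDec hg.
have [p' p'G p'I|A [B [w [h1 h2 h3]]]] := Dec_diag (Qs := Qs) wf _ hDec.
  have [q qQ [cq eq]] := hq p' p'G p'I.
  have iq : (index q Qs < size Qs)%N by rewrite index_mem.
  exists (Ordinal iq), ((tdeg q)`!%:R); rewrite /= nth_index //; split=> // v.
  by rewrite eq polar_diag.
set e := tdeg P in Pp P0 cI hg *; rewrite cI in h1 h2.
have e0 := fact_neq0 hp Pp; pose c : F := (e`!%:R)^-1.
have hAB : \sum_l A l * B l \is ishomog1 e mdeg.
  apply: rpred_sum => l _; have [a /andP[_ ae] [hA hB]] := h1 l.
  by rewrite -(subnKC (ltnW ae)); exact: dhomogM.
have hw : \sum_i w i * lform (nth 0%R Qs i) \is ishomog1 e mdeg.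
  apply: rpred_sum => i _; case: (h2 i) => [->|[le hw]]; first by rewrite mul0r; exact: dhomog0.
  by rewrite -(subnK le); apply: dhomogM => //; exact: lform_homog.
have eL : lform P = c *: (\sum_l A l * B l + \sum_i w i * lform (nth 0%R Qs i)).
  apply/eqP; rewrite -subr_eq0; apply/eqP; apply: (homog_ev0 hp Pp).
    by apply: rpredB; [exact: lform_homog|apply: dhomogZ; exact: rpredD].
  move=> v; rewrite -scaleN1r evD !evZ -h3 hg mulN1r mulrA /c mulVf // mul1r subrr //.
pose H := \sum_l (c *: A l) * B l.
have hH : H \is ishomog1 e mdeg.
  rewrite /H (eq_bigr (fun l => c *: (A l * B l))) => [|l _]; last by rewrite scalerAl.
  by rewrite -scaler_sumr; exact: dhomogZ.
have sz := size_map (@lform F n) Qs.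
have nthL (i : 'I_(size [seq lform q | q <- Qs])) : nth 0%R [seq lform q | q <- Qs] i = lform (nth 0%R Qs (cast_ord sz i)).
  by rewrite (nth_map 0%R) //= -sz.
pose T (i : 'I_(size [seq lform q | q <- Qs])) := - c *: w (cast_ord sz i).
have eH : lform P + \sum_i T i * nth 0%R [seq lform q | q <- Qs] i = H.
  have -> : \sum_i T i * nth 0%R [seq lform q | q <- Qs] i = \sum_i - c *: w i * lform (nth 0%R Qs i).
    rewrite [RHS](reindex (cast_ord sz)) /=; last first.
      by exists (cast_ord (esym sz)) => i _; rewrite ?cast_ordK ?cast_ordKV.
    by apply: eq_bigr => i _; rewrite nthL.
  rewrite eL scalerDr -addrA; have -> : c *: (\sum_i w i * lform (nth 0%R Qs i)) + \sum_i - c *: w i * lform (nth 0%R Qs i) = 0.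
    by rewrite scaler_sumr -big_split big1 //= => i _; rewrite scaleNr mulNr -scalerAl subrr.
  by rewrite addr0 /H scaler_sumr; apply: eq_bigr => l _; rewrite scalerAl.
have hT i : T i = 0 \/ (tdeg (T i) + tdeg (nth 0%R [seq lform q | q <- Qs] i) <= tdeg (lform P))%N.
  rewrite nthL !tdeg_lform /T; case: (h2 (cast_ord sz i)) => [->|[le hwi]]; first by left; rewrite scaler0.
  by right; rewrite -/e -(subnK le) leq_add2r; exact: tdeg_homog_le (dhomogZ _ hwi).
rewrite /rel_rk /rel_rk_homog; apply: ge_ereal_inf; exists (rk R H).
  by exists T => //; rewrite eH.
(* As e > 0, degree 0 occurs only for H = 0, whose rank is 0 by convention. *)
rewrite /rk /rk_homog (lform_id hH); case: eqP => [_|/eqP H0]; first by rewrite lee_fin ler0n.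
have Hn : H != 0 by apply: contraNneq H0 => ->; rewrite tdeg0.
have tH : tdeg H = e by exact: tdeg_homog.
apply: ereal_inf_lbound; exists r => //; exists (fun l => c *: A l), B; split=> // l.
have [a /andP[a0 ae] [hA hB]] := h1 l; rewrite tH; have hcA := dhomogZ c hA.
split; [exact: homogE hcA| |exact: homogE hB|].
  exact: leq_ltn_trans (tdeg_homog_le hcA) ae.
by apply: leq_ltn_trans (tdeg_homog_le hB) _; rewrite ltn_subrL a0 P0.
Qed.

End Ranks.

Lemma flatten_split (E E' : Type) (g : E -> seq E') (s : seq E) u x v :
  flatten (map g s) = u ++ x :: v ->
  exists s1 y s2 c d, [/\ s = s1 ++ y :: s2, g y = c ++ x :: d,
    u = flatten (map g s1) ++ c & v = d ++ flatten (map g s2)].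
Proof.
elim: s u => [|y s IH] u /=; first by case: u.
move=> h; have [[d [ey ->]]|[u' [es ->]]] := cat_split h; first by exists [::], y, s, u, d.
have [s1 [z [s2 [c [d [-> ez -> ->]]]]]] := IH _ es.
by exists (y :: s1), z, s2, c, d; rewrite /= catA.
Qed.

Lemma flatten_nonempty (E : eqType) (s : seq (seq E)) :
  flatten [seq L <- s | L != [::]] = flatten s.
Proof. by elim: s => //= L s IH; case: eqP => [->|_] /=; rewrite IH. Qed.

Lemma mem_split (E : eqType) (s : seq E) x : x \in s -> exists s1 s2, s = s1 ++ x :: s2.
Proof. by case/splitPr => s1 s2; exists s1, s2. Qed.

Lemma bin_le_exp K i : ('C(K, i) <= 2 ^ K)%N.
Proof.
elim: K i => [|K IH] [|i]; rewrite ?bin0 ?expn_gt0 // binS expnS mul2n -addnn.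
exact: leq_add.
Qed.

(** * Polar towers of towers of polynomials *)

Section Layers.
Variables (R : realType) (F : finFieldType) (n d : nat).
Local Notation K := d.+1.
Implicit Types (L : seq {mpoly F[n]}) (Ls : seq (seq {mpoly F[n]})).

Definition eval_layer L := (tdeg (head 0%R L), [seq ev q | q <- L]).

Lemma layer_comb_homog L (c : 'I_(size L) -> F) : {in L &, forall p q, tdeg p = tdeg q} ->
  \sum_i c i *: lform (nth 0%R L i) \is ishomog1 (tdeg (head 0%R L)) mdeg.
Proof.
move=> hL; apply: rpred_sum => i _; apply: dhomogZ.
rewrite (hL (head 0%R L) (nth 0%R L i)) ?mem_nth //; first exact: lform_homog.
by case: (L) i => [[]|? ? _] //; exact: mem_head.
Qed.

Variables (p a t : nat) (Ls : seq (seq {mpoly F[n]})).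
Hypotheses (hp : p \in [pchar F]) (dp : (d < p)%N).
Hypothesis ne : forall L, L \in Ls -> L != [::].
Hypothesis same : forall L, L \in Ls -> {in L &, forall p q, tdeg p = tdeg q}.
Hypothesis led : forall L, L \in Ls -> forall q, q \in L -> (tdeg q <= d)%N.
(** A polynomial has at most 2^K polar forms, which all count in the regularity of the polar
    tower. *)
Hypothesis hreg : forall q1 L q2, Ls = q1 ++ L :: q2 ->
  forall c : {ffun 'I_(size L) -> F}, c != 0 ->
  forall r, (r <= a * (2 ^ K * size (flatten (L :: q2)) + t.+1) ^ a)%N ->
  ~ (rel_rk R (flatten q1) (\sum_i c i *: lform (nth 0 L i))%R <= (r%:R)%:E)%E.

Local Notation Tw := [seq eval_layer L | L <- Ls].

Lemma head_layer L : L \in Ls -> head 0%R L \in L.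
Proof. by move/ne; case: L => // q L _; exact: mem_head. Qed.

Lemma goodtw_layers : goodtw K Tw.
Proof.
move=> _ /mapP[L LLs ->]; have hL := head_layer LLs; split=> /=.
(* A layer of constants would have relative rank at most 0, against regularity. *)
- rewrite lt0n; apply/eqP => e0; have [q1 [q2 eq]] := mem_split LLs.
  have c0 : [ffun i : 'I_(size L) => 1] != 0 :> {ffun 'I_(size L) -> F}.
    have s0 : (0 < size L)%N by rewrite lt0n size_eq0 ne.
    apply/eqP => /ffunP/(_ (Ordinal s0)); rewrite !ffunE => /eqP; by rewrite oner_eq0.
  apply: (hreg eq c0 (leq0n _)); apply: rel_rk_tdeg0.
  have := tdeg_homog_le (layer_comb_homog [ffun i : 'I_(size L) => 1] (same LLs)).
  by rewrite e0 leqn0 => /eqP.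
- by rewrite ltnS (led LLs).
- move=> f /mapP[q qL ->]; rewrite (same LLs hL qL); exact: pfun_ev.
Qed.

Lemma msz_ptw_le q2 : (msz (ptw K [seq eval_layer L | L <- q2]) <= 2 ^ K * size (flatten q2))%N.
Proof.
have -> : msz (ptw K [seq eval_layer L | L <- q2]) = mu_of [seq eval_layer L | L <- q2] K.
  have := msz_subt_ptw [seq eval_layer L | L <- q2] [set: 'I_K].
  by rewrite subt_id => [->|L' _]; rewrite ?cardsT ?card_ord ?subsetT.
rewrite /mu_of big_map size_flatten /shape sumnE big_map big_distrr /=.
by apply: leq_sum => L _; rewrite size_map mulnC leq_mul2r bin_le_exp orbT.
Qed.

Lemma regular_layers : regular a t (ptw K Tw).
Proof.
have gT := goodtw_layers; have wT := wft_ptw gT.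
move=> T1 L' T2 eT; have wT1 : wft T1.
  by move=> L1 L1T; apply: wT; rewrite eT mem_cat L1T.
have [u [[y J] [v [ei eT1 eL' eT2]]]] := map_split eT; subst T1 L' T2.
have [s1 [y' [s2 [c1 [d1 [eTw ey eu ev']]]]]] := flatten_split ei.
have [q1 [L [q2 [eLs es1 ey' es2]]]] := map_split eTw.
have [sl1 [J' [sl2 [esl ec1 [eyy eJ] ed1]]]] := map_split ey; rewrite {}eJ {J'} in esl; rewrite -{}ey' {y'} in eTw ey ec1 eyy esl ed1.
have LLs : L \in Ls by rewrite eLs mem_cat inE eqxx orbT.
have cJ : #|J| = tdeg (head 0%R L).
  have : J \in slots K y.1 by rewrite -eyy esl mem_cat inE eqxx orbT.
  by rewrite mem_slots -eyy => /eqP.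
subst y; have sz : size (polar_layer (eval_layer L, J)).2 = size L by rewrite !size_map.
move=> c c0 r rle hD.
pose c' := [ffun i : 'I_(size L) => c 0 (cast_ord (esym sz) i)].
have c'0 : c' != 0.
  apply: contraNneq c0 => e; apply/eqP/rowP => i; rewrite mxE.
  by have /ffunP/(_ (cast_ord sz i)) := e; rewrite !ffunE cast_ordK.
set P' := \sum_i c' i *: lform (nth 0%R L i).
have hP' : P' \is ishomog1 (tdeg (head 0%R L)) mdeg := layer_comb_homog c' (same LLs).
apply: (hreg eLs c'0 (r := r)).
  apply: leq_trans rle _; rewrite leq_mul2l; apply/orP; right; apply: leq_expl; rewrite leq_add2r.
  apply: leq_trans (msz_ptw_le (L :: q2)).
  have -> : ptw K [seq eval_layer L | L <- L :: q2] = map (@polar_layer F K n) c1 ++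
      polar_layer (eval_layer L, J) :: map (@polar_layer F K n) v.
    rewrite /ptw -map_cons -map_cat ev' -es2; congr map.
    by rewrite [LHS](congr1 (cat^~ (idx K [seq eval_layer L0 | L0 <- q2])) ey) -catA.
  by rewrite msz_cat msz_cons leq_addl.
rewrite -/P'; case: (posnP (tdeg P')) => [t0|t0].
  by apply: le_trans (rel_rk_tdeg0 R _ t0) _; rewrite lee_fin ler0n.
have P'0 : P' != 0 by apply: contraTneq t0 => ->; rewrite tdeg0.
have tP' : tdeg P' = tdeg (head 0%R L) by exact: tdeg_homog.
have tPd : (tdeg P' <= d)%N by rewrite tP' (led LLs) ?head_layer.
apply: (@rel_rk_le R F n K p _ J r (comb c) (flatten q1) P' hp (leq_ltn_trans tPd dp) t0 _ (wfg_gens wT1) _ hD); first by rewrite tP'.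
  move=> p0 /mem_gens[_ /mapP[[z J2] zu ->] /= /mapP[_ /mapP[f fz ->] ->]] /= J2J.
  move: zu; rewrite eu mem_cat => /orP[/mem_idx /= [zs1 cz]|].
    move: zs1 fz cz; rewrite -es1 => /mapP[L2 L2q ->] /= /mapP[q qL2 ->] cz.
    have L2Ls : L2 \in Ls by rewrite eLs mem_cat L2q.
    exists q; first by apply/flattenP; exists L2.
    by rewrite cz (same L2Ls (head_layer L2Ls) qL2).
  (* The earlier polar layers of the same L lie on sets of the same size as J. One contained in J
     would equal J, which is listed only once; so they do not enter the decomposition. *)
  rewrite -ec1 => /mapP[J3 J3s [ez eJ3]]; have := enum_uniq [set I : {set 'I_K} | #|I| == tdeg (head 0%R L)].
  have e3 : J3 = J.
    have c3 : #|J3| = tdeg (head 0%R L).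
      by apply/eqP; rewrite -mem_slots [slots _ _]esl mem_cat J3s.
    by apply/eqP; rewrite eqEcard -eJ3 J2J eJ3 c3 cJ leqnn.
  rewrite -/(slots _ _) [slots _ _]esl cat_uniq => /and3P[_ /hasPn/(_ J)]; rewrite inE eqxx -e3 => /(_ isT).
  by rewrite J3s.
move=> v0; rewrite (lform_id hP') tP' /comb ev_sum mulr_sumr (reindex (cast_ord (esym sz))) /=; last first.
  by exists (cast_ord sz) => i _; rewrite ?cast_ordK ?cast_ordKV.
apply: eq_bigr => i _; rewrite evZ ffunE (nth_map (fun=> 0)) ?size_map // (nth_map 0%R) //.
have iL := mem_nth 0%R (ltn_ord i).
by rewrite polar_diag ?(same LLs iL (head_layer LLs)) // mulrCA.
Qed.

End Layers.

(** The values are p-th roots of unity, so the conjugate is the inverse. *)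
Lemma good_character (R : realType) (F : finFieldType) p (chi : F -> R[i]) : p \in [pchar F] ->
  additive_character chi -> nontrivial_character chi -> good_char chi.
Proof.
move=> hp [chi0 chiD] nt; split=> // a.
have chiX N : chi (a *+ N) = chi a ^+ N.
  by elim: N => [|N IH]; rewrite ?mulr0n ?expr0 // mulrS chiD IH exprS.
have p0 : (0 < p)%N by exact: prime_gt0 (pcharf_prime hp).
have n1 : Normc.normc (chi a) = 1.
  have ncX N : Normc.normc (chi a ^+ N) = Normc.normc (chi a) ^+ N.
    elim: N => [|N IH]; last by rewrite !exprS Normc.normcM IH.
    by rewrite !expr0 Normc.normc1.
  have := ncX p; rewrite -chiX mulrn_pchar // chi0 Normc.normc1 => /esym/eqP.
  by rewrite pexpr_eq1 ?normc_ge0 // => /eqP.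
have i1 : chi a * conjc (chi a) = 1 by rewrite -normc_sqr n1 expr1n.
have i2 : chi a * chi (- a) = 1 by rewrite -chiD subrr.
have u : chi a != 0 by apply/eqP => u0; move/eqP: i2; rewrite u0 mul0r eq_sym oner_eq0.
by apply: (mulfI u); rewrite i1 i2.
Qed.

(** * Bias on zero sets and the final constants *)

Section Points.
Variables (R : realType) (F : finFieldType) (n : nat).
Implicit Types (x : {ffun 'I_n -> F}) (P : {mpoly F[n]}).

Definition rowpt x : 'rV[F]_n := \row_i x i.

Lemma ev_rowpt P x : ev P (rowpt x) = meval x P.
Proof. by rewrite /ev; apply: meval_eq => i; rewrite mxE. Qed.

Lemma rowpt_bij : bijective rowpt.
Proof.
by exists (fun v : 'rV[F]_n => [ffun i => v 0 i]) => v; [apply/ffunP => i|apply/rowP => i]; rewrite ?(ffunE, mxE).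
Qed.

Lemma zf_rowpt (Ls : seq (seq {mpoly F[n]})) x :
  zf [seq eval_layer L | L <- Ls] (rowpt x) = (x \in zeros (flatten Ls)).
Proof.
rewrite inE /zf all_map; elim: Ls => //= L Ls ->; rewrite all_cat all_map; congr (_ && _).
by apply: eq_all => q; rewrite /= ev_rowpt.
Qed.

Lemma sum_zeros (K : nzRingType) (Z : {set {ffun 'I_n -> F}}) (g : 'rV[F]_n -> K) (z : 'rV[F]_n -> bool) :
  (forall x, z (rowpt x) = (x \in Z)) ->
  \sum_v (z v)%:R * g v = \sum_(x in Z) g (rowpt x).
Proof.
move=> hz; rewrite (reindex rowpt) /=; last exact: onW_bij rowpt_bij.
rewrite [RHS]big_mkcond; apply: eq_bigr => x _; rewrite hz; case: (_ \in _); by rewrite ?mul1r ?mul0r.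
Qed.

Lemma avg_bias (chi : F -> R[i]) Ls P :
  Normc.normc (avg (fun v => (zf [seq eval_layer L | L <- Ls] v)%:R * chi (ev P v))) =
  avg (fun v => (zf [seq eval_layer L | L <- Ls] v)%:R : R) * bias chi (zeros (flatten Ls)) P.
Proof.
have hz := zf_rowpt Ls; set Z := zeros _ in hz *; set Tw := map _ _ in hz *.
have eZ : \sum_v (zf Tw v)%:R = #|Z|%:R :> R.
  rewrite (eq_bigr (fun v => (zf Tw v)%:R * 1)) => [|v _]; last by rewrite mulr1.
  by rewrite (sum_zeros _ hz) sumr_const.
rewrite /bias /average /avg (sum_zeros _ hz) eZ.
rewrite (eq_bigr (fun x : {ffun 'I_n -> F} => chi (meval x P))) => [|x _]; last by rewrite ev_rowpt.
set S := \sum_(x in Z) _.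
have ncN N : Normc.normc (N%:R^-1 : R[i]) = N%:R^-1.
  by rewrite -(rmorph_nat (real_complex R)) -fmorphV normc_real // invr_ge0 ler0n.
rewrite !Normc.normcM !ncN -!mulrA; congr (_ * _); rewrite mulrA.
(* Both sides are 0 if Z is empty, by the convention on averages. *)
case: (eqVneq #|Z| 0%N) => [Z0|Z0]; last by rewrite divff ?mul1r // pnatr_eq0.
move/eqP: Z0; rewrite cards_eq0 => /eqP Z0.
by rewrite /S Z0 big_set0 cards0 /Normc.normc /= !expr0n addr0 sqrtr0 mulr0.
Qed.

End Points.

Lemma nat_powR_le (R : realType) (a c X r : nat) (Y : R) : 0 <= Y ->
  (r <= a * X ^ a)%N -> X%:R <= c%:R * Y -> r%:R <= (a * c ^ a)%:R * (Y `^ a%:R).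
Proof.
move=> Y0 rX XY; rewrite powR_mulrn // natrM natrX -mulrA -exprMn.
apply: le_trans (_ : (a * X ^ a)%:R <= _); first by rewrite ler_nat.
by rewrite natrM natrX ler_wpM2l // lerXn2r ?nnegrE ?mulr_ge0.
Qed.

Lemma tower_regularP (R : realType) (F : finFieldType) n (A B s : R) (Q : tower F n) q1 L q2
    (c : {ffun 'I_(size L) -> F}) : tower_regular A B s Q -> (Q : seq _) = q1 ++ L :: q2 -> c != 0 ->
  ((A * ((size (flatten (L :: q2)))%:R + s) `^ B)%:E <
    rel_rk R (flatten q1) (\sum_i c i *: lform (nth 0 L i))%R)%E.
Proof.
move=> reg eQ c0; have iQ : (size q1 < tower_height Q)%N.
  by rewrite /tower_height eQ size_cat /= addnS ltnS leq_addr.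
have := reg _ iQ; rewrite eQ drop_size_cat // take_size_cat // nth_cat ltnn subnn /=.
move=> h; apply: (lt_le_trans h); apply: ereal_inf_lbound; by exists c.
Qed.

Theorem theorem2p2 (R : realType) (d H : nat) :
  exists A B : R,
    forall (F : finFieldType) (p : nat), p \in [pchar F] -> (d < p)%N ->
    forall chi : F -> R[i],
      additive_character chi -> nontrivial_character chi ->
    forall (n : nat) (s : R), 0 < s ->
    forall (Q : tower F n) (P : {mpoly F[n]}),
      tower_regular A B s Q ->
      (tower_degree Q <= d)%N -> (tower_height Q <= H)%N ->
      (tdeg P <= d)%N ->
      bias chi (zeros (tower_polys Q)) P >= #|F|%:R `^ (- s) ->
      (rel_rk R (tower_polys Q) P <= (A * (1 + s) `^ B)%:E)%E.
Proof.
have [/(_ 1%N)[a1 hE] [a2 hB]] := poly_bias_rank R d.+1 H.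
(* The factor 2^(d+1) accounts for the polar forms, and 4 for the rounding of s: 2^(d+1) M + s + 3
   is at most w (M + s) for M at least 1. *)
pose a := (a1 + a2)%N; pose w := (2 ^ d.+1 + 4)%N.
exists (a * w ^ a)%:R, a%:R => F p hp dp chi addchi ntchi n s s0 Q P reg degQ htQ degP hbias.
have good := good_character hp addchi ntchi.
have q1 : 1 < #|F|%:R :> R by rewrite ltr1n card_F_gt1.
(* Levels are integers, so s is rounded up to u; the further unit in t is spent on the density of
   the zeros, of which only q^-1 q^-(fsz Tw) is used. *)
pose u := (Num.truncn s).+1; pose t := u.+1.
have su : s <= u%:R by exact/ltW/truncnS_gt.
have ts : t.+1%:R <= s + 3%:R.
  have /andP[+ _] := truncn_itv (ltW s0); rewrite /t /u => h.
  by rewrite -addn3 natrD lerD2r.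
(* Empty layers have no degree of their own and are regular for any constants; without them every
   layer has a head. *)
pose Ls := [seq L <- (Q : seq (seq {mpoly F[n]})) | L != [::]].
have eLs : flatten Ls = tower_polys Q by exact: flatten_nonempty.
have LsQ L : L \in Ls -> L \in (Q : seq (seq {mpoly F[n]})) by rewrite mem_filter => /andP[].
have ne L : L \in Ls -> L != [::] by rewrite mem_filter => /andP[].
have same L : L \in Ls -> {in L &, forall p q, tdeg p = tdeg q} by move/LsQ/layers_same_tdeg.
have led L : L \in Ls -> forall q, q \in L -> (tdeg q <= d)%N.
  move=> /LsQ LQ q qL; apply: leq_trans degQ; rewrite /tower_degree; apply: leq_bigmax_seq => //.
  by apply/flattenP; exists L.
have hreg q1' L q2 : Ls = q1' ++ L :: q2 -> forall c : {ffun 'I_(size L) -> F}, c != 0 ->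
    forall r, (r <= a * (2 ^ d.+1 * size (flatten (L :: q2)) + t.+1) ^ a)%N ->
    ~ (rel_rk R (flatten q1') (\sum_i c i *: lform (nth 0 L i))%R <= (r%:R)%:E)%E.
  move=> eL c c0 r rle; have [v1 [v2 [eQ e1 e2]]] := filter_split eL.
  have := tower_regularP reg eQ c0; rewrite -(flatten_nonempty v1) e1.
  have -> : flatten (L :: v2) = flatten (L :: q2) by rewrite /= -e2 flatten_nonempty.
  move=> h1 h2; have := lt_le_trans h1 h2; rewrite lte_fin => /lt_geF/negP; apply.
  have s1 : (0 < size (flatten (L :: q2)))%N.
    have : L != [::] by apply: ne; rewrite eL mem_cat inE eqxx orbT.
    by rewrite /= size_cat; case: (L).
  apply: nat_powR_le rle _; first by rewrite addr_ge0 ?ler0n // ltW.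
  rewrite -(ler1n R) in s1; rewrite /w !natrD natrM; move: s1 ts s0.
  have : (0 : R) <= (2 ^ d.+1)%:R by exact: ler0n.
  move: (size _)%:R (2 ^ _)%:R t.+1%:R => M b t'; clear => b0 M1 ts s0; nra.
pose Tw := [seq eval_layer L | L <- Ls].
have gT : goodtw d.+1 Tw by exact: (@goodtw_layers R F n d a t Ls ne same led hreg).
have rT : regular a t (ptw d.+1 Tw) by exact: (@regular_layers R F n d p a t Ls hp dp ne same led hreg).
have hT : (size Tw <= H)%N by rewrite size_map; apply: leq_trans htQ; rewrite size_filter count_size.
have rw a' : (a' <= a)%N -> regular a' t (ptw d.+1 Tw).
  by move=> aa; apply: regular_weaken rT => j; apply: pow_bound_le; rewrite ?addnS.
have [E1 _] := hE F chi n Tw t good gT hT (rw _ (leq_addr _ _)).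
case: (posnP (tdeg P)) => [P0|P0].
  by apply: le_trans (rel_rk_tdeg0 R _ P0) _; rewrite lee_fin mulr_ge0 // powR_ge0.
have q0 : 0 < #|F|%:R :> R by exact: lt_trans ltr01 q1.
have big : #|F|%:R ^- t * #|F|%:R ^- fsz Tw <= Normc.normc (avg (fun v => (zf Tw v)%:R * chi (ev P v))).
  rewrite avg_bias eLs /t -addn1 qVD -mulrA mulrC; apply: ler_pM.
  - by rewrite mulr_ge0 ?invr_ge0 ?exprn_ge0 // ltW.
  - by rewrite invr_ge0 exprn_ge0 // ltW.
  - apply: le_trans E1; rewrite ler_wpM2r ?invr_ge0 ?exprn_ge0 ?(ltW q0) //.
    rewrite mul1n; apply: (@le_trans _ _ (1 - #|F|%:R ^- 1)).
      rewrite expr1 lerBrDr -mulr2n -[_ *+ 2]mulr_natl ler_pdivrMr // mul1r ler_nat; exact: card_F_gt1.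
    by rewrite lerD2l lerN2; exact: qV_mono.
  apply: le_trans hbias; rewrite -powR_mulrn ?(ltW q0) // -powRN; apply: ler_powR; first exact: ltW.
  by rewrite lerN2.
have [I [r [cI rle hD]]] := hB F chi n Tw t (tdeg P) (ev P) good gT hT P0 (degP : (tdeg P < d.+1)%N)
  (@pfun_ev F n d.+1 P) (rw _ (leq_addl _ _)) big.
have rk_le : (rel_rk R (tower_polys Q) P <= (r%:R)%:E)%E.
  apply: (@rel_rk_le R F n d.+1 p _ I r _ _ P hp (leq_ltn_trans degP dp) P0 cI (wfg_gens (wft_ptw gT)) _ hD).
    move=> p0 /mem_gens[_ /mapP[[z J] /mem_idx /= [zT cJ] ->] /= /mapP[_ /mapP[f fz ->] ->]] /= _.
    move: zT fz cJ => /mapP[L LLs ->] /= /mapP[q qL ->] cJ.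
    exists q; first by rewrite -eLs; apply/flattenP; exists L.
    by rewrite cJ (same L LLs _ _ (head_layer ne LLs) qL).
  by move=> v; exact: polar_diag.
apply: le_trans rk_le _; rewrite lee_fin.
apply: (@nat_powR_le _ a w t.+1 r); first by rewrite addr_ge0 // ltW.
  by apply: leq_trans rle _; apply: pow_bound_le => //; exact: leq_addl.
rewrite /w natrD; move: ts s0; have : (0 : R) <= (2 ^ d.+1)%:R by exact: ler0n.
move: (2 ^ _)%:R t.+1%:R => b t'; clear => b0 ts s0; nra.
Qed.
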